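(* Let $m\ge3$ be an odd integer and $n$ an integer with $2m<n$. Let $f:[0,\infty)\to[0,\infty)$ be continuous with $f(t)=O(t^\sigma)$ as $t\to\infty$, where $0<\sigma<\frac{n}{n-2m}$. Let $v$ be a $C^{2m}$ nonnegative solution of $$0\le-\Delta^m v\le f(v)\quad\text{in }\mathbb{R}^n\setminus B_{1/2}(0).$$ Then $v(y)=O(|y|^b)$ as $|y|\to\infty$, where $$b=\frac{2m(n-2)}{n-\sigma(n-2m)}.$$
   Context: $\Delta^m$ is the $m$-fold iterated Laplacian; $B_{1/2}(0)$ is the open ball of radius $1/2$ about the origin. *)

(* Defs.v *)
From Stdlib Require Import Reals.
From mathcomp Require Import all_boot.

Set Implicit Arguments.
Unset Strict Implicit.
Unset Printing Implicit Defensive.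

Open Scope R_scope.

Definition pt (n : nat) := 'I_n -> R.

Definition enorm (n : nat) (x : pt n) : R :=
  sqrt (\big[Rplus/0]_(i < n) (x i ^ 2)).

Definition edist (n : nat) (x y : pt n) : R := enorm (fun i => x i - y i).

Definition upd (n : nat) (x : pt n) (i : 'I_n) (t : R) : pt n :=
  fun j => if j == i then t else x j.

Definition cont_on (n : nat) (U : pt n -> Prop) (g : pt n -> R) : Prop :=
  forall x, U x -> forall eps, 0 < eps -> exists delta, 0 < delta /\
    forall y, U y -> edist y x < delta -> Rabs (g y - g x) < eps.

(* D is the family of iterated partial derivatives of v up to order k on the
   open set U: D [::] = v, D (i :: l) = d/dx_i (D l), all continuous on U.
   So "v is C^k on U" means: such a family D exists. *)
Definition partials_upto (n : nat) (k : nat) (U : pt n -> Prop)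
    (v : pt n -> R) (D : seq 'I_n -> pt n -> R) : Prop :=
  (forall x, U x -> D [::] x = v x) /\
  (forall (l : seq 'I_n) (i : 'I_n) x, (size l < k)%nat -> U x ->
     derivable_pt_lim (fun t => D l (upd x i t)) (x i) (D (i :: l) x)) /\
  (forall l : seq 'I_n, (size l <= k)%nat -> cont_on U (D l)).

(* lapD D k l = Delta^k applied to D l, i.e.
   sum_{i1..ik} d_{ik}^2 ... d_{i1}^2 (D l) expressed through the family D. *)
Fixpoint lapD (n : nat) (D : seq 'I_n -> pt n -> R) (k : nat)
    (l : seq 'I_n) (x : pt n) : R :=
  match k with
  | O => D l x
  | S k' => \big[Rplus/0]_(i < n) lapD D k' (i :: i :: l) x
  end.

Definition lap_iter (n : nat) (D : seq 'I_n -> pt n -> R) (m : nat) (x : pt n) : R :=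
  lapD D m [::] x.

(* Main.v *)
Require Import Defs.
From Stdlib Require Import Reals Psatz ClassicalEpsilon FunctionalExtensionality.
From Coquelicot Require Import Coquelicot.
From mathcomp Require filter.
From HB Require Import structures.
From mathcomp Require Import all_boot.
From mathcomp Require Import zify.
Open Scope R_scope.

(* With w_k = Delta^k v and g = - w_m >= 0 (m is odd), only averages of the w_k
   against radial cutoffs are needed. For a profile q |-> q^k beta(q), the mean
   V_k(r) = r^-n int w_k(x) q^k beta(q) dx with q = |x - c|^2 / r^2 satisfies
   exactly the radial equation (r^(n-1) V_k')' = r^(n-1) V_(k+1), because the
   derivative in r of the kernel is a divergence.

   Around the origin, with beta supported in an annulus, V_0 >= 0 and V_m <= 0
   on [1, oo) force V_(m-1) to be bounded above with flux at least -C r^(n-2)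
   (otherwise V_(m-1), ..., V_0 would successively tend to -oo). Hence
   int_(|x| ~ R) v <= C R^(n+2m-2) and int_(|x| ~ R) g <= C R^(n-2).

   Around a point y0, with beta supported in a ball of radius rho ~ dist, V_0
   is the sum of an even polynomial of degree < 2m and of the radial Newtonian
   potential of g. The former is controlled by the L^1 bound on v, the latter,
   for g <= G0 and int g <= B = R^(n-2), by B a^(2m-n) where G0 a^n = B.

   Finally v(x) dist(x)^n is almost maximised over the ball of radius |y|/4
   around y: near the maximiser v is comparable to M = v(y0), so G0 = C M^sigma
   and M <= C R^(n+2m-2) / dist^n + C R^((n-2)2m/n) M^(sigma(n-2m)/n), whose last
   exponent is < 1. Absorbing it yields the bound by |y|^b. *)

(** * Riemann sums on grids *)

(** The obstacle is that g is controlled through f(v), so a bound for g near a point presupposes one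
    for v there, and v(y) alone says nothing about nearby values. Moving to a weighted near-maximum
    supplies it. The weight is dist^n because it cancels the factor dist^(-n) that the L^1 bound of
    v carries. The exponents then fit: 2m - 2 <= b because 2m < n, and sigma < n/(n-2m) says
    precisely that the power of M on the right is below 1.

    The factor q^k in the profiles comes from the second derivative in r: differentiating the flux
    replaces a profile G by (qG)', and an integration by parts turns this into qG tested against the
    Laplacian. The family of profiles therefore has to be closed under multiplication by q. The
    cutoff beta needs only a Lipschitz derivative, since derivatives in r are read off from
    quadratic remainders.

    Around y0 the homogeneous radial equations also have singular solutions. Regularity of v at the
    centre, in the form flux = O(r^(n-1)), excludes them and leaves even polynomials. *)

HB.instance Definition _ := Monoid.isComLaw.Build R 0 Rplus
  (fun x y z => esym (Rplus_assoc x y z)) Rplus_comm Rplus_0_l.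

Lemma Rsum_le (I : Type) (s : seq I) (F G : I -> R) :
  (forall i, F i <= G i) ->
  \big[Rplus/0]_(i <- s) F i <= \big[Rplus/0]_(i <- s) G i.
Proof.
move=> FG; elim: s => [|i s IH]; first by rewrite !big_nil; lra.
by rewrite !big_cons; have := FG i; lra.
Qed.

Lemma Rsum_scal (I : Type) (s : seq I) (a : R) (F : I -> R) :
  \big[Rplus/0]_(i <- s) (a * F i) = a * \big[Rplus/0]_(i <- s) F i.
Proof.
elim: s => [|i s IH]; first by rewrite !big_nil; lra.
by rewrite !big_cons IH; lra.
Qed.

Lemma Rsum_abs (I : Type) (s : seq I) (F : I -> R) :
  Rabs (\big[Rplus/0]_(i <- s) F i) <= \big[Rplus/0]_(i <- s) Rabs (F i).
Proof.
elim: s => [|i s IH]; first by rewrite !big_nil Rabs_R0; lra.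
rewrite !big_cons; apply: Rle_trans (Rabs_triang _ _) _; lra.
Qed.

Lemma Rsum_recr (K : nat) (F : nat -> R) :
  \big[Rplus/0]_(j < K.+1) F j = \big[Rplus/0]_(j < K) F j + F K.
Proof. by rewrite big_ord_recr. Qed.

Lemma Rsum_const (K : nat) (a : R) : \big[Rplus/0]_(j < K) a = INR K * a.
Proof.
elim: K => [|K IH]; first by rewrite big_ord0 /=; lra.
rewrite big_ord_recr IH S_INR /=; ring.
Qed.

Lemma Rsum_telescope (K : nat) (u : nat -> R) :
  \big[Rplus/0]_(j < K) (u j.+1 - u j) = u K - u 0%N.
Proof.
elim: K => [|K IH]; first by rewrite big_ord0; lra.
rewrite big_ord_recr IH /=; lra.
Qed.

Section grid.
Variable n : nat.
Implicit Types (h : pt n -> R) (x : pt n) (i : 'I_n).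

Lemma upd_same x i t : upd x i t i = t.
Proof. by rewrite /upd eqxx. Qed.

Lemma upd_id x i : upd x i (x i) = x.
Proof. by apply: functional_extensionality => j; rewrite /upd; case: eqP => [->|]. Qed.

Lemma upd_upd x i s t : upd (upd x i s) i t = upd x i t.
Proof. by apply: functional_extensionality => j; rewrite /upd; case: eqP. Qed.

Lemma upd_comm x i j s t : i != j -> upd (upd x i s) j t = upd (upd x j t) i s.
Proof.
move=> ij; apply: functional_extensionality => k; rewrite /upd.
by case: eqP => // ->; rewrite eq_sym (negbTE ij).
Qed.

(* The nodes j d and -(j+1) d, for j < K, are those of [-Kd, Kd). *)
Definition line_sum (d : R) (K : nat) i h : pt n -> R := fun x =>
  d * \big[Rplus/0]_(j < K)
    (h (upd x i (INR j * d)) + h (upd x i (- (INR j.+1 * d)))).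

(** Iterating one-dimensional sums reduces telescoping and support questions to one variable. The
    result is independent of the coordinates in [l], hence the arbitrary base point in
    [riemann_sum]. *)
Definition multi_sum d K (l : seq 'I_n) h := foldr (line_sum d K) h l.

Lemma line_sum_le d K i h h' : 0 <= d -> (forall x, h x <= h' x) ->
  forall x, line_sum d K i h x <= line_sum d K i h' x.
Proof.
move=> d0 hh x; apply: Rmult_le_compat_l => //; apply: Rsum_le => j.
by apply: Rplus_le_compat.
Qed.

Lemma line_sum_lin d K i a b h h' :
  line_sum d K i (fun x => a * h x + b * h' x) =
  fun x => a * line_sum d K i h x + b * line_sum d K i h' x.
Proof.
apply: functional_extensionality => x; rewrite /line_sum.
under eq_bigr => j _.
  have -> : (a * h (upd x i (INR j * d)) + b * h' (upd x i (INR j * d)) +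
    (a * h (upd x i (- (INR j.+1 * d))) + b * h' (upd x i (- (INR j.+1 * d))))) =
    a * (h (upd x i (INR j * d)) + h (upd x i (- (INR j.+1 * d)))) +
    b * (h' (upd x i (INR j * d)) + h' (upd x i (- (INR j.+1 * d)))) by ring.
  over.
by rewrite big_split !Rsum_scal /=; ring.
Qed.

Lemma multi_sum_le d K l h h' : 0 <= d -> (forall x, h x <= h' x) ->
  forall x, multi_sum d K l h x <= multi_sum d K l h' x.
Proof.
by move=> d0 hh; elim: l => //= i l IH; apply: line_sum_le.
Qed.

Lemma multi_sum_lin d K l a b h h' :
  multi_sum d K l (fun x => a * h x + b * h' x) =
  fun x => a * multi_sum d K l h x + b * multi_sum d K l h' x.
Proof. by elim: l => //= i l ->; apply: line_sum_lin. Qed.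

Lemma multi_sum_cst d K l c x :
  multi_sum d K l (fun=> c) x = (2 * INR K * d) ^ (size l) * c.
Proof.
elim: l x => [|i l IH] x /=; first by lra.
rewrite /line_sum; under eq_bigr => j _ do rewrite !IH.
rewrite Rsum_const; ring.
Qed.

Definition in_box (L : R) x := forall i, - L <= x i < L.

Definition supp_box (L : R) h := forall x, ~ in_box L x -> h x = 0.

Definition supp_box_on (L : R) (l : seq 'I_n) h :=
  forall x i, i \in l -> ~ (- L <= x i < L) -> h x = 0.

Lemma line_sum_supp d K L l i h : i \notin l ->
  supp_box_on L l h -> supp_box_on L l (line_sum d K i h).
Proof.
move=> il sh x j jl nL; rewrite /line_sum big1 ?Rmult_0_r// => k _.
have ji : (j == i) = false by apply/eqP => ji; rewrite -ji jl in il.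
by rewrite !(sh _ j) ?Rplus_0_l// /upd ji.
Qed.

(** The added nodes are [INR j * d] and [- (INR j.+1 * d)] with j >= K; both fall outside the
    half-open interval, where [h] vanishes. *)
Lemma line_sum_widen d K K' i h : 0 < d -> (K <= K')%N ->
  (forall x, ~ (- (INR K * d) <= x i < INR K * d) -> h x = 0) ->
  line_sum d K' i h = line_sum d K i h.
Proof.
move=> d0 KK sh; apply: functional_extensionality => x; rewrite /line_sum.
congr (_ * _); move: KK => /subnKC <-; elim: (K' - K)%N => [|p IH].
  by rewrite addn0.
have H : INR K * d <= INR (K + p) * d.
  by apply: Rmult_le_compat_r; [lra | apply/le_INR/leP/leq_addr].
rewrite addnS (Rsum_recr _ (fun j => h (upd x i (INR j * d)) + h (upd x i (- (INR j.+1 * d))))) IH !(sh (upd _ _ _)) ?upd_same ?Rplus_0_r//.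
  by rewrite S_INR; lra.
lra.
Qed.

Lemma multi_sum_supp d K L l l' h : (forall i, i \in l -> i \notin l') ->
  supp_box_on L l' h -> supp_box_on L l' (multi_sum d K l h).
Proof.
elim: l => [//|i l IH] ll sh /=; apply: line_sum_supp.
  by apply: ll; rewrite mem_head.
by apply: IH => // j jl; apply: ll; rewrite in_cons jl orbT.
Qed.

Lemma multi_sum_widen d K K' l h : uniq l -> 0 < d -> (K <= K')%N ->
  supp_box_on (INR K * d) l h ->
  multi_sum d K' l h = multi_sum d K l h.
Proof.
move=> ul d0 KK; elim: l ul => [//|i l IH] /= /andP[il ul] sh.
rewrite IH//; last by move=> x j jl; apply: sh; rewrite in_cons jl orbT.
apply: line_sum_widen => // x nx.
have sh' : supp_box_on (INR K * d) [:: i] (multi_sum d K l h).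
  apply: multi_sum_supp.
    by move=> j jl; rewrite inE; apply/eqP => ji; rewrite -ji jl in il.
  by move=> y j; rewrite inE => /eqP ->; apply: sh; rewrite mem_head.
by apply: (sh' _ i); rewrite ?inE.
Qed.

Definition shift d i h : pt n -> R := fun x => h (upd x i (x i + d)).

Lemma line_sum_shift_neq d K i j h : j != i ->
  line_sum d K j (shift d i h) = shift d i (line_sum d K j h).
Proof.
move=> ji; apply: functional_extensionality => x; rewrite /shift /line_sum.
congr (_ * _); apply: eq_bigr => k _; rewrite /upd eq_sym (negbTE ji).
by congr (h _ + h _); rewrite -/(upd _ _ _) -/(upd _ _ _) -/(upd _ _ _) -/(upd _ _ _) upd_comm.
Qed.

(** With u(k) = h(kd) - h(-kd), the pairing of kd with -(k+1)d makes the difference of the two sums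
    telescope to u(K) - u(0). Here u(0) = 0 trivially and u(K) = 0 because [h] vanishes at both
    ends, whence the open interval in the hypothesis. *)
Lemma line_sum_shift_eq d K i h : 0 < d ->
  (forall x, ~ (- (INR K * d) < x i < INR K * d) -> h x = 0) ->
  line_sum d K i (shift d i h) = line_sum d K i h.
Proof.
move=> d0 sh; apply: functional_extensionality => x.
apply: Rminus_diag_uniq; rewrite /line_sum -Rmult_minus_distr_l.
set A := bigop.body _ _ _; set B := bigop.body _ _ _.
suff -> : A = B by ring.
apply: Rminus_diag_uniq.
have -> : A - B = A + -1 * B by ring.
rewrite /A /B -Rsum_scal -big_split /=.
pose u (k : nat) := h (upd x i (INR k * d)) - h (upd x i (- (INR k * d))).
under eq_bigr => k _.
  rewrite /shift !upd_upd !upd_same.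
  have -> : INR k * d + d = INR k.+1 * d by rewrite S_INR; ring.
  have -> : - (INR k.+1 * d) + d = - (INR k * d) by rewrite S_INR; ring.
  have -> : h (upd x i (INR k.+1 * d)) + h (upd x i (- (INR k * d))) +
    -1 * (h (upd x i (INR k * d)) + h (upd x i (- (INR k.+1 * d)))) =
    u k.+1 - u k by rewrite /u; ring.
  over.
rewrite Rsum_telescope /u.
have -> : h (upd x i (INR K * d)) = 0 by apply: sh; rewrite upd_same; lra.
have -> : h (upd x i (- (INR K * d))) = 0 by apply: sh; rewrite upd_same; lra.
by rewrite /= Rmult_0_l Ropp_0; ring.
Qed.

Lemma multi_sum_shift d K l i h : uniq l -> 0 < d -> i \in l ->
  (forall x, ~ (- (INR K * d) < x i < INR K * d) -> h x = 0) ->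
  multi_sum d K l (shift d i h) = multi_sum d K l h.
Proof.
move=> + d0; elim: l => [//|j l IH] /= /andP[jl ul].
rewrite in_cons => /orP[/eqP ij|il] sh; last by rewrite IH.
have comm : multi_sum d K l (shift d i h) = shift d i (multi_sum d K l h).
  rewrite ij; elim: l jl ul {IH} => [//|k l IH] /=.
  rewrite in_cons negb_or => /andP[jk jl] /andP[kl ul].
  by rewrite IH// line_sum_shift_neq// eq_sym.
rewrite comm -ij; apply: line_sum_shift_eq => // x nx.
have {jl} : i \notin l by rewrite ij.
elim: l x nx {IH ul comm} => [|k l IH] x nx /=; first by move=> _; apply: sh.
rewrite in_cons negb_or => /andP[ik il].
rewrite /line_sum big1 ?Rmult_0_r// => p _.
by rewrite !IH ?Rplus_0_l// /upd (negbTE ik).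
Qed.

End grid.

(** * Compactness and an ultrafilter *)

Section compactness.

Fixpoint nthT n : Compactness.Tn n R -> nat -> R :=
  match n with
  | 0%N => fun _ _ => 0
  | S n' => fun t k => if k is k'.+1 then nthT n' t.2 k' else t.1
  end.

Fixpoint ofT n (u : nat -> R) : Compactness.Tn n R :=
  match n with
  | 0%N => tt
  | S n' => (u 0%N, ofT n' (fun k => u k.+1))
  end.

Lemma nthT_ofT n u k : (k < n)%N -> nthT n (ofT n u) k = u k.
Proof. by elim: n u k => [//|n IH] u [|k] //= kn; rewrite IH. Qed.

Lemma bounded_ofT n a b u : (forall k, (k < n)%N -> a <= u k <= b) ->
  bounded_n n (ofT n (fun=> a)) (ofT n (fun=> b)) (ofT n u).
Proof.
elim: n u => [//|n IH] u ab /=; split; first exact: ab.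
by apply: IH => k kn; apply: ab.
Qed.

Lemma close_nthT n d x t : close_n n d x t ->
  forall k, (k < n)%N -> Rabs (nthT n x k - nthT n t k) < d.
Proof.
elim: n x t => [//|n IH] [x1 x2] [t1 t2] /= [c1 c2] [|k] //= kn.
exact: IH.
Qed.

(** A Lebesgue number for a gauge. [compactness_value] gives it doubly negated and on iterated
    products, hence the classical step and the translation through [nthT] and [ofT]. *)
Lemma box_lebesgue n (delta : pt n -> R) (L : R) : (forall x, 0 < delta x) ->
  exists d, 0 < d /\ forall x : pt n, (forall i, - L <= x i <= L) ->
    exists t, (forall i, Rabs (x i - t i) < delta t) /\ d <= delta t.
Proof.
move=> d0.
pose fromT (t : Compactness.Tn n R) : pt n := fun i => nthT n t i.
case: (compactness_value n (ofT n (fun=> - L)) (ofT n (fun=> L))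
  (fun t => mkposreal _ (d0 (fromT t)))) => d Hd.
exists d; split; first exact: cond_pos.
move=> x xL; pose u k := if insub k is Some i then x i else 0.
have uE (i : 'I_n) : u i = x i by rewrite /u valK.
have ub k : (k < n)%N -> - L <= u k <= L.
  by move=> kn; rewrite (uE (Ordinal kn)).
have := Hd _ (bounded_ofT _ _ _ _ ub) => /Classical_Prop.NNPP [t [_ [ct dt]]].
exists (fromT t); split=> // i; have := close_nthT _ _ _ _ ct i (ltn_ord i).
by rewrite nthT_ofT// uE.
Qed.

End compactness.

Section pt_topology.
Variable n : nat.
Implicit Types (h : pt n -> R) (x y : pt n).

Lemma continuousP h x : continuous h x <->
  forall eps, 0 < eps -> exists delta, 0 < delta /\
    forall y, (forall i, Rabs (y i - x i) < delta) -> Rabs (h y - h x) < eps.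
Proof.
split=> [ch eps e0 | ch].
  have /ch [d Hd] : locally (h x) (fun z => Rabs (z - h x) < eps).
    by exists (mkposreal _ e0).
  exists d; split; first exact: cond_pos.
  by move=> y yx; apply: Hd => i; apply: yx.
move=> P [e He]; case: (ch e (cond_pos e)) => d [d0 Hd].
by exists (mkposreal _ d0) => y yx; apply/He/Hd => i; apply: yx.
Qed.

Lemma coord_continuous (i : 'I_n) x : continuous (fun y : pt n => y i) x.
Proof. by apply/continuousP => eps e0; exists eps; split=> // y; apply. Qed.

(** On [P] the gauge at t is at most 1/(1 + |h t|), so its uniform lower bound d gives 1 + |h t| <=
    1/d directly, without a finite subcover. Off [P] the gauge avoids [P], which forces the t
    attached to a point of [P] to lie in [P]. *)
Lemma bounded_on_compact h (P : pt n -> Prop) (L : R) :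
  (forall x, P x -> forall i, - L <= x i <= L) ->
  (forall x, P x -> continuous h x) ->
  (forall x, ~ P x -> exists d, 0 < d /\
     forall y, (forall i, Rabs (y i - x i) < d) -> ~ P y) ->
  exists M, forall x, P x -> Rabs (h x) <= M.
Proof.
move=> PL ch Pclosed.
have good x : exists d, 0 < d /\ (P x -> d <= / (1 + Rabs (h x))) /\
    forall y, (forall i, Rabs (y i - x i) < d) -> P y ->
      P x /\ Rabs (h y - h x) < 1.
  case: (excluded_middle_informative (P x)) => [Px|nPx].
    have [d [d0 Hd]] := (proj1 (continuousP _ _)) (ch x Px) 1 Rlt_0_1.
    have p : 0 < / (1 + Rabs (h x)).
      by apply: Rinv_0_lt_compat; have := Rabs_pos (h x); lra.
    exists (Rmin d (/ (1 + Rabs (h x)))); split; first exact: Rmin_pos.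
    split; first by move=> _; apply: Rmin_r.
    move=> y yx Py; split=> //; apply: Hd => i.
    by apply: Rlt_le_trans (yx i) _; apply: Rmin_l.
  have [d [d0 Hd]] := Pclosed x nPx.
  exists d; split=> //; split; first by move/nPx.
  by move=> y yx Py; case: (Hd y yx Py).
pose delta x := proj1_sig (constructive_indefinite_description _ (good x)).
have deltaP x := proj2_sig (constructive_indefinite_description _ (good x)).
have [d [d0 Hd]] := box_lebesgue n delta L (fun x => proj1 (deltaP x)).
exists (1 + / d) => x Px; have [t [xt dt]] := Hd x (PL x Px).
have [t0 [t1 t2]] := deltaP t; have [Pt hxt] := t2 x xt Px.
have {t1} := Rle_trans _ _ _ dt (t1 Pt) => dht.
have : 1 + Rabs (h t) <= / d.
  rewrite -[X in X <= _]Rinv_inv; apply: Rinv_le_contravar => //.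
have := Rabs_triang (h x - h t) (h t); have -> : h x - h t + h t = h x by ring.
lra.
Qed.

Lemma unif_continuous h (L : R) : (forall x, continuous h x) ->
  (forall x, (exists i, L < Rabs (x i)) -> h x = 0) ->
  forall eps, 0 < eps -> exists d, 0 < d /\
    forall x y, (forall i, Rabs (x i - y i) < d) -> Rabs (h x - h y) <= eps.
Proof.
move=> ch sh eps e0.
have e2 : 0 < eps / 2 by lra.
have good x : exists d, 0 < d /\ forall y, (forall i, Rabs (y i - x i) < 2 * d) ->
     Rabs (h y - h x) < eps / 2.
  have [d [d0 Hd]] := (proj1 (continuousP _ _)) (ch x) _ e2.
  by exists (d / 2); split; [lra | move=> y yx; apply: Hd => i; have := yx i; lra].
pose delta x := proj1_sig (constructive_indefinite_description _ (good x)).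
have deltaP x := proj2_sig (constructive_indefinite_description _ (good x)).
have [d [d0 Hd]] := box_lebesgue n delta L (fun x => proj1 (deltaP x)).
have key x y : (forall i, - L <= x i <= L) -> (forall i, Rabs (x i - y i) < d) ->
    Rabs (h x - h y) <= eps.
  move=> xL xy; have [t [xt dt]] := Hd x xL.
  have [t0 t1] := deltaP t; rewrite -/(delta t) in t0 t1.
  have hx : Rabs (h x - h t) < eps / 2 by apply: t1 => i; have := xt i; lra.
  have hy : Rabs (h y - h t) < eps / 2.
    apply: t1 => i; have := xt i; have := xy i.
    have := Rabs_triang (y i - x i) (x i - t i).
    rewrite (Rabs_minus_sym (y i)); have -> : y i - x i + (x i - t i) = y i - t i by ring.
    lra.
  have := Rabs_triang (h x - h t) (h t - h y).
  rewrite (Rabs_minus_sym (h t)); have -> : h x - h t + (h t - h y) = h x - h y by ring.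
  lra.
have inbox x : (forall i, - L <= x i <= L) \/ (exists i, L < Rabs (x i)).
  case: (excluded_middle_informative (exists i, L < Rabs (x i))) => [|nx]; first by right.
  left=> i; apply/Rabs_le_between/Rnot_lt_le => Li; apply: nx; by exists i.
exists d; split=> // x y xy; case: (inbox x) => [xL|xL]; first exact: key.
case: (inbox y) => [yL|yL].
  by rewrite Rabs_minus_sym; apply: key => // i; rewrite Rabs_minus_sym.
rewrite !sh// Rminus_0_r Rabs_R0; lra.
Qed.

End pt_topology.

Section ultra.

Lemma ultra_ex : exists U : (nat -> Prop) -> Prop,
  [/\ forall N0, U (fun N => (N0 <= N)%N),
      forall A B, U A -> U B -> U (fun N => A N /\ B N),
      forall (A B : nat -> Prop), (forall N, A N -> B N) -> U A -> U B,
      ~ U (fun=> False)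
    & forall A, U A \/ U (fun N => ~ A N)].
Proof.
have [U [UU sU]] := filter.ultraFilterLemma filter.eventually_filter.
have PU : filter.ProperFilter U := @filter.ultra_proper _ _ UU.
have FU : filter.Filter U := @filter.filter_filter _ _ PU.
exists U; split.
- by move=> N0; apply: sU; exists N0.
- by move=> A B UA UB; apply: (@filter.filterI _ _ FU).
- by move=> A B AB; apply: (@filter.filterS _ _ FU).
- exact: (@filter.filter_not_empty _ _ PU).
- by move=> A; apply: filter.in_ultra_setVsetC.
Qed.

End ultra.

(** * The mean functional *)

Definition ultra : (nat -> Prop) -> Prop :=
  proj1_sig (constructive_indefinite_description _ ultra_ex).

Lemma ultra_ge N0 : ultra (fun N => (N0 <= N)%N).
Proof. by rewrite /ultra; case: constructive_indefinite_description => U /= [H1 H2 H3 H4 H5]. Qed.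

Lemma ultraI A B : ultra A -> ultra B -> ultra (fun N => A N /\ B N).
Proof.
by rewrite /ultra; case: constructive_indefinite_description => U /= [? HI ? ? ?]; apply: HI.
Qed.

Lemma ultraS (A B : nat -> Prop) : (forall N, A N -> B N) -> ultra A -> ultra B.
Proof.
by rewrite /ultra; case: constructive_indefinite_description => U /= [? ? HS ? ?]; apply: HS.
Qed.

Lemma ultra_ex_elt (A : nat -> Prop) : ultra A -> exists N, A N.
Proof.
rewrite /ultra; case: constructive_indefinite_description => U /= [_ _ S U0 _] UA.
apply: Classical_Prop.NNPP => nA; apply: U0; apply: (S A) => // N AN; apply: nA.
by exists N.
Qed.

Lemma ultraC A : ultra A \/ ultra (fun N => ~ A N).
Proof. by rewrite /ultra; case: constructive_indefinite_description => U /= [H1 H2 H3 H4 H5]. Qed.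

Definition ulim_to (u : nat -> R) (l : R) :=
  forall eps, 0 < eps -> ultra (fun N => Rabs (u N - l) < eps).

(** The limit is the supremum of the levels that u reaches for ultrafilter-many N. The estimate from
    above uses that a set or its complement belongs to the ultrafilter. *)
Lemma ulim_ex u M : ultra (fun N => Rabs (u N) <= M) -> exists l, ulim_to u l.
Proof.
move=> uM; pose E x := ultra (fun N => x <= u N).
have bE : bound E.
  exists M => x Ex; have [N [xN NM]] := ultra_ex_elt _ (ultraI _ _ Ex uM).
  by move/Rabs_le_between: NM; lra.
have exE : exists x, E x.
  by exists (- M); apply: ultraS uM => N /Rabs_le_between; lra.
have [l [ub lub]] := completeness E bE exE.
exists l => eps e0.
have lo : ultra (fun N => l - eps < u N).
  apply: Classical_Prop.NNPP => nl.
  have : is_upper_bound E (l - eps / 2).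
    move=> x Ex; apply: Rnot_lt_le => lx; apply: nl.
    by apply: ultraS Ex => N; lra.
  by move/lub; lra.
have hi : ultra (fun N => u N < l + eps).
  case: (ultraC (fun N => l + eps <= u N)) => [/ub|]; first by lra.
  by apply: ultraS => N; lra.
by apply: ultraS (ultraI _ _ lo hi) => N [? ?]; apply/Rabs_lt_between'; split.
Qed.

Lemma ulim_le u u' l l' : ultra (fun N => u N <= u' N) ->
  ulim_to u l -> ulim_to u' l' -> l <= l'.
Proof.
move=> uu ul ul'; apply: Rnot_lt_le => ll.
have e0 : 0 < (l - l') / 2 by lra.
have [N [uuN [/Rabs_lt_between' ? /Rabs_lt_between' ?]]] :=
  ultra_ex_elt _ (ultraI _ _ uu (ultraI _ _ (ul _ e0) (ul' _ e0))).
lra.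
Qed.

Lemma ulim_unique u l l' : ulim_to u l -> ulim_to u l' -> l = l'.
Proof.
move=> ul ul'; apply: Rle_antisym; apply: ulim_le; eauto;
  by apply: ultraS (ultra_ge 0) => N _; apply: Rle_refl.
Qed.

Lemma ulim_lin u u' l l' a b : ulim_to u l -> ulim_to u' l' ->
  ulim_to (fun N => a * u N + b * u' N) (a * l + b * l').
Proof.
move=> ul ul' eps e0.
have p : 0 < 1 + Rabs a + Rabs b by have := Rabs_pos a; have := Rabs_pos b; lra.
have e1 : 0 < eps / (1 + Rabs a + Rabs b) by apply: Rdiv_lt_0_compat.
apply: ultraS (ultraI _ _ (ul _ e1) (ul' _ e1)) => N [].
set d := eps / _ => h h'.
have -> : a * u N + b * u' N - (a * l + b * l') = a * (u N - l) + b * (u' N - l') by ring.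
apply: Rle_lt_trans (Rabs_triang _ _) _; rewrite !Rabs_mult.
have -> : eps = d + Rabs a * d + Rabs b * d by rewrite /d; field; lra.
have := Rabs_pos a; have := Rabs_pos b => *.
have : Rabs a * Rabs (u N - l) <= Rabs a * d by apply: Rmult_le_compat_l => //; lra.
have : Rabs b * Rabs (u' N - l') <= Rabs b * d by apply: Rmult_le_compat_l => //; lra.
by have : 0 < d by []; lra.
Qed.

Section integral.
Variable n : nat.
Implicit Types (h : pt n -> R) (x y : pt n).

(** Step 1/(N+1) with (N+1)^2 nodes on either side: the mesh shrinks while the box [-(N+1), N+1)^n
    exhausts the space. *)
Definition riemann_sum h (N : nat) : R :=
  multi_sum n (/ INR N.+1) (N.+1 * N.+1) (enum 'I_n) h (fun=> 0).

(* The limit along an ultrafilter exists for every bounded function with bounded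
   support, so no integrability has to be proved; positivity, linearity and the
   vanishing on derivatives are all that is used of the Lebesgue integral. *)
Definition Lam h : R := epsilon (inhabits 0) (ulim_to (riemann_sum h)).

Definition bdd_supp (L : nat) (M : R) h :=
  (forall x, Rabs (h x) <= M) /\ supp_box n (INR L) h.

Definition bdd h := exists L M, bdd_supp L M h.

(** Once N >= L the growing box can be cut back to [-L, L)^n, which makes bounds on the sums uniform
    in N. *)
Lemma riemann_sum_narrow (L N : nat) h : (L <= N)%N -> supp_box n (INR L) h ->
  riemann_sum h N = multi_sum n (/ INR N.+1) (L * N.+1) (enum 'I_n) h (fun=> 0).
Proof.
move=> LN sh; have N0 : 0 < INR N.+1 by apply: lt_0_INR; apply/ltP.
rewrite /riemann_sum (multi_sum_widen _ _ (L * N.+1)) ?enum_uniq//.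
- exact: Rinv_0_lt_compat.
- by rewrite leq_mul2r; apply/orP; right; apply: leq_trans LN _.
- move=> x i _; rewrite mult_INR Rmult_assoc Rinv_r; last by lra.
  by rewrite Rmult_1_r => nx; apply: sh => bx; apply: nx; apply: bx.
Qed.

Lemma step_gt0 N : 0 < / INR N.+1.
Proof. by apply: Rinv_0_lt_compat; apply: lt_0_INR; apply/ltP. Qed.

Lemma riemann_sum_bound L M h N : (L <= N)%N -> bdd_supp L M h ->
  Rabs (riemann_sum h N) <= (2 * INR L) ^ n * M.
Proof.
move=> LN [hM sh]; rewrite (riemann_sum_narrow L)//.
have E c : (2 * INR L) ^ n * c = multi_sum n (/ INR N.+1) (L * N.+1) (enum 'I_n) (fun=> c) (fun=> 0).
  rewrite multi_sum_cst size_enum_ord mult_INR; congr (_ ^ _ * _).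
  by field; apply: not_0_INR.
apply/Rabs_le_between; split.
  have -> : - ((2 * INR L) ^ n * M) = (2 * INR L) ^ n * - M by ring.
  rewrite E; apply: multi_sum_le; first by apply/Rlt_le/step_gt0.
  by move=> x; have /Rabs_le_between := hM x; lra.
rewrite E; apply: multi_sum_le; first by apply/Rlt_le/step_gt0.
by move=> x; have /Rabs_le_between := hM x; lra.
Qed.

Lemma LamP h : bdd h -> ulim_to (riemann_sum h) (Lam h).
Proof.
move=> [L [M hb]]; apply: epsilon_spec.
apply: (ulim_ex _ ((2 * INR L) ^ n * M)); apply: ultraS (ultra_ge L) => N LN.
exact: riemann_sum_bound.
Qed.

Lemma supp_box_mono (L L' : R) h : L <= L' -> supp_box n L h -> supp_box n L' h.
Proof. by move=> LL sh x nx; apply: sh => bx; apply: nx => i; have := bx i; lra. Qed.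

Lemma bdd_mono h h' : bdd h' -> (forall x, Rabs (h x) <= Rabs (h' x)) -> bdd h.
Proof.
move=> [L [M [hM sh]]] hh; exists L, M; split.
  by move=> x; apply: Rle_trans (hh x) _.
move=> x nx; have := hh x; rewrite sh// Rabs_R0; have := Rabs_pos (h x).
by move=> a b; apply: Rabs_eq_0; lra.
Qed.

Lemma bdd_lin a b h h' : bdd h -> bdd h' -> bdd (fun x => a * h x + b * h' x).
Proof.
move=> [L [M [hM sh]]] [L' [M' [hM' sh']]].
exists (L + L')%N, (Rabs a * M + Rabs b * M'); split.
  move=> x; apply: Rle_trans (Rabs_triang _ _) _; rewrite !Rabs_mult.
  by apply: Rplus_le_compat; apply: Rmult_le_compat_l => //; apply: Rabs_pos.
have L0 := pos_INR L; have L0' := pos_INR L'.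
have le1 : INR L <= INR (L + L') by rewrite plus_INR; lra.
have le2 : INR L' <= INR (L + L') by rewrite plus_INR; lra.
move=> x nx; rewrite (supp_box_mono _ _ _ le1 sh)// (supp_box_mono _ _ _ le2 sh')//.
ring.
Qed.

Lemma Lam_lin a b h h' : bdd h -> bdd h' ->
  Lam (fun x => a * h x + b * h' x) = a * Lam h + b * Lam h'.
Proof.
move=> bh bh'; apply: (ulim_unique (riemann_sum (fun x => a * h x + b * h' x))).
  by apply: LamP; apply: bdd_lin.
suff -> : riemann_sum (fun x => a * h x + b * h' x) =
    fun N => a * riemann_sum h N + b * riemann_sum h' N.
  by apply: ulim_lin; apply: LamP.
by apply: functional_extensionality => N; rewrite /riemann_sum multi_sum_lin.
Qed.

Lemma Lam_le h h' : bdd h -> bdd h' -> (forall x, h x <= h' x) -> Lam h <= Lam h'.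
Proof.
move=> bh bh' hh; apply: ulim_le (LamP _ bh) (LamP _ bh').
apply: ultraS (ultra_ge 0) => N _; apply: multi_sum_le => //.
by apply/Rlt_le/step_gt0.
Qed.

Lemma multi_sum_eq_on d K (l : seq 'I_n) h h' x : 0 < d ->
  (forall y, (forall i, i \in l -> - (INR K * d) <= y i < INR K * d) ->
     (forall i, i \notin l -> y i = x i) -> h y = h' y) ->
  multi_sum n d K l h x = multi_sum n d K l h' x.
Proof.
move=> d0; elim: l x => [|i l IH] x hh /=; first by apply: hh.
have K0 := pos_INR K.
rewrite /line_sum; congr (_ * _); apply: eq_bigr => k _.
have kK : INR k.+1 <= INR K by apply/le_INR/leP.
have {}kK : INR k.+1 * d <= INR K * d by apply: Rmult_le_compat_r; lra.
have k0 : 0 <= INR k * d by apply: Rmult_le_pos; [apply: pos_INR | lra].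
have kS : INR k.+1 * d = INR k * d + d by rewrite S_INR; ring.
have aux t : - (INR K * d) <= t < INR K * d ->
    multi_sum n d K l h (upd x i t) = multi_sum n d K l h' (upd x i t).
  move=> tK; apply: IH => y yl yn; apply: hh => j; rewrite in_cons.
    case: (boolP (j \in l)) => [jl _|jl]; first exact: yl.
    by rewrite orbF => /eqP ji; rewrite yn// ji upd_same.
  by rewrite negb_or => /andP[ji jl]; rewrite yn// /upd (negbTE ji).
by congr (_ + _); apply: aux; lra.
Qed.

Definition box_ind (L : R) x : R :=
  if excluded_middle_informative (in_box n L x) then 1 else 0.

Lemma box_ind_bdd (L : nat) : bdd (box_ind (INR L)).
Proof.
exists L, 1; split=> x.
  by rewrite /box_ind; case: (excluded_middle_informative (in_box n (INR L) x)) => ?; rewrite ?Rabs_R1 ?Rabs_R0; lra.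
by rewrite /box_ind; case: excluded_middle_informative.
Qed.

(** The nontriviality of [Lam]: the nodes fill the half-open cube exactly, so every Riemann sum with
    N >= 1 equals 2^n. Positivity of all masses descends from this. *)
Lemma Lam_box_gt0 : 0 < Lam (box_ind 1).
Proof.
have b1 : bdd (box_ind 1) by apply: (box_ind_bdd 1).
have cst c : ulim_to (fun=> c) c.
  by move=> eps e0; apply: ultraS (ultra_ge 0) => N _; rewrite Rminus_diag Rabs_R0.
apply: (Rlt_le_trans _ (2 ^ n)); first by apply: pow_lt; lra.
apply: ulim_le (cst _) (LamP _ b1); apply: ultraS (ultra_ge 1) => N N1.
have s1 : supp_box n (INR 1) (box_ind 1).
  by move=> x; rewrite /box_ind; case: excluded_middle_informative.
rewrite (riemann_sum_narrow 1)// (multi_sum_eq_on _ _ _ _ (fun=> 1)).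
- rewrite multi_sum_cst size_enum_ord mul1n Rmult_assoc Rinv_r; last exact: not_0_INR.
  by rewrite !Rmult_1_r; apply: Rle_refl.
- exact: step_gt0.
- move=> y yl _; rewrite /box_ind; case: excluded_middle_informative => // nb.
  case: nb => i; have := yl i (mem_enum _ _); rewrite mul1n Rinv_r//.
  exact: not_0_INR.
Qed.

(* Forward difference quotients have vanishing Riemann sums, by telescoping, and
   approximate the derivative uniformly. *)
Lemma Lam_deriv0 i h (hd : pt n -> R) : bdd h ->
  (forall x, is_derive (fun t => h (upd x i t)) (x i) (hd x)) ->
  (forall x, continuous hd x) -> bdd hd /\ Lam hd = 0.
Proof.
move=> bh dh chd; have [L [M [hM sh]]] := bh; have L0 := pos_INR L.
(* If some |x j| exceeds L, the function t |-> h(upd x i t) vanishes near x i, so its derivative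
   does too. *)
have hd0 x : (exists j, INR L < Rabs (x j)) -> hd x = 0.
  move=> [j Lj]; have e0 : 0 < Rabs (x j) - INR L by lra.
  have tri t : Rabs (x i) <= Rabs (t - x i) + Rabs t.
    rewrite (Rabs_minus_sym t) -[X in Rabs X <= _](_ : x i - t + t = _); last by ring.
    exact: Rabs_triang.
  have dz : is_derive (fun=> 0 : R) (x i) (hd x).
    apply: is_derive_ext_loc (dh x); exists (mkposreal _ e0) => t tx.
    have {}tx : Rabs (t - x i) < Rabs (x j) - INR L by apply: tx.
    apply: sh => /(_ j); rewrite /upd; case: eqP => [ji|_] bx.
      have : Rabs t <= INR L by apply/Rabs_le_between; lra.
      by rewrite ji in tx; have := tri t; lra.
    have : Rabs (x j) <= INR L by apply/Rabs_le_between; lra.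
    by move: Lj; lra.
  by rewrite -(is_derive_unique _ _ _ dz) Derive_const.
have [M' hM'] : exists M', forall x, (forall i, - INR L <= x i <= INR L) -> Rabs (hd x) <= M'.
  apply: (bounded_on_compact _ _ _ (INR L)) => // x nx.
  have [j Lj] : exists j, INR L < Rabs (x j).
    apply: Classical_Prop.NNPP => nj; apply: nx => j; apply/Rabs_le_between/Rnot_lt_le => Lj.
    by apply: nj; exists j.
  exists (Rabs (x j) - INR L); split; first lra.
  move=> y /(_ j) yx /(_ j) /Rabs_le_between yL.
  have := Rabs_triang (x j - y j) (y j); rewrite (Rabs_minus_sym (x j)).
  have -> : x j - y j + y j = x j by ring.
  lra.
have nin x : ~ (forall i, - INR L <= x i <= INR L) -> exists j, INR L < Rabs (x j).
  move=> nx; apply: Classical_Prop.NNPP => nj; apply: nx => j.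
  by apply/Rabs_le_between/Rnot_lt_le => Lj; apply: nj; exists j.
have bhd : bdd hd.
  exists L.+1, (Rabs M'); split.
    move=> x; case: (excluded_middle_informative (forall i, - INR L <= x i <= INR L)) => [bx|/nin/hd0 ->].
      by apply: Rle_trans (hM' x bx) _; apply: Rle_abs.
    by rewrite Rabs_R0; apply: Rabs_pos.
  move=> x nx; apply/hd0/nin => bx; apply: nx => j; rewrite S_INR; have := bx j; lra.
split=> //.
apply: (ulim_unique _ _ _ (LamP _ bhd)) => eps e0.
(* Volume of a box that contains the support of [hd] and, once the step is below 1, that of the
   shifted function. *)
pose c := (2 * INR (L + 2)) ^ n.
have c0 : 0 <= c by apply: pow_le; have := pos_INR (L + 2); lra.
have e1 : 0 < eps / (c + 1) by apply: Rdiv_lt_0_compat; lra.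
have [d [d0 Hd]] := unif_continuous _ hd (INR L) chd hd0 _ e1.
have [N0 HN0] : exists N0 : nat, forall N, (N0 <= N)%N -> / INR N.+1 < Rmin d 1.
  have m0 : 0 < Rmin d 1 by apply: Rmin_pos; lra.
  have [N1 HN1] := nfloor_ex (/ Rmin d 1) (Rlt_le _ _ (Rinv_0_lt_compat _ m0)).
  exists N1 => N NN; rewrite -(Rinv_inv (Rmin d 1)); apply: Rinv_lt_contravar.
    by apply: Rmult_lt_0_compat; [apply: Rinv_0_lt_compat | apply: lt_0_INR; apply/ltP].
  by apply: Rlt_le_trans (proj2 HN1) _; rewrite -S_INR; apply/le_INR/leP.
apply: ultraS (ultra_ge (maxn N0 (L + 2))) => N; rewrite geq_max => /andP[NN0 NL].
have := HN0 N NN0; set s := / INR N.+1 => sd.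
have s0 : 0 < s := step_gt0 N.
have sm := Rmin_l d 1; have sm1 := Rmin_r d 1.
(* The error of the difference quotient. The quotient has Riemann sum 0 by [multi_sum_shift], so
   [hd] and [q] have the same sum; the mean value theorem and uniform continuity of [hd] make [q]
   small. *)
pose q x := hd x - (shift n s i h x - h x) / s.
have qb : bdd_supp (L + 2) (eps / (c + 1)) q.
  split=> x.
    pose F t := h (upd x i t).
    have dF t : derivable_pt_lim F t (hd (upd x i t)).
      apply/is_derive_Reals; have := dh (upd x i t); rewrite upd_same.
      by apply: is_derive_ext => u; rewrite upd_upd.
    have xs : x i < x i + s by lra.
    have [t [Ft tx]] := MVT_cor2 F _ (x i) (x i + s) xs (fun t _ => dF t).
    have Fx : F (x i) = h x by rewrite /F upd_id.
    rewrite /q /shift -Fx -/(F (x i + s)) Ft.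
    have -> : hd (upd x i t) * (x i + s - x i) / s = hd (upd x i t) by field; lra.
    apply: Hd => j; rewrite /upd; case: eqP => [->|_].
      by rewrite Rabs_minus_sym Rabs_right; lra.
    by rewrite Rminus_diag Rabs_R0.
  move=> nx; have [j nj] : exists j, ~ (- INR (L + 2) <= x j < INR (L + 2)).
    apply: Classical_Prop.NNPP => nj; apply: nx => j; apply: Classical_Prop.NNPP => njj.
    by apply: nj; exists j.
  rewrite plus_INR /= in nj.
  rewrite /q /shift hd0; last first.
    exists j; apply: Rnot_le_lt => /Rabs_le_between; lra.
  rewrite !sh; first by field; lra.
    by move=> /(_ j); lra.
  by move=> /(_ j); rewrite /upd; case: eqP => [ji|_]; [rewrite -ji|]; lra.
have bq : bdd q by exists (L + 2)%N, (eps / (c + 1)).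
have -> : riemann_sum hd N = riemann_sum q N.
  rewrite /riemann_sum -/s.
  have -> : hd = fun x => 1 * q x + 1 * ((/ s) * shift n s i h x + (- / s) * h x).
    by apply: functional_extensionality => x; rewrite /q; field; lra.
  rewrite !multi_sum_lin (multi_sum_shift _ _ _ _ i)//; first by ring.
  - exact: enum_uniq.
  - exact: mem_enum.
  - move=> x nx; apply: sh => /(_ i) xL; apply: nx.
    have -> : INR (N.+1 * N.+1) * s = INR N.+1.
      by rewrite mult_INR /s; field; apply: not_0_INR.
    have : INR (L + 2) <= INR N.+1 by apply/le_INR/leP; apply: leq_trans NL _.
    by rewrite plus_INR /=; lra.
rewrite Rminus_0_r; apply: Rle_lt_trans (riemann_sum_bound _ _ _ _ NL qb) _.
rewrite -/c; have -> : c * (eps / (c + 1)) = eps - eps / (c + 1) by field; lra.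
lra.
Qed.

End integral.

(** * Linearity of the mean functional and calculus of squared distances *)

Section lam_calculus.
Variable n : nat.
Implicit Types (h : pt n -> R) (x y c : pt n).
Local Notation Lam := (Lam n).
Local Notation bdd := (bdd n).

Lemma bdd0 : bdd (fun=> 0).
Proof. by exists 0%N, 0; split=> // x; rewrite Rabs_R0; lra. Qed.

Lemma bdd_scal a h : bdd h -> bdd (fun x => a * h x).
Proof.
move=> bh; have -> : (fun x => a * h x) = fun x => a * h x + 0 * h x.
  by apply: functional_extensionality => x; ring.
exact: bdd_lin.
Qed.

Lemma bdd_plus h h' : bdd h -> bdd h' -> bdd (fun x => h x + h' x).
Proof.
move=> bh bh'; have -> : (fun x => h x + h' x) = fun x => 1 * h x + 1 * h' x.
  by apply: functional_extensionality => x; ring.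
exact: bdd_lin.
Qed.

Lemma Lam_scal a h : bdd h -> Lam (fun x => a * h x) = a * Lam h.
Proof.
move=> bh; have -> : (fun x => a * h x) = fun x => a * h x + 0 * h x.
  by apply: functional_extensionality => x; ring.
by rewrite Lam_lin//; ring.
Qed.

Lemma Lam_plus h h' : bdd h -> bdd h' -> Lam (fun x => h x + h' x) = Lam h + Lam h'.
Proof.
move=> bh bh'; have -> : (fun x => h x + h' x) = fun x => 1 * h x + 1 * h' x.
  by apply: functional_extensionality => x; ring.
by rewrite Lam_lin//; ring.
Qed.

Lemma Lam0 : Lam (fun=> 0) = 0.
Proof.
have -> : (fun=> 0) = (fun x : pt n => 0 * 0) by apply: functional_extensionality => x; ring.
by rewrite (Lam_scal 0 (fun=> 0) bdd0); ring.
Qed.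

Lemma Lam_ge0 h : bdd h -> (forall x, 0 <= h x) -> 0 <= Lam h.
Proof. by move=> bh h0; rewrite -Lam0; apply: Lam_le => //; apply: bdd0. Qed.

Lemma Lam_abs_le h h' : bdd h' -> (forall x, Rabs (h x) <= h' x) ->
  Rabs (Lam h) <= Lam h'.
Proof.
move=> bh' hh.
have bh : bdd h.
  apply: (bdd_mono _ _ h') => // x; apply: Rle_trans (hh x) _; apply: Rle_abs.
apply/Rabs_le_between; split; last first.
  by apply: Lam_le => // x; have /Rabs_le_between := hh x; lra.
have -> : - Lam h' = Lam (fun x => -1 * h' x) by rewrite Lam_scal//; ring.
apply: Lam_le => //; first exact: bdd_scal.
by move=> x; have /Rabs_le_between := hh x; lra.
Qed.

Lemma bdd_Rsum (s : seq 'I_n) (F : 'I_n -> pt n -> R) : (forall i, bdd (F i)) ->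
  bdd (fun x => \big[Rplus/0]_(i <- s) F i x).
Proof.
move=> bF; elim: s => [|i s IH].
  suff -> : (fun x => \big[Rplus/0]_(i <- [::]) F i x) = fun=> 0 by apply: bdd0.
  by apply: functional_extensionality => x; rewrite big_nil.
suff -> : (fun x => \big[Rplus/0]_(j <- i :: s) F j x) =
    fun x => F i x + \big[Rplus/0]_(j <- s) F j x by apply: bdd_plus.
by apply: functional_extensionality => x; rewrite big_cons.
Qed.

Lemma Lam_Rsum (s : seq 'I_n) (F : 'I_n -> pt n -> R) : (forall i, bdd (F i)) ->
  Lam (fun x => \big[Rplus/0]_(i <- s) F i x) = \big[Rplus/0]_(i <- s) Lam (F i).
Proof.
move=> bF; elim: s => [|i s IH].
  rewrite big_nil; have -> : (fun x => \big[Rplus/0]_(i <- [::]) F i x) = fun=> 0.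
    by apply: functional_extensionality => x; rewrite big_nil.
  exact: Lam0.
have -> : (fun x => \big[Rplus/0]_(j <- i :: s) F j x) =
    fun x => F i x + \big[Rplus/0]_(j <- s) F j x.
  by apply: functional_extensionality => x; rewrite big_cons.
by rewrite Lam_plus ?IH ?big_cons//; apply: bdd_Rsum.
Qed.

(** Squared distances are smooth everywhere, so balls, shells and cutoffs are all expressed through
    them; [enorm] enters only by translation. *)
Definition sqdist c x : R := \big[Rplus/0]_(i < n) (x i - c i) ^ 2.

Definition origin : pt n := fun=> 0.

Lemma sqdist_ge0 c x : 0 <= sqdist c x.
Proof.
apply: (big_ind (fun s => 0 <= s)) => [|a b|i _]; [lra | lra | exact: pow2_ge_0].
Qed.

Lemma sqdist_coord c x i : (x i - c i) ^ 2 <= sqdist c x.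
Proof.
rewrite /sqdist (bigD1 i)//= -[X in X <= _]Rplus_0_r.
apply: Rplus_le_compat_l.
apply: (big_ind (fun s => 0 <= s)) => [|a b|j _]; [lra | lra | exact: pow2_ge_0].
Qed.

Lemma sqdist_self c : sqdist c c = 0.
Proof. by rewrite /sqdist big1// => i _; ring. Qed.

Lemma sqdist_sym c x : sqdist c x = sqdist x c.
Proof. by apply: eq_bigr => i _; ring. Qed.

(** Takes the place of the triangle inequality: 2ab <= e a^2 + b^2/e. The value e = 1 serves for
    crude inclusions, a small e for the sharp one in [depth_half]. *)
Lemma sqdist_split e c y x : 0 < e ->
  sqdist c x <= (1 + e) * sqdist c y + (1 + / e) * sqdist y x.
Proof.
move=> e0; rewrite /sqdist -!Rsum_scal -big_split /=; apply: Rsum_le => i.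
have -> : x i - c i = (y i - c i) + (x i - y i) by ring.
set a := y i - c i; set b := x i - y i.
have : 0 <= / e * (e * a - b) ^ 2.
  by apply: Rmult_le_pos; [apply/Rlt_le/Rinv_0_lt_compat | apply: pow2_ge_0].
have -> : / e * (e * a - b) ^ 2 = e * a ^ 2 - 2 * a * b + / e * b ^ 2 by field; lra.
have -> : (1 + e) * a ^ 2 + (1 + / e) * b ^ 2 =
  (a + b) ^ 2 + (e * a ^ 2 - 2 * a * b + / e * b ^ 2) by ring.
lra.
Qed.

Lemma enorm_sqdist x : enorm x = sqrt (sqdist origin x).
Proof.
by rewrite /enorm /sqdist; congr sqrt; apply: eq_bigr => i _; rewrite /origin Rminus_0_r.
Qed.

Lemma Rsum_continuous (s : seq 'I_n) (F : 'I_n -> pt n -> R) x :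
  (forall i, continuous (F i) x) ->
  continuous (fun y => \big[Rplus/0]_(i <- s) F i y) x.
Proof.
move=> cF; elim: s => [|i s IH].
  apply: (continuous_ext (fun=> 0)) => [y|]; first by rewrite big_nil.
  exact: continuous_const.
apply: (continuous_ext (fun y => plus (F i y) (\big[Rplus/0]_(i <- s) F i y))).
  by move=> y; rewrite big_cons.
exact: continuous_plus.
Qed.

Lemma sub_continuous c i x : continuous (fun y : pt n => y i - c i) x.
Proof.
apply: (continuous_minus (fun y : pt n => y i) (fun=> c i)).
  exact: coord_continuous.
exact: continuous_const.
Qed.

Lemma sqdist_continuous c x : continuous (sqdist c) x.
Proof.
apply: Rsum_continuous => i.
apply: (continuous_ext (fun y : pt n => mult (y i - c i) (y i - c i))).
  by move=> y; rewrite /mult /= Rmult_1_r.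
by apply: continuous_mult; apply: sub_continuous.
Qed.

Lemma sqdist_upd c x i t :
  sqdist c (upd x i t) = sqdist c x - (x i - c i) ^ 2 + (t - c i) ^ 2.
Proof.
rewrite /sqdist (bigD1 i)//= [in RHS](bigD1 i)//= upd_same.
rewrite (eq_bigr (fun j => (x j - c j) ^ 2)); first by rewrite /=; ring.
by move=> j /negbTE ji; rewrite /upd ji.
Qed.

Lemma sqdist_derive c x i :
  is_derive (fun t => sqdist c (upd x i t)) (x i) (2 * (x i - c i)).
Proof.
apply: (is_derive_ext (fun t => sqdist c x - (x i - c i) ^ 2 + (t - c i) ^ 2)).
  by move=> t; rewrite sqdist_upd.
by auto_derive => //; ring.
Qed.

Lemma sqdist_bdd_supp (hi : R) h c M : (forall x, Rabs (h x) <= M) ->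
  (forall x, hi < sqdist c x -> h x = 0) -> bdd h.
Proof.
move=> hM sh.
have bound x i : sqdist c x <= hi -> Rabs (x i) <= Rabs (c i) + (1 + Rabs hi).
  move=> xh; have := sqdist_coord c x i.
  have := Rle_abs hi => hh q; have := Rabs_triang (x i - c i) (c i).
  have -> : x i - c i + c i = x i by ring.
  suff : Rabs (x i - c i) <= 1 + Rabs hi by lra.
  rewrite -pow2_abs in q; have := Rabs_pos (x i - c i); have := Rabs_pos hi; nra.
pose T := 1 + Rabs hi + \big[Rplus/0]_(i < n) Rabs (c i).
have [L HL] : exists L : nat, T < INR L.
  have T0 : 0 <= T.
    rewrite /T; have := Rabs_pos hi.
    suff : 0 <= \big[Rplus/0]_(i < n) Rabs (c i) by lra.
    by apply: (big_ind (fun s => 0 <= s)) => [|a b|j _]; [lra | lra | exact: Rabs_pos].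
  have [L [? ?]] := nfloor_ex T T0.
  by exists L.+1; rewrite S_INR.
exists L, M; split=> // x nx; apply: sh; apply: Rnot_le_lt => xh; apply: nx => i.
have := bound x i xh.
have : Rabs (c i) <= \big[Rplus/0]_(i < n) Rabs (c i).
  rewrite (bigD1 i)//= -[X in X <= _]Rplus_0_r; apply: Rplus_le_compat_l.
  by apply: (big_ind (fun s => 0 <= s)) => [|a b|j _]; [lra | lra | exact: Rabs_pos].
move=> h1 h2; have : Rabs (x i) < INR L by rewrite /T in HL; lra.
by move/Rabs_lt_between; lra.
Qed.

(** A quadratic remainder survives integration, so this form of differentiability permits
    differentiating under [Lam] without a convergence theorem. *)
Lemma quad_is_derive (F : R -> R) t0 D C s0 : 0 < s0 ->
  (forall s, Rabs s < s0 -> Rabs (F (t0 + s) - F t0 - s * D) <= C * s ^ 2) ->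
  is_derive F t0 D.
Proof.
move=> s00 HF; apply/is_derive_Reals => eps e0.
have C0 : 0 < Rabs C + 1 by have := Rabs_pos C; lra.
have d0 : 0 < Rmin s0 (eps / (Rabs C + 1)).
  by apply: Rmin_pos => //; apply: Rdiv_lt_0_compat.
exists (mkposreal _ d0) => s sn0 /= sd.
have sd1 := Rlt_le_trans _ _ _ sd (Rmin_l _ _).
have sd2 := Rlt_le_trans _ _ _ sd (Rmin_r _ _).
have p : 0 < Rabs s by apply: Rabs_pos_lt.
have -> : (F (t0 + s) - F t0) / s - D = (F (t0 + s) - F t0 - s * D) / s by field.
rewrite Rabs_div//; apply/Rlt_div_l => //.
apply: Rle_lt_trans (HF s sd1) _.
have -> : s ^ 2 = Rabs s * Rabs s by rewrite -pow2_abs; ring.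
have : Rabs s * (Rabs C + 1) < eps by apply/Rlt_div_r.
have := Rle_abs C; nra.
Qed.

End lam_calculus.

(** * Radial cutoffs and integration by parts *)

Section radial.
Variable n : nat.
Implicit Types (h : pt n -> R) (x y c : pt n) (g dg : R -> R).
Local Notation Lam := (Lam n).
Local Notation bdd := (bdd n).
Local Notation sqdist := (sqdist n).
Local Notation origin := (origin n).

Definition supp_in (a b : R) g := forall q, 0 <= q -> ~ (a <= q <= b) -> g q = 0.

(* The cutoff x |-> g (tau |x - c|^2), with g supported in [a, b], is supported
   in a compact subset of {|x|^2 > u0}, uniformly near tau. *)
Definition adm (u0 : R) c (a b tau : R) := exists lo hi s0,
  [/\ u0 < lo, 0 < s0, forall s, Rabs s < s0 -> 0 < tau + s &
   forall x s, Rabs s < s0 -> a <= (tau + s) * sqdist c x <= b ->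
     lo <= sqdist origin x <= hi].

Lemma adm_gt0 u0 c a b tau : adm u0 c a b tau -> 0 < tau.
Proof.
by move=> [? [? [s0 [_ s00 /(_ 0) + _]]]]; rewrite Rabs_R0 Rplus_0_r; apply.
Qed.

Lemma shell_coord lo hi x : lo <= sqdist origin x <= hi ->
  forall i, - (1 + Rabs hi) <= x i <= 1 + Rabs hi.
Proof.
move=> [_ xh] i; apply/Rabs_le_between.
have := sqdist_coord n origin x i; rewrite (_ : origin i = 0)// Rminus_0_r -pow2_abs.
have h1 := Rle_abs hi; have h0 := Rabs_pos hi; set X := Rabs (x i) => q.
by apply: Rnot_lt_le => xx; nra.
Qed.

Lemma shell_closed lo hi x : ~ (lo <= sqdist origin x <= hi) ->
  exists d, 0 < d /\ forall y, (forall i, Rabs (y i - x i) < d) ->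
    ~ (lo <= sqdist origin y <= hi).
Proof.
move=> nx.
have [e [e0 He]] : exists e, 0 < e /\ forall z, Rabs (z - sqdist origin x) < e ->
    ~ (lo <= z <= hi).
  case: (Rlt_le_dec (sqdist origin x) lo) => xl.
    exists (lo - sqdist origin x); split=> [|z /Rabs_lt_between]; lra.
  exists (sqdist origin x - hi); split=> [|z /Rabs_lt_between]; lra.
have [d [d0 Hd]] := (proj1 (continuousP _ _ _)) (sqdist_continuous n origin x) e e0.
by exists d; split=> // y yx; apply/He/Hd.
Qed.

Lemma shell_bounded lo hi h :
  (forall x, lo <= sqdist origin x <= hi -> continuous h x) ->
  exists M, 0 <= M /\ forall x, lo <= sqdist origin x <= hi -> Rabs (h x) <= M.
Proof.
move=> ch; have [M HM] := bounded_on_compact n h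
  (fun x => lo <= sqdist origin x <= hi) (1 + Rabs hi) (shell_coord lo hi) ch (shell_closed lo hi).
exists (Rabs M); split; first exact: Rabs_pos.
by move=> x xs; apply: Rle_trans (HM x xs) _; apply: Rle_abs.
Qed.

Lemma radial_continuous g c tau x : (forall q, continuous g q) ->
  continuous (fun y => g (tau * sqdist c y)) x.
Proof.
move=> cg; apply: (continuous_comp (fun y => tau * sqdist c y) g) => //.
apply: (continuous_scal_r tau (sqdist c)); exact: sqdist_continuous.
Qed.

(** [A] is controlled only where |x|^2 > u0. The product is nevertheless continuous everywhere,
    since every other point has a neighbourhood on which the cutoff is zero. *)
Lemma cut_continuous u0 c a b tau A g : adm u0 c a b tau -> supp_in a b g ->
  (forall x, u0 < sqdist origin x -> continuous A x) -> (forall q, continuous g q) ->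
  (forall x, continuous (fun y => A y * g (tau * sqdist c y)) x) /\
  bdd (fun y => A y * g (tau * sqdist c y)).
Proof.
move=> ad sg cA cg; have tau0 := adm_gt0 _ _ _ _ _ ad.
have [lo [hi [s0 [ulo s00 ts H]]]] := ad.
have g0 x : ~ (lo <= sqdist origin x <= hi) -> g (tau * sqdist c x) = 0.
  move=> nx; apply: sg; first by apply: Rmult_le_pos; [lra | apply: sqdist_ge0].
  by move=> ab; apply: nx; apply: (H x 0); rewrite ?Rabs_R0 ?Rplus_0_r.
have cF x : continuous (fun y => A y * g (tau * sqdist c y)) x.
  case: (Rlt_le_dec u0 (sqdist origin x)) => xu.
    by apply: (continuous_mult A); [apply: cA | apply: radial_continuous].
  have nx : ~ (lo <= sqdist origin x <= hi) by lra.
  have [d [d0 Hd]] := shell_closed lo hi x nx.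
  apply: (continuous_ext_loc _ (fun=> 0)); last exact: continuous_const.
  exists (mkposreal _ d0) => y yx; rewrite g0 ?Rmult_0_r//.
  by apply: Hd => i; apply: yx.
split=> //; have [M [M0 HM]] := shell_bounded lo hi _ (fun x _ => cF x).
apply: (sqdist_bdd_supp n hi _ origin M) => x.
  case: (excluded_middle_informative (lo <= sqdist origin x <= hi)) => [/HM//|/g0 ->].
  by rewrite Rmult_0_r Rabs_R0.
by move=> xh; rewrite g0 ?Rmult_0_r//; lra.
Qed.

(** [hd] is the i-th partial derivative of A times the cutoff, so [Lam_deriv0] applies; where [A] is
    uncontrolled the product is locally zero. *)
Lemma cut_ibp u0 c a b tau i A dA g dg : adm u0 c a b tau ->
  supp_in a b g -> supp_in a b dg ->
  (forall x, u0 < sqdist origin x -> continuous A x) ->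
  (forall x, u0 < sqdist origin x -> continuous dA x) ->
  (forall x, u0 < sqdist origin x ->
     is_derive (fun t => A (upd x i t)) (x i) (dA x)) ->
  (forall q, continuous dg q) -> (forall q, is_derive g q (dg q)) ->
  let hd x := dA x * g (tau * sqdist c x) +
     (A x * (2 * tau * (x i - c i))) * dg (tau * sqdist c x) in
  bdd hd /\ Lam hd = 0.
Proof.
move=> ad sg sdg cA cdA dAE cdg dgE hd.
have cg q : continuous g q by apply: ex_derive_continuous; exists (dg q); apply: dgE.
have [c1 b1] := cut_continuous _ _ _ _ _ _ _ ad sg cA cg.
have [c2 b2] := cut_continuous _ _ _ _ _ _ _ ad sg cdA cg.
have cA' x : u0 < sqdist origin x -> continuous (fun y => A y * (2 * tau * (y i - c i))) x.
  move=> xu; apply: (continuous_mult A); first exact: cA.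
  by apply: (continuous_scal_r (2 * tau) (fun y : pt n => y i - c i)); apply: sub_continuous.
have [c3 b3] := cut_continuous _ _ _ _ _ _ _ ad sdg cA' cdg.
apply: (Lam_deriv0 _ i _ _ b1); last first.
  by move=> x; apply: (continuous_plus (fun y => dA y * g (tau * sqdist c y))).
move=> x; have tau0 := adm_gt0 _ _ _ _ _ ad.
have [lo [hi [s0 [ulo s00 ts H]]]] := ad.
have out y : ~ (lo <= sqdist origin y <= hi) -> ~ (a <= tau * sqdist c y <= b).
  by move=> ny ab; apply: ny; apply: (H y 0); rewrite ?Rabs_R0 ?Rplus_0_r.
have q0 y : 0 <= tau * sqdist c y by apply: Rmult_le_pos; [lra | apply: sqdist_ge0].
case: (Rlt_le_dec u0 (sqdist origin x)) => xu.
  have d1 := dAE x xu.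
  have d2 : is_derive (fun t => g (tau * sqdist c (upd x i t))) (x i)
      (2 * tau * (x i - c i) * dg (tau * sqdist c x)).
    have d3 : is_derive (fun t => tau * sqdist c (upd x i t)) (x i) (tau * (2 * (x i - c i))).
      by apply: is_derive_scal; apply: sqdist_derive.
    have := dgE (tau * sqdist c (upd x i (x i))); rewrite upd_id => d4.
    have := is_derive_comp g (fun t => tau * sqdist c (upd x i t)) (x i) _ _ _ d3.
    rewrite upd_id => /(_ _ d4).
    have -> : scal (tau * (2 * (x i - c i))) (dg (tau * sqdist c x)) =
      2 * tau * (x i - c i) * dg (tau * sqdist c x) by rewrite /scal /= /mult /=; ring.
    by [].
  apply/is_derive_Reals; move/is_derive_Reals: d1 => d1; move/is_derive_Reals: d2 => d2.
  have := derivable_pt_lim_mult _ _ _ _ _ d1 d2; rewrite upd_id /hd.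
  have -> : dA x * g (tau * sqdist c x) +
    A x * (2 * tau * (x i - c i) * dg (tau * sqdist c x)) =
    dA x * g (tau * sqdist c x) + A x * (2 * tau * (x i - c i)) * dg (tau * sqdist c x) by ring.
  by [].
have nx : ~ (lo <= sqdist origin x <= hi) by lra.
rewrite /hd sg ?sdg//; try exact: out.
have -> : dA x * 0 + A x * (2 * tau * (x i - c i)) * 0 = 0 by ring.
have [d [d0 Hd]] := shell_closed lo hi x nx.
apply: (is_derive_ext_loc (fun=> 0)); last exact: is_derive_const.
exists (mkposreal _ d0) => t tx; rewrite sg ?Rmult_0_r//; apply: out; apply: Hd => j.
by rewrite /upd; case: eqP => [->|_]; [apply: tx | rewrite Rminus_diag Rabs_R0].
Qed.

(** A global C^{1,1} condition, phrased so that it can be inserted under [Lam] with p and q both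
    multiples of |x - c|^2. *)
Definition quad_rem g dg := exists K, 0 <= K /\
  forall p q, Rabs (g p - g q - (p - q) * dg q) <= K * (p - q) ^ 2.

Lemma quad_rem_derive g dg (q : R) : quad_rem g dg -> is_derive g q (dg q).
Proof.
move=> [K [K0 HK]]; apply: (quad_is_derive _ _ _ K 1); first lra.
move=> s _; have := HK (q + s) q.
by have -> : q + s - q = s by ring.
Qed.

(** Adding the remainder estimates for (p, q) and (q, p) leaves (p - q)(dg p - dg q). *)
Lemma quad_rem_lip g dg : quad_rem g dg -> exists K, 0 <= K /\
  forall p q, Rabs (dg p - dg q) <= K * Rabs (p - q).
Proof.
move=> [K [K0 HK]]; exists (2 * K); split; first lra.
move=> p q; case: (Req_dec p q) => [->|pq].
  by rewrite !Rminus_diag Rabs_R0; lra.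
have pq0 : 0 < Rabs (p - q) by apply: Rabs_pos_lt; lra.
apply: (Rmult_le_reg_l (Rabs (p - q))) => //; rewrite -Rabs_mult.
have -> : (p - q) * (dg p - dg q) =
  (g p - g q - (p - q) * dg q) + (g q - g p - (q - p) * dg p) by ring.
apply: Rle_trans (Rabs_triang _ _) _.
have := HK p q; have := HK q p.
have -> : (q - p) ^ 2 = Rabs (p - q) ^ 2 by rewrite pow2_abs; ring.
by rewrite -(pow2_abs (p - q)); lra.
Qed.

Lemma quad_rem_continuous g dg (q : R) : quad_rem g dg -> continuous dg q.
Proof.
move=> /quad_rem_lip [K [K0 HK]]; apply/continuity_pt_filterlim => eps e0.
exists (eps / (K + 1)); split; first by apply: Rdiv_lt_0_compat; lra.
move=> p [_ /= pq]; rewrite /Rlimit.dist /= /R_dist in pq *.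
apply: Rle_lt_trans (HK p q) _.
have : Rabs (p - q) * (K + 1) < eps by apply/Rlt_div_r => //; lra.
by have := Rabs_pos (p - q); nra.
Qed.

Lemma adm_near u0 c a b tau : adm u0 c a b tau -> exists s0, 0 < s0 /\
  forall s, Rabs s < s0 -> adm u0 c a b (tau + s).
Proof.
move=> [lo [hi [s0 [ulo s00 ts H]]]]; exists (s0 / 2); split; first lra.
move=> s ss; exists lo, hi, (s0 / 2); split=> //; first lra.
  move=> t tt; have := ts (s + t); rewrite -Rplus_assoc; apply.
  by apply: Rle_lt_trans (Rabs_triang _ _) _; lra.
move=> x t tt; rewrite Rplus_assoc; apply: H.
by apply: Rle_lt_trans (Rabs_triang _ _) _; lra.
Qed.

(** The remainder is at most K s^2 |w| |x - c|^4, hence K M s^2 on a compact shell. [adm] provides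
    one shell for all nearby scales, so the total error is O(s^2). *)
Lemma Lam_scale_derive u0 c a b tau w g dg : adm u0 c a b tau ->
  supp_in a b g -> supp_in a b dg -> quad_rem g dg ->
  (forall x, u0 < sqdist origin x -> continuous w x) ->
  is_derive (fun t => Lam (fun x => w x * g (t * sqdist c x))) tau
    (Lam (fun x => (w x * sqdist c x) * dg (tau * sqdist c x))).
Proof.
move=> ad sg sdg rem cw; have [K [K0 HK]] := rem.
have cg q : continuous g q.
  by apply: ex_derive_continuous; exists (dg q); apply: quad_rem_derive.
have cdg q : continuous dg q := quad_rem_continuous _ _ q rem.
have cwq x : u0 < sqdist origin x -> continuous (fun y => w y * sqdist c y) x.
  by move=> xu; apply: (continuous_mult w); [apply: cw | apply: sqdist_continuous].
have [_ b1] := cut_continuous _ _ _ _ _ _ _ ad sg cw cg.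
have [_ b2] := cut_continuous _ _ _ _ _ _ _ ad sdg cwq cdg.
have [s1 [s10 near]] := adm_near _ _ _ _ _ ad.
have [lo [hi [s0 [ulo s00 ts H]]]] := ad.
have cw2 x : lo <= sqdist origin x <= hi -> continuous (fun x => w x * sqdist c x ^ 2) x.
  move=> xs; apply: (continuous_mult w); first by apply: cw; lra.
  apply: (continuous_ext (fun y => mult (sqdist c y) (sqdist c y))).
    by move=> y; rewrite /mult /=; ring.
  by apply: continuous_mult; apply: sqdist_continuous.
have [M [M0 HM]] := shell_bounded lo hi _ cw2.
pose ind x : R := if excluded_middle_informative (lo <= sqdist origin x <= hi) then 1 else 0.
have bind : bdd ind.
  apply: (sqdist_bdd_supp n hi _ origin 1) => x; rewrite /ind.
    by case: excluded_middle_informative => ?; rewrite ?Rabs_R1 ?Rabs_R0; lra.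
  by case: excluded_middle_informative => ? //; lra.
apply: (quad_is_derive _ _ _ (K * M * Lam ind) (Rmin s0 s1)); first exact: Rmin_pos.
move=> s ss; have ss0 := Rlt_le_trans _ _ _ ss (Rmin_l _ _).
have ss1 := Rlt_le_trans _ _ _ ss (Rmin_r _ _).
have [_ b3] := cut_continuous _ _ _ _ _ _ _ (near s ss1) sg cw cg.
pose f x := w x * g ((tau + s) * sqdist c x) +
  (-1 * (w x * g (tau * sqdist c x)) + (- s) * (w x * sqdist c x * dg (tau * sqdist c x))).
have -> : Lam (fun x => w x * g ((tau + s) * sqdist c x)) -
   Lam (fun x => w x * g (tau * sqdist c x)) -
   s * Lam (fun x => w x * sqdist c x * dg (tau * sqdist c x)) = Lam f.
  rewrite /f Lam_plus//; last by apply: bdd_lin.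
  by rewrite Lam_lin//; ring.
have -> : K * M * Lam ind * s ^ 2 = Lam (fun x => (K * M * s ^ 2) * ind x).
  by rewrite Lam_scal//; ring.
apply: Lam_abs_le; first exact: bdd_scal.
move=> x; rewrite /f /ind; case: excluded_middle_informative => xs; last first.
  have z0 t : Rabs t < s0 -> ~ (a <= (tau + t) * sqdist c x <= b).
    by move=> tt ab; apply: xs; apply: (H x t).
  have z1 : ~ (a <= tau * sqdist c x <= b).
    by have := z0 0; rewrite Rabs_R0 Rplus_0_r; apply.
  have q0 := sqdist_ge0 n c x; have tau0 := adm_gt0 _ _ _ _ _ ad.
  have ts0 := ts s ss0.
  rewrite (sg ((tau + s) * _)) ?(sg (tau * _)) ?(sdg (tau * _))//;
    try (by apply: Rmult_le_pos; lra); last exact: z0.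
  by rewrite !Rmult_0_r !Rplus_0_r Rabs_R0; lra.
rewrite Rmult_1_r.
have -> : w x * g ((tau + s) * sqdist c x) +
   (-1 * (w x * g (tau * sqdist c x)) + - s * (w x * sqdist c x * dg (tau * sqdist c x))) =
   w x * (g ((tau + s) * sqdist c x) - g (tau * sqdist c x) -
     ((tau + s) * sqdist c x - tau * sqdist c x) * dg (tau * sqdist c x)) by ring.
rewrite Rabs_mult.
apply: Rle_trans (Rmult_le_compat_l _ _ _ (Rabs_pos _) (HK _ _)) _.
have -> : Rabs (w x) * (K * ((tau + s) * sqdist c x - tau * sqdist c x) ^ 2) =
  (K * s ^ 2) * Rabs (w x * sqdist c x ^ 2).
  by rewrite Rabs_mult (Rabs_right (_ ^ 2)); [ring | apply/Rle_ge/pow2_ge_0].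
have -> : K * M * s ^ 2 = K * s ^ 2 * M by ring.
apply: Rmult_le_compat_l; last exact: HM.
by apply: Rmult_le_pos => //; apply: pow2_ge_0.
Qed.

End radial.

(** * Radial means and fluxes *)

Lemma inv_pow_derive p (r : R) : 0 < r ->
  is_derive (fun t => / t ^ p) r (- INR p * / r ^ p * / r).
Proof.
move=> r0; case: p => [|p].
  apply: (is_derive_ext (fun=> / 1)) => //.
  by rewrite /= Ropp_0 !Rmult_0_l; apply: is_derive_const.
have p0 : r ^ p <> 0 by apply: pow_nonzero; lra.
have rp0 : r ^ p.+1 <> 0 by apply: pow_nonzero; lra.
have d1 : is_derive (fun t => t ^ p.+1) r (INR p.+1 * r ^ p).
  by have := is_derive_pow id p.+1 r 1 (is_derive_id r); rewrite Rmult_1_r.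
have := is_derive_inv _ _ _ d1 rp0.
have -> : - (INR p.+1 * r ^ p) / (r ^ p.+1) ^ 2 = - INR p.+1 * / r ^ p.+1 * / r.
  by rewrite -[r ^ p.+1]/(r * r ^ p); field; split; lra.
by [].
Qed.

Section means.
Variable n : nat.
Implicit Types (w : pt n -> R) (dw : 'I_n -> pt n -> R) (c : pt n) (g dg : R -> R).
Local Notation Lam := (Lam n).
Local Notation bdd := (bdd n).
Local Notation sqdist := (sqdist n).
Local Notation origin := (origin n).
Local Notation adm := (adm n).

Definition mean w g c (r : R) : R :=
  / r ^ n * Lam (fun x => w x * g (/ r ^ 2 * sqdist c x)).

Definition euler dw c (x : pt n) : R := \big[Rplus/0]_(i < n) ((x i - c i) * dw i x).

(** By [mean_derive] this is r^(n-1) times the r-derivative of [mean]. *)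
Definition flux dw g c (r : R) : R :=
  / r ^ 2 * Lam (fun x => euler dw c x * g (/ r ^ 2 * sqdist c x)).

Definition C1_on (u0 : R) w dw := forall x, u0 < sqdist origin x ->
  continuous w x /\ forall i, continuous (dw i) x /\
    is_derive (fun t => w (upd x i t)) (x i) (dw i x).

Definition C2_on (u0 : R) w dw lw := C1_on u0 w dw /\ exists ddw,
  (forall i x, u0 < sqdist origin x -> continuous (ddw i) x /\
    is_derive (fun t => dw i (upd x i t)) (x i) (ddw i x)) /\
  forall x, lw x = \big[Rplus/0]_(i < n) ddw i x.

Definition profile a b g dg :=
  (forall q, ~ (a <= q <= b) -> g q = 0 /\ dg q = 0) /\ quad_rem g dg.

Lemma profileP a b g dg : profile a b g dg ->
  [/\ supp_in a b g, supp_in a b dg & quad_rem g dg].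
Proof. by move=> [sup rem]; split=> // q _ /sup []. Qed.

Lemma euler_continuous u0 w dw c x : C1_on u0 w dw -> u0 < sqdist origin x ->
  continuous (euler dw c) x.
Proof.
move=> C1 xu; apply: Rsum_continuous => i.
apply: (continuous_mult (fun y : pt n => y i - c i)); first exact: sub_continuous.
by case: (C1 x xu) => _ /(_ i) [].
Qed.

(** Integral of the divergence of the field w(x) (x - c) g(tau |x - c|^2). *)
Lemma mean_ibp u0 c a b tau w dw g dg : adm u0 c a b tau -> profile a b g dg ->
  C1_on u0 w dw ->
  INR n * Lam (fun x => w x * g (tau * sqdist c x)) +
  2 * tau * Lam (fun x => w x * sqdist c x * dg (tau * sqdist c x)) =
  - Lam (fun x => euler dw c x * g (tau * sqdist c x)).
Proof.
move=> ad pr C1; have [sg sdg rem] := profileP _ _ _ _ pr.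
have cg q : continuous g q.
  by apply: ex_derive_continuous; exists (dg q); apply: quad_rem_derive.
have cdg q : continuous dg q by apply: quad_rem_continuous rem.
have dgE q : is_derive g q (dg q) by apply: quad_rem_derive.
have cw x : u0 < sqdist origin x -> continuous w x by move=> /C1 [].
have cwq x : u0 < sqdist origin x -> continuous (fun y => w y * sqdist c y) x.
  by move=> xu; apply: (continuous_mult w); [apply: cw | apply: sqdist_continuous].
have [_ b1] := cut_continuous n _ _ _ _ _ _ _ ad sg cw cg.
have [_ b2] := cut_continuous n _ _ _ _ _ _ _ ad sdg cwq cdg.
have [_ b3] := cut_continuous n _ _ _ _ _ _ _ ad sg
  (fun x => euler_continuous _ _ _ c x C1) cg.
pose hd i x := (dw i x * (x i - c i) + w x) * g (tau * sqdist c x) +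
  (w x * (x i - c i) * (2 * tau * (x i - c i))) * dg (tau * sqdist c x).
have hdP i : bdd (hd i) /\ Lam (hd i) = 0.
  apply: (cut_ibp n u0 c a b tau i (fun x => w x * (x i - c i))) => //.
  - move=> x xu; apply: (continuous_mult w); [exact: cw | exact: sub_continuous].
  - move=> x xu; have [_ /(_ i) [cd _]] := C1 x xu.
    apply: (continuous_plus (fun y => dw i y * (y i - c i)) w); last exact: cw.
    by apply: (continuous_mult (dw i)) => //; apply: sub_continuous.
  - move=> x xu; have [_ /(_ i) [_ d]] := C1 x xu.
    apply: (is_derive_ext (fun t => w (upd x i t) * (t - c i))).
      by move=> t; rewrite upd_same.
    have d2 : is_derive (fun t => t - c i) (x i) 1 by auto_derive => //; ring.
    move/is_derive_Reals: d => d; move/is_derive_Reals: d2 => d2; apply/is_derive_Reals.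
    have := derivable_pt_lim_mult _ _ _ _ _ d d2; rewrite upd_id Rmult_1_r.
    by [].
have E : Lam (fun x => \big[Rplus/0]_(i < n) hd i x) = 0.
  by rewrite Lam_Rsum; [rewrite big1 // => i _|] => [|i]; case: (hdP i).
have {E} : Lam (fun x => (INR n * (w x * g (tau * sqdist c x)) +
    2 * tau * (w x * sqdist c x * dg (tau * sqdist c x))) +
    1 * (euler dw c x * g (tau * sqdist c x))) = 0.
  rewrite -E; congr Lam; apply: functional_extensionality => x.
  set q := tau * _.
  transitivity (\big[Rplus/0]_(i < n) (w x * g q) +
     (\big[Rplus/0]_(i < n) ((2 * tau * w x * dg q) * (x i - c i) ^ 2) +
      \big[Rplus/0]_(i < n) (g q * ((x i - c i) * dw i x)))).
    by rewrite Rsum_const !Rsum_scal -/(sqdist c x) -/(euler dw c x); ring.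
  rewrite -!big_split /=; apply: eq_bigr => i _; rewrite /hd -/q; ring.
rewrite Lam_plus; [|exact: bdd_lin|exact: bdd_scal].
rewrite Lam_lin// Lam_scal//; lra.
Qed.

(** Integral of the divergence of g(tau |x - c|^2) grad w. The pair g, dg is general because it is
    instantiated both with q g(q) and with [tail]. *)
Lemma flux_ibp u0 c a b tau w dw ddw g dg : adm u0 c a b tau ->
  supp_in a b g -> supp_in a b dg -> (forall q, continuous dg q) ->
  (forall q, is_derive g q (dg q)) ->
  C1_on u0 w dw -> (forall i x, u0 < sqdist origin x -> continuous (ddw i) x /\
    is_derive (fun t => dw i (upd x i t)) (x i) (ddw i x)) ->
  2 * tau * Lam (fun x => euler dw c x * dg (tau * sqdist c x)) =
  - Lam (fun x => \big[Rplus/0]_(i < n) ddw i x * g (tau * sqdist c x)).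
Proof.
move=> ad sg sdg cdg dgE C1 C2.
have cg q : continuous g q by apply: ex_derive_continuous; exists (dg q).
have [_ b1] := cut_continuous n _ _ _ _ _ _ _ ad sdg
  (fun x => euler_continuous _ _ _ c x C1) cdg.
pose lapl x := \big[Rplus/0]_(i < n) ddw i x.
rewrite -[X in _ = - X]/(Lam (fun x => lapl x * g (tau * sqdist c x))).
have clw x : u0 < sqdist origin x -> continuous lapl x.
  by move=> xu; apply: Rsum_continuous => i; case: (C2 i x xu).
have [_ b2] := cut_continuous n _ _ _ _ _ _ _ ad sg clw cg.
pose hd i x := ddw i x * g (tau * sqdist c x) +
  (dw i x * (2 * tau * (x i - c i))) * dg (tau * sqdist c x).
have hdP i : bdd (hd i) /\ Lam (hd i) = 0.
  apply: (cut_ibp n u0 c a b tau i (dw i)) => //.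
  - by move=> x /C1 [_ /(_ i) []].
  - by move=> x /(C2 i) [].
  - by move=> x /(C2 i) [].
have E : Lam (fun x => \big[Rplus/0]_(i < n) hd i x) = 0.
  by rewrite Lam_Rsum; [rewrite big1 // => i _|] => [|i]; case: (hdP i).
have {E} : Lam (fun x => 1 * (lapl x * g (tau * sqdist c x)) +
    2 * tau * (euler dw c x * dg (tau * sqdist c x))) = 0.
  rewrite -E; congr Lam; apply: functional_extensionality => x.
  set q := tau * _.
  transitivity (\big[Rplus/0]_(i < n) (g q * ddw i x) +
      \big[Rplus/0]_(i < n) (2 * tau * dg q * ((x i - c i) * dw i x))).
    by rewrite !Rsum_scal -/(euler dw c x) -/(lapl x); ring.
  rewrite -!big_split /=; apply: eq_bigr => i _; rewrite /hd -/q; ring.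
rewrite Lam_lin//; lra.
Qed.

Lemma inv_sq_gt0 r : 0 < r -> 0 < / r ^ 2.
Proof. by move=> r0; apply: Rinv_0_lt_compat; apply: pow_lt. Qed.

Lemma Lam_radius_derive u0 c a b r w g dg : 0 < r -> adm u0 c a b (/ r ^ 2) ->
  profile a b g dg -> (forall x, u0 < sqdist origin x -> continuous w x) ->
  is_derive (fun t => Lam (fun x => w x * g (/ t ^ 2 * sqdist c x))) r
    (- 2 * / r ^ 3 * Lam (fun x => w x * sqdist c x * dg (/ r ^ 2 * sqdist c x))).
Proof.
move=> r0 ad pr cw; have [sg sdg rem] := profileP _ _ _ _ pr.
have d1 := Lam_scale_derive n _ _ _ _ _ _ _ _ ad sg sdg rem cw.
have d2 := inv_pow_derive 2 r r0.
have := is_derive_comp _ _ _ _ _ d1 d2.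
set D := Lam _; have -> : scal (- INR 2 * / r ^ 2 * / r) D = - 2 * / r ^ 3 * D.
  by rewrite /scal /= /mult /=; field; lra.
by [].
Qed.

Lemma mean_derive u0 c a b r w dw g dg : 0 < r -> adm u0 c a b (/ r ^ 2) ->
  profile a b g dg -> C1_on u0 w dw ->
  is_derive (mean w g c) r (r / r ^ n * flux dw g c r).
Proof.
move=> r0 ad pr C1.
have ibp := mean_ibp _ _ _ _ _ _ _ _ _ ad pr C1.
have d1 := Lam_radius_derive _ _ _ _ _ _ _ _ r0 ad pr (fun x xu => proj1 (C1 x xu)).
have d2 := inv_pow_derive n r r0.
move/is_derive_Reals: d1 => d1; move/is_derive_Reals: d2 => d2; apply/is_derive_Reals.
have := derivable_pt_lim_mult _ _ _ _ _ d2 d1.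
set A := Lam _; set B := Lam _ => d3.
rewrite /flux; set E := Lam _.
rewrite -/A -/B -/E in ibp.
have rn : r ^ n <> 0 by apply: pow_nonzero; lra.
have -> : r / r ^ n * (/ r ^ 2 * E) =
  - INR n * / r ^ n * / r * A + / r ^ n * (-2 * / r ^ 3 * B).
  have -> : E = - (INR n * A + 2 * / r ^ 2 * B) by lra.
  by field; lra.
exact: d3.
Qed.

(** The unbounded factor q is harmless on the compact support. For q in [a, b] the new remainder is
    q times the old one plus (p - q)(g p - g q), so a Lipschitz bound for g suffices; for q outside,
    the old remainder is g p itself. *)
Lemma profile_mulX a b g dg : profile a b g dg ->
  profile a b (fun q => q * g q) (fun q => g q + q * dg q).
Proof.
move=> [sup rem]; split.
  by move=> q /sup [-> ->]; split; ring.
have [K [K0 HK]] := rem; have [K' [K0' HK']] := quad_rem_lip _ _ rem.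
pose B := Rabs a + Rabs b + 1.
have B1 : 1 <= B by rewrite /B; have := Rabs_pos a; have := Rabs_pos b; lra.
have qB q : a <= q <= b -> Rabs q <= B.
  move=> qab; apply/Rabs_le_between; rewrite /B.
  have := Rle_abs b; have := Rle_abs (- a); rewrite Rabs_Ropp.
  by have := Rabs_pos a; have := Rabs_pos b; lra.
(* Both [g] and [dg] vanish at b + 1, so the remainder and Lipschitz estimates based at this point
   bound them everywhere. *)
have out : ~ (a <= b + 1 <= b) by lra.
have [g1 dg1] := sup _ out.
have q1B q : a <= q <= b -> Rabs (q - (b + 1)) <= 2 * B.
  move=> qab; apply/Rabs_le_between; rewrite /B.
  have := Rle_abs b; have := Rle_abs (- a); rewrite Rabs_Ropp.
  by have := Rabs_pos a; have := Rabs_pos b; lra.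
pose DD := 2 * K' * B; pose G := 4 * K * B ^ 2.
have D0 : 0 <= DD by rewrite /DD; nra.
have G0 : 0 <= G by rewrite /G; nra.
have gG q : Rabs (g q) <= G.
  case: (excluded_middle_informative (a <= q <= b)) => [qab|/sup [-> _]]; last by rewrite Rabs_R0.
  have := HK q (b + 1); rewrite g1 dg1 Rmult_0_r !Rminus_0_r -pow2_abs.
  have := q1B q qab; set z := Rabs _; have : 0 <= z by apply: Rabs_pos.
  move=> z0 zB h; apply: Rle_trans h _.
  have : z ^ 2 <= (2 * B) ^ 2 by apply: pow_incr; lra.
  by move/(Rmult_le_compat_l _ _ _ K0); rewrite /G; lra.
have dD q : Rabs (dg q) <= DD.
  case: (excluded_middle_informative (a <= q <= b)) => [qab|/sup [_ ->]]; last by rewrite Rabs_R0.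
  have := HK' q (b + 1); rewrite dg1 Rminus_0_r.
  by have := q1B q qab => zB h; apply: Rle_trans h _; move/(Rmult_le_compat_l _ _ _ K0'): zB; rewrite /DD; lra.
pose L := DD + K + 2 * G.
have gL p q : Rabs (g p - g q) <= L * Rabs (p - q).
  have z0 : 0 <= Rabs (p - q) by apply: Rabs_pos.
  case: (Rle_lt_dec (Rabs (p - q)) 1) => z1.
    have h := HK p q; set X := g p - g q - (p - q) * dg q in h.
    have -> : g p - g q = X + (p - q) * dg q by rewrite /X; ring.
    apply: Rle_trans (Rabs_triang _ _) _; rewrite Rabs_mult.
    have h2 : Rabs (p - q) * Rabs (dg q) <= Rabs (p - q) * DD by apply: Rmult_le_compat_l.
    have h3 : K * (p - q) ^ 2 <= K * Rabs (p - q).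
      by apply: Rmult_le_compat_l => //; rewrite -pow2_abs; nra.
    have h4 : 0 <= G * Rabs (p - q) by apply: Rmult_le_pos.
    by rewrite /L; lra.
  have := Rabs_triang (g p) (- g q); rewrite Rabs_Ropp.
  rewrite -[g p + - g q]/(g p - g q) => h.
  have h5 : 2 * G * 1 <= 2 * G * Rabs (p - q) by apply: Rmult_le_compat_l; lra.
  have h6 : 0 <= (DD + K) * Rabs (p - q) by apply: Rmult_le_pos; lra.
  by have := gG p; have := gG q; rewrite /L; lra.
exists (B * K + L); split; first by rewrite /L; nra.
move=> p q; have z0 := pow2_ge_0 (p - q).
have L0 : 0 <= L by rewrite /L; lra.
case: (excluded_middle_informative (a <= q <= b)) => [/qB qb|/sup [gq dq]].
  have -> : p * g p - q * g q - (p - q) * (g q + q * dg q) =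
    q * (g p - g q - (p - q) * dg q) + (p - q) * (g p - g q) by ring.
  apply: Rle_trans (Rabs_triang _ _) _; rewrite !Rabs_mult Rmult_plus_distr_r.
  apply: Rplus_le_compat.
    rewrite Rmult_assoc; apply: Rmult_le_compat => //; exact: Rabs_pos.
  have := gL p q; have := Rabs_pos (p - q); rewrite -(pow2_abs (p - q)); nra.
have := HK p q; rewrite gq dq.
have -> : g p - 0 - (p - q) * 0 = g p by ring.
have -> : p * g p - q * 0 - (p - q) * (0 + q * 0) = p * g p by ring.
move=> h; case: (excluded_middle_informative (a <= p <= b)) => [/qB pb|/sup [-> _]]; last first.
  by rewrite Rmult_0_r Rabs_R0; apply: Rmult_le_pos => //; nra.
rewrite Rabs_mult Rmult_plus_distr_r.
have h1 : Rabs p * Rabs (g p) <= B * (K * (p - q) ^ 2).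
  by apply: Rmult_le_compat => //; apply: Rabs_pos.
have h2 : 0 <= L * (p - q) ^ 2 by apply: Rmult_le_pos; lra.
lra.
Qed.

(** Differentiating r^(-2) and the cutoff together gives -2 r^(-3) times the integral of the Euler
    derivative against g + q g' = (q g)'. By [flux_ibp] that is an integral of the Laplacian against
    q g: the source of the extra factor q. *)
Lemma flux_derive u0 c a b r w dw lw g dg : 0 < r -> adm u0 c a b (/ r ^ 2) ->
  profile a b g dg -> C2_on u0 w dw lw ->
  is_derive (flux dw g c) r (r ^ n / r * mean lw (fun q => q * g q) c r).
Proof.
move=> r0 ad pr [C1 [ddw [C2 lwE]]].
have prX := profile_mulX _ _ _ _ pr.
have [sg sdg rem] := profileP _ _ _ _ pr.
have [sgX sdgX remX] := profileP _ _ _ _ prX.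
have cg q : continuous g q.
  by apply: ex_derive_continuous; exists (dg q); apply: quad_rem_derive.
have cdg q : continuous dg q by apply: quad_rem_continuous rem.
have ce x : u0 < sqdist origin x -> continuous (euler dw c) x.
  exact: euler_continuous C1.
have ceq x : u0 < sqdist origin x -> continuous (fun y => euler dw c y * sqdist c y) x.
  by move=> xu; apply: (continuous_mult (euler dw c)); [apply: ce | apply: sqdist_continuous].
have [_ b1] := cut_continuous n _ _ _ _ _ _ _ ad sg ce cg.
have [_ b2] := cut_continuous n _ _ _ _ _ _ _ ad sdg ceq cdg.
have := flux_ibp u0 c a b (/ r ^ 2) w dw ddw _ _ ad sgX sdgX
  (fun q => quad_rem_continuous _ _ q remX) (fun q => quad_rem_derive _ _ q remX) C1 C2.
have {}lwE := functional_extensionality _ _ lwE; subst lw.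
have -> : (fun x => euler dw c x *
   (g (/ r ^ 2 * sqdist c x) + / r ^ 2 * sqdist c x * dg (/ r ^ 2 * sqdist c x))) =
   fun x => 1 * (euler dw c x * g (/ r ^ 2 * sqdist c x)) +
     / r ^ 2 * (euler dw c x * sqdist c x * dg (/ r ^ 2 * sqdist c x)).
  by apply: functional_extensionality => x; ring.
rewrite Lam_lin//.
have d1 := Lam_radius_derive _ _ _ _ _ _ _ _ r0 ad pr ce.
have d2 := inv_pow_derive 2 r r0.
move/is_derive_Reals: d1 => d1; move/is_derive_Reals: d2 => d2.
move=> ibp; apply/is_derive_Reals.
have := derivable_pt_lim_mult _ _ _ _ _ d2 d1.
rewrite /mean; set A := Lam (fun x => _ * g _); set B := Lam (fun x => _ * dg _) => d3.
rewrite -/A -/B in ibp; set E := Lam _ in ibp *.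
have rn : r ^ n <> 0 by apply: pow_nonzero; lra.
have -> : r ^ n / r * (/ r ^ n * E) =
  - INR 2 * / r ^ 2 * / r * A + / r ^ 2 * (-2 * / r ^ 3 * B).
  have -> : E = - (2 * / r ^ 2 * (1 * A + / r ^ 2 * B)) by lra.
  by rewrite /=; field; lra.
exact: d3.
Qed.

End means.

(** * Bump profiles and their masses *)

(** The double zeros at -1 and 1 give a Lipschitz derivative, which is all that [quad_rem] demands,
    and keep every estimate polynomial. *)
Definition bump0 (z : R) := Rmax 0 (1 - z ^ 2) ^ 2.

Definition dbump0 (z : R) := - 4 * z * Rmax 0 (1 - z ^ 2).

Lemma bump0_in z : -1 <= z <= 1 -> bump0 z = (1 - z ^ 2) ^ 2 /\
  dbump0 z = - 4 * z * (1 - z ^ 2).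
Proof. by move=> z1; rewrite /bump0 /dbump0 Rmax_right//; nra. Qed.

Lemma bump0_out z : ~ (-1 <= z <= 1) -> bump0 z = 0 /\ dbump0 z = 0.
Proof.
move=> z1; rewrite /bump0 /dbump0 Rmax_left; first by split; ring.
by case: (Rlt_le_dec z (-1)) => ?; nra.
Qed.

Lemma bump0_range z : 0 <= bump0 z <= 1.
Proof.
case: (excluded_middle_informative (-1 <= z <= 1)) => [z1|/bump0_out [-> _]]; last lra.
rewrite (proj1 (bump0_in _ z1)); have : 0 <= 1 - z ^ 2 <= 1 by nra.
by set u := 1 - z ^ 2; nra.
Qed.

Lemma bump0_quad_rem : quad_rem bump0 dbump0.
Proof.
(* The worst case is p outside and q inside. With z = |p - q| and u = 1 - q^2 <= 2z, the two terms
   are at most 8 z^2 and 4 z^2. *)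
exists 12; split; first lra.
have edge y z : ~ (-1 <= y <= 1) -> -1 <= z <= 1 -> 0 <= 1 - z ^ 2 <= 2 * Rabs (y - z).
  move=> ny z1; split; first nra.
  case: (Rlt_le_dec y (-1)) => y1.
    by rewrite Rabs_left; nra.
  by rewrite Rabs_right; nra.
move=> p q; case: (excluded_middle_informative (-1 <= p <= 1)) => p1;
  case: (excluded_middle_informative (-1 <= q <= 1)) => q1.
- rewrite !(proj1 (bump0_in _ _))// (proj2 (bump0_in _ q1)).
  have -> : (1 - p ^ 2) ^ 2 - (1 - q ^ 2) ^ 2 - (p - q) * (- 4 * q * (1 - q ^ 2)) =
    (p - q) ^ 2 * (p ^ 2 + 2 * p * q + 3 * q ^ 2 - 2) by ring.
  rewrite Rabs_mult (Rabs_right (_ ^ 2)); last exact/Rle_ge/pow2_ge_0.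
  rewrite Rmult_comm; apply: Rmult_le_compat_r; first exact: pow2_ge_0.
  by apply/Rabs_le_between; nra.
- have [-> ->] := bump0_out _ q1; rewrite (proj1 (bump0_in _ p1)).
  have := edge _ _ q1 p1; rewrite Rabs_minus_sym; set z := Rabs _ => e.
  have -> : (1 - p ^ 2) ^ 2 - 0 - (p - q) * 0 = (1 - p ^ 2) ^ 2 by ring.
  rewrite Rabs_right; last exact/Rle_ge/pow2_ge_0.
  by rewrite -(pow2_abs (p - q)) -/z; nra.
- have [-> _] := bump0_out _ p1.
  rewrite (proj1 (bump0_in _ q1)) (proj2 (bump0_in _ q1)).
  have := edge _ _ p1 q1; set u := 1 - q ^ 2 => e.
  have -> : 0 - u ^ 2 - (p - q) * (- 4 * q * u) = 4 * ((p - q) * (q * u)) + - (u * u) by ring.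
  apply: Rle_trans (Rabs_triang _ _) _; rewrite Rabs_Ropp (Rabs_mult u u).
  rewrite (Rabs_mult 4) (Rabs_mult (p - q)) (Rabs_mult q u).
  rewrite (Rabs_right 4); last lra.
  rewrite (Rabs_right u); last lra.
  have : Rabs q <= 1 by apply/Rabs_le_between; lra.
  rewrite -(pow2_abs (p - q)); move: e; set z := Rabs (p - q) => e qq.
  have h1 : Rabs q * u <= 2 * z by have := Rabs_pos q; nra.
  have z0 : 0 <= z by lra.
  have h2 : z * (Rabs q * u) <= z * (2 * z) by apply: Rmult_le_compat_l.
  have h3 : u * u <= (2 * z) * (2 * z) by apply: Rmult_le_compat; lra.
  by rewrite /= !Rmult_1_r; lra.
- have [-> _] := bump0_out _ p1; have [-> ->] := bump0_out _ q1.
  have -> : 0 - 0 - (p - q) * 0 = 0 by ring.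
  by rewrite Rabs_R0; have := pow2_ge_0 (p - q); lra.
Qed.

Definition bump (a b q : R) := bump0 ((q - (a + b) / 2) / ((b - a) / 2)).

Lemma bump_range a b q : 0 <= bump a b q <= 1.
Proof. exact: bump0_range. Qed.

Lemma bump_profile a b : a < b -> exists dg, profile a b (bump a b) dg.
Proof.
move=> ab; pose z q := (q - (a + b) / 2) / ((b - a) / 2).
exists (fun q => dbump0 (z q) / ((b - a) / 2)); split.
  move=> q qab; have zout : ~ (-1 <= z q <= 1).
    move=> [z1 z2]; apply: qab.
    have qE : q = (a + b) / 2 + (b - a) / 2 * z q by rewrite /z; field; lra.
    by split; rewrite qE; nra.
  have [e1 e2] := bump0_out _ zout.
  by rewrite e2; split=> //; rewrite /Rdiv Rmult_0_l.
have [K [K0 HK]] := bump0_quad_rem.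
have h0 : 0 < (b - a) / 2 by lra.
exists (K / ((b - a) / 2) ^ 2); split.
  by apply: Rmult_le_pos => //; apply/Rlt_le/Rinv_0_lt_compat/pow_lt.
move=> p q; have := HK (z p) (z q).
have -> : z p - z q = (p - q) / ((b - a) / 2) by rewrite /z; field; lra.
rewrite /bump -!/(z _).
have -> : (p - q) / ((b - a) / 2) * dbump0 (z q) = (p - q) * (dbump0 (z q) / ((b - a) / 2)).
  by field; lra.
have -> : K * ((p - q) / ((b - a) / 2)) ^ 2 = K / ((b - a) / 2) ^ 2 * (p - q) ^ 2.
  by field; lra.
by [].
Qed.

(** Defined by repeated multiplication, so that level k+1 is by computation the profile that
    [flux_derive] produces from level k. *)
Fixpoint bumpX (a b : R) (k : nat) : R -> R :=
  if k is k'.+1 then fun q => q * bumpX a b k' q else bump a b.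

Lemma bumpXE a b k q : bumpX a b k q = q ^ k * bump a b q.
Proof. by elim: k => [|k IH] /=; [rewrite Rmult_1_l | rewrite IH Rmult_assoc]. Qed.

Lemma bumpX_profile a b k : a < b -> exists dg, profile a b (bumpX a b k) dg.
Proof.
move=> ab; elim: k => [|k [dg IH]]; first exact: bump_profile.
by eexists; apply: profile_mulX IH.
Qed.

Lemma bump11 q : bump (-1) 1 q = bump0 q.
Proof. by congr bump0; field. Qed.

Lemma bump11_ge q : 0 <= q <= 1 / 2 -> / 2 <= bump (-1) 1 q.
Proof. by move=> q1; rewrite bump11 (proj1 (bump0_in _ _)); nra. Qed.

Section mass.
Variable n : nat.
Hypothesis n0 : (0 < n)%N.
Local Notation Lam := (Lam n).
Local Notation bdd := (bdd n).
Local Notation sqdist := (sqdist n).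
Local Notation origin := (origin n).

Lemma bump_bdd c r : 0 < r -> bdd (fun x => bump (-1) 1 (/ r ^ 2 * sqdist c x)).
Proof.
move=> r0; have p := inv_sq_gt0 r r0.
apply: (sqdist_bdd_supp n (r ^ 2) _ c 1) => x.
  by rewrite Rabs_right; [case: (bump_range (-1) 1 (/ r ^ 2 * sqdist c x)) | apply/Rle_ge; case: (bump_range (-1) 1 (/ r ^ 2 * sqdist c x))].
move=> xr; rewrite bump11 (proj1 (bump0_out _ _))// => -[_ q1].
have := Rmult_le_compat_l (r ^ 2) _ _ (pow2_ge_0 r) q1.
by rewrite -Rmult_assoc Rinv_r ?Rmult_1_r ?Rmult_1_l; [lra|apply: pow_nonzero; lra].
Qed.

Definition mass c := Lam (fun x => bump (-1) 1 (sqdist c x)).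

(** The scaling law without a change of variables: the mean of the constant 1 has zero flux, hence
    does not depend on r. *)
Lemma massE c r : 0 < r -> Lam (fun x => bump (-1) 1 (/ r ^ 2 * sqdist c x)) = mass c * r ^ n.
Proof.
move=> r0; have [dg pr] := bump_profile (-1) 1 ltac:(lra).
pose F := mean n (fun=> 1) (bump (-1) 1) c.
have FE t : 0 < t -> Lam (fun x => bump (-1) 1 (/ t ^ 2 * sqdist c x)) = F t * t ^ n.
  move=> t0; rewrite /F /mean; have tn : t ^ n <> 0 by apply: pow_nonzero; lra.
  have -> : (fun x => 1 * bump (-1) 1 (/ t ^ 2 * sqdist c x)) = fun x => bump (-1) 1 (/ t ^ 2 * sqdist c x).
    by apply: functional_extensionality => x; ring.
  by field.
have dF t : 0 < t -> is_derive F t 0.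
  move=> t0; have p := inv_sq_gt0 t t0.
  (* With u0 = -1 the exterior condition holds on the whole space, squared distances being
     nonnegative. *)
  have ad : adm n (-1) c (-1) 1 (/ t ^ 2).
    exists (-1 / 2), (2 * sqdist origin c + 2 * (2 * t ^ 2)), (/ t ^ 2 / 2); split; try lra.
      by move=> s /Rabs_lt_between; lra.
    move=> x s /Rabs_lt_between ss [_ q1]; split.
      by have := sqdist_ge0 n origin x; lra.
    have := sqdist_split n 1 origin c x ltac:(lra); rewrite Rinv_1.
    suff : sqdist c x <= 2 * t ^ 2 by lra.
    have q0 := sqdist_ge0 n c x.
    have : / t ^ 2 / 2 * sqdist c x <= 1.
      by apply: Rle_trans q1; apply: Rmult_le_compat_r; lra.
    move/(Rmult_le_compat_l (2 * t ^ 2) _ _ ltac:(nra)).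
    have -> : 2 * t ^ 2 * (/ t ^ 2 / 2 * sqdist c x) = sqdist c x by field; lra.
    lra.
  have C1 : C1_on n (-1) (fun=> 1) (fun _ _ => 0).
    move=> x _; split; first exact: continuous_const.
    by move=> i; split; [apply: continuous_const | apply: is_derive_const].
  have := mean_derive n _ _ _ _ _ _ _ _ _ t0 ad pr C1.
  have -> : flux n (fun _ _ => 0) (bump (-1) 1) c t = 0.
    rewrite /flux; have -> : (fun x => euler n (fun _ _ => 0) c x *
       bump (-1) 1 (/ t ^ 2 * sqdist c x)) = fun=> 0.
      apply: functional_extensionality => x; rewrite /euler big1 ?Rmult_0_l// => i _.
      exact: Rmult_0_r.
    by rewrite Lam0 Rmult_0_r.
  by rewrite Rmult_0_r.
have Fc s t : 0 < s -> s < t -> F s = F t.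
  move=> s0 st; apply: eq_is_derive => // u us; apply: dF; lra.
rewrite FE//; congr (_ * _).
have -> : mass c = F 1.
  have := FE 1 Rlt_0_1; rewrite !pow1 Rmult_1_r Rinv_1 => <-.
  by congr Lam; apply: functional_extensionality => x; rewrite Rmult_1_l.
case: (Rtotal_order r 1) => [r1|[->//|r1]]; first exact: Fc.
by apply/esym/Fc => //; lra.
Qed.

(* By scaling it suffices to compare at radii much larger than |c - d|. *)
Lemma mass_compare c d : mass c <= 2 * 4 ^ n * mass d.
Proof.
(* Since 16 |c - d|^2 <= s^2, the ball of radius s/4 about c lies in |x - d|^2 <= s^2/4, where the
   bump of radius s about d is at least 1/2. The ratio of the radii yields 4^n. *)
pose s := 4 * (1 + sqdist c d).
have q0 := sqdist_ge0 n c d; have s0 : 0 < s by rewrite /s; lra.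
have s40 : 0 < s / 4 by lra.
have s2 : 16 * sqdist c d <= s ^ 2 by rewrite /s; nra.
have : Lam (fun x => bump (-1) 1 (/ (s / 4) ^ 2 * sqdist c x)) <=
    Lam (fun x => 2 * bump (-1) 1 (/ s ^ 2 * sqdist d x)).
  apply: Lam_le; first exact: bump_bdd.
    by apply: bdd_scal; apply: bump_bdd.
  move=> x; have b0 := bump_range (-1) 1 (/ s ^ 2 * sqdist d x).
  case: (Rle_lt_dec (/ (s / 4) ^ 2 * sqdist c x) 1) => q1; last first.
    by rewrite bump11 (proj1 (bump0_out _ _)); lra.
  have p := inv_sq_gt0 _ s40; have ps := inv_sq_gt0 _ s0.
  have qx : sqdist c x <= s ^ 2 / 16.
    have := Rmult_le_compat_l ((s / 4) ^ 2) _ _ (pow2_ge_0 _) q1.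
    rewrite -Rmult_assoc Rinv_r; last by apply: pow_nonzero; lra.
    have -> : (s / 4) ^ 2 = s ^ 2 / 16 by field.
    lra.
  have := sqdist_split n 1 d c x ltac:(lra); rewrite Rinv_1 (sqdist_sym _ d c) => qd.
  have q2 : 0 <= / s ^ 2 * sqdist d x <= 1 / 2.
    split; first by apply: Rmult_le_pos; [lra | apply: sqdist_ge0].
    have -> : 1 / 2 = / s ^ 2 * (s ^ 2 / 2) by field; lra.
    by apply: Rmult_le_compat_l; lra.
  have := bump11_ge _ q2; have := bump_range (-1) 1 (/ (s / 4) ^ 2 * sqdist c x); lra.
rewrite Lam_scal; last exact: bump_bdd.
rewrite !massE//; have -> : (s / 4) ^ n = s ^ n / 4 ^ n.
  by rewrite Rpow_mult_distr pow_inv.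
have sn : 0 < s ^ n by apply: pow_lt.
have n4 : 0 < 4 ^ n by apply: pow_lt; lra.
move=> h; have {h} := Rmult_le_compat_l (4 ^ n / s ^ n) _ _ _ h.
have -> : 4 ^ n / s ^ n * (mass c * (s ^ n / 4 ^ n)) = mass c by field; lra.
have -> : 4 ^ n / s ^ n * (2 * (mass d * s ^ n)) = 2 * 4 ^ n * mass d by field; lra.
by apply; apply/Rlt_le/Rdiv_lt_0_compat.
Qed.

(** For r = 2n the cube [-1, 1)^n lies in |x|^2 <= n <= r^2/2, where the bump of radius r is at
    least 1/2. *)
Lemma mass_origin_gt0 : 0 < mass origin.
Proof.
have N0 : 0 < INR n by apply/lt_0_INR/ltP.
pose r := 2 * INR n; have r0 : 0 < r by rewrite /r; lra.
have N1 : 1 <= INR n by apply: (le_INR 1); apply/leP.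
have : Lam (box_ind n 1) <= Lam (fun x => 2 * bump (-1) 1 (/ r ^ 2 * sqdist origin x)).
  apply: Lam_le; first exact: (box_ind_bdd n 1).
    by apply: bdd_scal; apply: bump_bdd.
  move=> x; rewrite /box_ind; have b0 := bump_range (-1) 1 (/ r ^ 2 * sqdist origin x).
  set B := bump _ _ _ in b0 *; case: excluded_middle_informative => /= bx; last lra.
  have qn : sqdist origin x <= INR n.
    rewrite -[INR n]Rmult_1_r -Rsum_const; apply: Rsum_le => i.
    by have := bx i; rewrite /origin; nra.
  suff : / 2 <= B by lra.
  apply: bump11_ge; have p := inv_sq_gt0 _ r0; split.
    by apply: Rmult_le_pos; [lra | apply: sqdist_ge0].
  have -> : 1 / 2 = / r ^ 2 * (r ^ 2 / 2) by field; lra.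
  apply: Rmult_le_compat_l; first lra.
  by apply: Rle_trans qn _; rewrite /r; nra.
have := Lam_box_gt0 n; rewrite Lam_scal; last exact: bump_bdd.
rewrite massE// => h1 h2; have rn : 0 < r ^ n by apply: pow_lt.
have : 0 < mass origin * r ^ n by lra.
nra.
Qed.

(** Stands in for translation invariance of [Lam]: bounds uniform in the centre are enough. *)
Lemma mass_bounds : exists k0 k1, 0 < k0 /\ 0 < k1 /\ forall c, k0 <= mass c <= k1.
Proof.
have n4 : 0 < 2 * 4 ^ n by apply: Rmult_lt_0_compat; [lra | apply: pow_lt; lra].
have m0 := mass_origin_gt0.
exists (mass origin / (2 * 4 ^ n)), (2 * 4 ^ n * mass origin); split.
  exact: Rdiv_lt_0_compat.
split; first exact: Rmult_lt_0_compat.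
move=> c; split; last exact: mass_compare.
by apply/Rle_div_l => //; rewrite Rmult_comm; apply: mass_compare.
Qed.

End mass.

(** * The radial equations on an exterior domain *)

(** Serves to integrate differential inequalities: choose g with an explicit derivative above f'. *)
Lemma derive_le (f g f' g' : R -> R) a b : a <= b ->
  (forall t, a <= t <= b -> is_derive f t (f' t)) ->
  (forall t, a <= t <= b -> is_derive g t (g' t)) ->
  (forall t, a <= t <= b -> f' t <= g' t) -> f b - f a <= g b - g a.
Proof.
case=> [ab df dg fg|->]; last by move=> *; lra.
have [t [E tt]] : exists t, (g b - f b) - (g a - f a) = (g' t - f' t) * (b - a) /\ a < t < b.
  apply: (MVT_cor2 (fun t => g t - f t)) => // t tt; apply/is_derive_Reals.
  by apply: (is_derive_minus g f); [apply: dg | apply: df].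
have : 0 <= (g' t - f' t) * (b - a).
  by apply: Rmult_le_pos; [have := fg t; lra | lra].
lra.
Qed.

Lemma pow_derive (k : nat) (r : R) : is_derive (fun t => t ^ k.+1) r (INR k.+1 * r ^ k).
Proof. by have := is_derive_pow id k.+1 r 1 (is_derive_id r); rewrite Rmult_1_r. Qed.

Lemma pow_Sn_derive (k : nat) (r : R) : is_derive (fun t => t ^ k.+1 / INR k.+1) r (r ^ k).
Proof.
have d := is_derive_scal _ _ (/ INR k.+1) _ (pow_derive k r).
have kn : INR k.+1 <> 0 by apply: not_0_INR.
have -> : r ^ k = / INR k.+1 * (INR k.+1 * r ^ k) by field.
by apply: is_derive_ext d => t; rewrite Rmult_comm.
Qed.

Lemma pow_ge_id (r : R) k : 1 <= r -> r <= r ^ k.+1.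
Proof. by move=> r1; have := pow_R1_Rle r k r1; rewrite /=; nra. Qed.

Section exterior_ode.
Variables (m p : nat) (V P : nat -> R -> R).
Hypothesis p2 : (2 <= p)%N.
Hypothesis dV : forall k r, (k < m)%N -> 1 <= r -> is_derive (V k) r (/ r ^ p * P k r).
Hypothesis dP : forall k r, (k < m)%N -> 1 <= r -> is_derive (P k) r (r ^ p * V k.+1 r).
Hypothesis V0_ge0 : forall r, 1 <= r -> 0 <= V 0 r.
Hypothesis Vm_le0 : forall r, 1 <= r -> V m r <= 0.

(** Two integrations: the flux falls at least like -r^(p+1), hence the mean like -r^2. Here [c2] is
    half the leading coefficient c/(p+1); the other half absorbs the constants of integration. *)
Lemma ode_neg_step k c r1 : (k < m)%N -> 0 < c -> 1 <= r1 ->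
  (forall r, r1 <= r -> V k.+1 r <= - c) ->
  exists r2, 1 <= r2 /\ forall r, r2 <= r -> V k r <= -1.
Proof.
move=> km c0 r11 Vc; have p1 : 0 < INR p.+1 by apply: lt_0_INR; apply/ltP.
pose c2 := c / INR p.+1 / 2; have c20 : 0 < c2 by apply: Rdiv_lt_0_compat; [apply: Rdiv_lt_0_compat | lra].
have Pup r : r1 <= r -> P k r <= P k r1 + 2 * c2 * r1 ^ p.+1 - 2 * c2 * r ^ p.+1.
  move=> rr.
  have := derive_le (P k) (fun t => - c * (t ^ p.+1 / INR p.+1)) (fun t => t ^ p * V k.+1 t)
    (fun t => - c * t ^ p) r1 r rr.
  have E t : - c * (t ^ p.+1 / INR p.+1) = - (2 * c2 * t ^ p.+1) by rewrite /c2; field; lra.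
  rewrite !E => H; suff : P k r - P k r1 <= - (2 * c2 * r ^ p.+1) - - (2 * c2 * r1 ^ p.+1) by lra.
  apply: H => t tt; first by apply: dP => //; lra.
    by apply: is_derive_scal; apply: pow_Sn_derive.
  rewrite Rmult_comm; apply: Rmult_le_compat_r; first by apply: pow_le; lra.
  by apply: Vc; lra.
pose K := Rabs (P k r1 + 2 * c2 * r1 ^ p.+1) / c2.
pose r2 := Rmax r1 K; have r2r1 : r1 <= r2 := Rmax_l _ _.
have Pneg r : r2 <= r -> P k r <= - (c2 * r ^ p.+1).
  move=> rr; have := Pup r ltac:(lra).
  have Kr : K <= r by apply: Rle_trans (Rmax_r _ _) rr.
  have := Rmult_le_compat_l c2 _ _ (Rlt_le _ _ c20) Kr.
  have -> : c2 * K = Rabs (P k r1 + 2 * c2 * r1 ^ p.+1) by rewrite /K; field; lra.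
  have := Rle_abs (P k r1 + 2 * c2 * r1 ^ p.+1).
  have := Rmult_le_compat_l c2 _ _ (Rlt_le _ _ c20) (pow_ge_id r p ltac:(lra)); lra.
have Vup r : r2 <= r -> V k r <= V k r2 + c2 / 2 * r2 ^ 2 - c2 / 2 * r ^ 2.
  move=> rr.
  have := derive_le (V k) (fun t => - c2 * (t ^ 2 / INR 2)) (fun t => / t ^ p * P k t)
    (fun t => - c2 * t ^ 1) r2 r rr.
  have E t : - c2 * (t ^ 2 / INR 2) = - (c2 / 2 * t ^ 2) by rewrite /=; field.
  rewrite !E => H; suff : V k r - V k r2 <= - (c2 / 2 * r ^ 2) - - (c2 / 2 * r2 ^ 2) by lra.
  apply: H => t tt; first by apply: dV => //; lra.
    by apply: is_derive_scal; apply: (pow_Sn_derive 1).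
  have tp : 0 < t ^ p by apply: pow_lt; lra.
  apply: (Rmult_le_reg_l (t ^ p)) => //.
  rewrite -Rmult_assoc Rinv_r ?Rmult_1_l; last lra.
  have := Pneg t ltac:(lra); rewrite -[t ^ p.+1]/(t * t ^ p) pow_1; lra.
pose K2 := (Rabs (V k r2 + c2 / 2 * r2 ^ 2) + 1) / (c2 / 2).
exists (Rmax r2 K2); split; first by apply: Rle_trans (Rmax_l _ _); lra.
move=> r rr; have rr2 : r2 <= r by apply: Rle_trans (Rmax_l _ _) rr.
have Kr : K2 <= r by apply: Rle_trans (Rmax_r _ _) rr.
have := Vup r rr2.
have c21 : 0 <= c2 / 2 by lra.
have := Rmult_le_compat_l (c2 / 2) _ _ c21 Kr.
have -> : c2 / 2 * K2 = Rabs (V k r2 + c2 / 2 * r2 ^ 2) + 1 by rewrite /K2; field; lra.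
have := Rle_abs (V k r2 + c2 / 2 * r2 ^ 2).
have := Rmult_le_compat_l (c2 / 2) _ _ c21 (pow_ge_id r 1 ltac:(lra)); lra.
Qed.

Lemma ode_not_neg k c r1 : (k < m)%N -> 0 < c -> 1 <= r1 ->
  ~ (forall r, r1 <= r -> V k r <= - c).
Proof.
elim: k c r1 => [|k IH] c r1 km c0 r11 H.
  by have := H r1 (Rle_refl _); have := V0_ge0 r1 r11; lra.
have [r2 [r21 H2]] := ode_neg_step k c r1 (ltnW km) c0 r11 H.
by apply: (IH 1 r2 (ltnW km)) => //; lra.
Qed.

Hypothesis m0 : (0 < m)%N.

(** The top flux decreases because V m <= 0, so the derivative of the top mean is at most a constant
    times r^(-p) <= r^(-2). This is integrable at infinity thanks to p >= 2. *)
Lemma ode_top_upper : exists M, 0 <= M /\ forall r, 1 <= r ->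
  V m.-1 r <= M /\ P m.-1 r <= M.
Proof.
have mm : (m.-1 < m)%N by rewrite prednK.
pose P1 := Rabs (P m.-1 1).
have Pup r : 1 <= r -> P m.-1 r <= P1.
  move=> rr; have := derive_le (P m.-1) (fun=> 0) (fun t => t ^ p * V m t) (fun=> 0) 1 r rr.
  move=> H; have := Rle_abs (P m.-1 1); rewrite -/P1.
  suff : P m.-1 r - P m.-1 1 <= 0 - 0 by lra.
  apply: H => t tt; first by have := dP m.-1 t mm ltac:(lra); rewrite prednK.
    exact: is_derive_const.
  have : 0 <= t ^ p by apply: pow_le; lra.
  by have := Vm_le0 t ltac:(lra); nra.
have P10 : 0 <= P1 by apply: Rabs_pos.
exists (Rabs (V m.-1 1) + P1); split; first by have := Rabs_pos (V m.-1 1); lra.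
move=> r rr; split; last by have := Pup r rr; have := Rabs_pos (V m.-1 1); lra.
have := derive_le (V m.-1) (fun t => - P1 * / t ^ 1) (fun t => / t ^ p * P m.-1 t)
  (fun t => - P1 * (- INR 1 * / t ^ 1 * / t)) 1 r rr.
move=> H; have := Rle_abs (V m.-1 1).
have rp : 0 < / r ^ 1 by apply: Rinv_0_lt_compat; apply: pow_lt; lra.
suff : V m.-1 r - V m.-1 1 <= - P1 * / r ^ 1 - - P1 * / 1 ^ 1.
  by rewrite pow1 Rinv_1; nra.
apply: H => t tt; first by apply: dV => //; lra.
  by apply: is_derive_scal; apply: inv_pow_derive; lra.
have tp : 0 < / t ^ p by apply: Rinv_0_lt_compat; apply: pow_lt; lra.
apply: (Rle_trans _ (/ t ^ p * P1)).
  by apply: Rmult_le_compat_l; [lra | apply: Pup; lra].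
have -> : - P1 * (- INR 1 * / t ^ 1 * / t) = / t ^ 2 * P1 by rewrite /=; field; lra.
apply: Rmult_le_compat_r => //; apply: Rinv_le_contravar; first by apply: pow_lt; lra.
by apply: Rle_pow; [lra | apply/leP].
Qed.

(* If the flux were too negative at r1, the top mean would stay below -1 from
   2 r1 on, and so would eventually all the lower ones. *)
Lemma ode_top_flux_lower : exists C, 0 <= C /\ forall r, 1 <= r ->
  - (C * r ^ p.-1) <= P m.-1 r.
Proof.
have mm : (m.-1 < m)%N by rewrite prednK.
have [M [M0 HM]] := ode_top_upper.
have pp : 0 < 2 ^ p by apply: pow_lt; lra.
(* With this constant K r1 / (2 r1)^p = M + 1, so the top mean drops from at most M to at most -1
   between r1 and 2 r1. *)
exists (2 ^ p * (M + 1)); split; first by apply: Rmult_le_pos; lra.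
move=> r1 r11; apply: Rnot_lt_le => Pneg.
set K := 2 ^ p * (M + 1) * r1 ^ p.-1 in Pneg.
have K0 : 0 <= K.
  by apply: Rmult_le_pos; [apply: Rmult_le_pos; lra | apply: pow_le; lra].
have Pdec r : r1 <= r -> P m.-1 r <= - K.
  move=> rr; have := derive_le (P m.-1) (fun=> 0) (fun t => t ^ p * V m t) (fun=> 0) r1 r rr.
  move=> H; suff : P m.-1 r - P m.-1 r1 <= 0 - 0 by lra.
  apply: H => t tt; first by have := dP m.-1 t mm ltac:(lra); rewrite prednK.
    exact: is_derive_const.
  have : 0 <= t ^ p by apply: pow_le; lra.
  by have := Vm_le0 t ltac:(lra); nra.
have V2 : V m.-1 (2 * r1) <= -1.
  have rp : 0 < (2 * r1) ^ p by apply: pow_lt; lra.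
  have H := derive_le (V m.-1) (fun t => - (K / (2 * r1) ^ p) * t) (fun t => / t ^ p * P m.-1 t)
    (fun=> - (K / (2 * r1) ^ p) * 1) r1 (2 * r1) ltac:(lra).
  have : V m.-1 (2 * r1) - V m.-1 r1 <=
     - (K / (2 * r1) ^ p) * (2 * r1) - - (K / (2 * r1) ^ p) * r1.
    apply: H => t tt; first by apply: dV => //; lra.
      by apply: is_derive_scal; apply: is_derive_id.
    rewrite Rmult_1_r; have tp : 0 < t ^ p by apply: pow_lt; lra.
    have tp2 : t ^ p <= (2 * r1) ^ p by apply: pow_incr; lra.
    apply: (Rle_trans _ (/ t ^ p * - K)).
      by apply: Rmult_le_compat_l; [apply/Rlt_le/Rinv_0_lt_compat | apply: Pdec; lra].
    have : / (2 * r1) ^ p <= / t ^ p by apply: Rinv_le_contravar.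
    by rewrite /Rdiv; nra.
  have -> : - (K / (2 * r1) ^ p) * (2 * r1) - - (K / (2 * r1) ^ p) * r1 = - (M + 1).
    rewrite /K Rpow_mult_distr; have r1p : 0 < r1 ^ p by apply: pow_lt; lra.
    have -> : r1 ^ p = r1 * r1 ^ p.-1 by rewrite -[in LHS](@prednK p) //; apply: leq_trans p2.
    by field; repeat split; try lra; apply: pow_nonzero; lra.
  by have [? _] := HM r1 r11; lra.
apply: (ode_not_neg m.-1 1 (2 * r1) mm) => [||r rr]; [lra|lra|].
have H := derive_le (V m.-1) (fun=> 0) (fun t => / t ^ p * P m.-1 t) (fun=> 0) (2 * r1) r rr.
have : V m.-1 r - V m.-1 (2 * r1) <= 0 - 0; last lra.
apply: H => t tt; first by apply: dV => //; lra.
  exact: is_derive_const.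
have : 0 < / t ^ p by apply: Rinv_0_lt_compat; apply: pow_lt; lra.
by have := Pdec t ltac:(lra); nra.
Qed.

Lemma ode_growth_step k a C : (k < m)%N -> 0 <= C ->
  (forall r, 1 <= r -> V k.+1 r <= C * r ^ a) ->
  exists C', 0 <= C' /\ forall r, 1 <= r -> V k r <= C' * r ^ a.+2.
Proof.
move=> km C0 HV.
pose C1 := Rabs (P k 1) + C; have C10 : 0 <= C1 by rewrite /C1; have := Rabs_pos (P k 1); lra.
have small j (x : R) : 0 <= x -> x / INR j.+1 <= x.
  move=> x0; rewrite -[X in _ <= X]Rmult_1_r; apply: Rmult_le_compat_l => //.
  rewrite -Rinv_1; apply: Rinv_le_contravar; first lra.
  by apply: (le_INR 1); apply/leP.
have Pup r : 1 <= r -> P k r <= C1 * r ^ (p + a).+1.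
  move=> rr; have H := derive_le (P k) (fun t => C * (t ^ (p + a).+1 / INR (p + a).+1))
    (fun t => t ^ p * V k.+1 t) (fun t => C * t ^ (p + a)) 1 r rr.
  have : P k r - P k 1 <= C * (r ^ (p + a).+1 / INR (p + a).+1) - C * (1 ^ (p + a).+1 / INR (p + a).+1).
    apply: H => t tt; first by apply: dP => //; lra.
      by apply: is_derive_scal; apply: pow_Sn_derive.
    rewrite pow_add; have tp : 0 <= t ^ p by apply: pow_le; lra.
    by have := Rmult_le_compat_l _ _ _ tp (HV t ltac:(lra)); lra.
  have r1 := pow_R1_Rle r (p + a).+1 rr.
  have s1 := Rmult_le_compat_l _ _ _ C0 (small (p + a)%N (r ^ (p + a).+1) ltac:(lra)).
  have s2 : 0 <= C * (1 ^ (p + a).+1 / INR (p + a).+1).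
    apply: Rmult_le_pos => //; rewrite pow1; apply/Rlt_le/Rdiv_lt_0_compat; first lra.
    by apply: lt_0_INR; apply/ltP.
  have := Rle_abs (P k 1); have := Rabs_pos (P k 1); rewrite /C1; nra.
exists (Rabs (V k 1) + C1); split; first by have := Rabs_pos (V k 1); lra.
move=> r rr; have H := derive_le (V k) (fun t => C1 * (t ^ a.+2 / INR a.+2))
    (fun t => / t ^ p * P k t) (fun t => C1 * t ^ a.+1) 1 r rr.
have : V k r - V k 1 <= C1 * (r ^ a.+2 / INR a.+2) - C1 * (1 ^ a.+2 / INR a.+2).
  apply: H => t tt; first by apply: dV => //; lra.
    by apply: is_derive_scal; apply: pow_Sn_derive.
  have tp : 0 < t ^ p by apply: pow_lt; lra.
  apply: (Rmult_le_reg_l (t ^ p)) => //; rewrite -Rmult_assoc Rinv_r ?Rmult_1_l; last lra.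
  by have := Pup t ltac:(lra); rewrite -addnS pow_add; lra.
have r1 := pow_R1_Rle r a.+2 rr.
have s1 := Rmult_le_compat_l _ _ _ C10 (small a.+1 (r ^ a.+2) ltac:(lra)).
have s2 : 0 <= C1 * (1 ^ a.+2 / INR a.+2).
  apply: Rmult_le_pos => //; rewrite pow1; apply/Rlt_le/Rdiv_lt_0_compat; first lra.
  by apply: lt_0_INR; apply/ltP.
have := Rle_abs (V k 1); have := Rabs_pos (V k 1); nra.
Qed.

(** The bound on V m comes from the mean value theorem on [r, 2r] for the top flux, hence holds only
    at some radius s. That is enough, since the supports at all s in [r, 2r] cover a common
    shell. *)
Lemma ode_exterior : exists C, 0 < C /\ forall r, 1 <= r ->
  V 0 r <= C * r ^ (2 * m.-1) /\
  exists s, r <= s <= 2 * r /\ - V m s <= C / r ^ 2.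
Proof.
have mm : (m.-1 < m)%N by rewrite prednK.
have [M [M0 HM]] := ode_top_upper; have [C [C0 HC]] := ode_top_flux_lower.
have [C1 [C10 HC1]] : exists C1, 0 <= C1 /\ forall r, 1 <= r -> V 0 r <= C1 * r ^ (2 * m.-1).
  have G j : (j <= m.-1)%N -> exists C1, 0 <= C1 /\ forall r, 1 <= r ->
      V (m.-1 - j) r <= C1 * r ^ (2 * j).
    elim: j => [|j IH] jm.
      by exists M; split=> // r rr; rewrite subn0 muln0 Rmult_1_r; case: (HM r rr).
    have [C1 [C10 HC1]] := IH (ltnW jm).
    have E : (m.-1 - j = (m.-1 - j.+1).+1)%N by rewrite subnS prednK // subn_gt0.
    have jm' : (m.-1 - j.+1 < m)%N by apply: leq_ltn_trans (leq_subr _ _) mm.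
    rewrite E in HC1; have [C' H] := ode_growth_step _ _ _ jm' C10 HC1.
    by exists C'; rewrite mulnS.
  by have := G m.-1 (leqnn _); rewrite subnn.
pose C2 := M + C * 2 ^ p.-1.
have C20 : 0 <= C2 by rewrite /C2; have := pow_le 2 p.-1 ltac:(lra); nra.
exists (C1 + C2 + 1); split; first lra.
move=> r rr; split.
  apply: Rle_trans (HC1 r rr) _; apply: Rmult_le_compat_r; last lra.
  by apply: pow_le; lra.
have dPm t : 1 <= t -> is_derive (P m.-1) t (t ^ p * V m t).
  by move=> t1; have := dP m.-1 t mm t1; rewrite prednK.
have [s [E ss]] : exists s, P m.-1 (2 * r) - P m.-1 r = s ^ p * V m s * (2 * r - r) /\ r < s < 2 * r.
  apply: MVT_cor2; first lra.
  by move=> t tt; apply/is_derive_Reals; apply: dPm; lra.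
exists s; split; first lra.
have rp : 0 < r ^ p by apply: pow_lt; lra.
have Ep : r ^ p = r * r ^ p.-1.
  by rewrite -[in LHS](@prednK p) //; apply: leq_trans p2.
have rp1 : 1 <= r ^ p.-1 by apply: pow_R1_Rle.
have sp : r ^ p <= s ^ p by apply: pow_incr; lra.
have Vs := Vm_le0 s ltac:(lra).
have h1 : r ^ p * - V m s <= s ^ p * - V m s by apply: Rmult_le_compat_r; lra.
have h2 : r * (s ^ p * - V m s) <= C2 * r ^ p.-1.
  have [_ h3] := HM r rr; have := HC (2 * r) ltac:(lra); rewrite Rpow_mult_distr.
  by rewrite /C2; nra.
have h4 : r * (r ^ p * - V m s) <= C2 * r ^ p.-1.
  by apply: Rle_trans h2; apply: Rmult_le_compat_l; lra.
apply/Rle_div_r; first by apply: pow_lt; lra.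
apply: (Rmult_le_reg_l (r ^ p.-1)); first lra.
have -> : r ^ p.-1 * (- V m s * r ^ 2) = r * (r ^ p * - V m s) by rewrite Ep; ring.
by apply: Rle_trans h4 _; rewrite Rmult_comm; apply: Rmult_le_compat_l; lra.
Qed.

End exterior_ode.

(** * Radial potentials *)

Definition epoly (c : nat -> R) (k : nat) (r : R) := \big[Rplus/0]_(i < k) (c i * (r ^ 2) ^ i).

Lemma pow_sq (r : R) k : (r ^ 2) ^ k = r ^ (2 * k)%N.
Proof. by elim: k => [|k IH] //; rewrite mulnS pow_add -IH. Qed.

Lemma epolyS c k r : epoly c k.+1 r = epoly c k r + c k * (r ^ 2) ^ k.
Proof. by rewrite /epoly (Rsum_recr _ (fun i => c i * (r ^ 2) ^ i)). Qed.

Lemma epolySl c k r : epoly c k.+1 r = c 0%N + r ^ 2 * epoly (fun i => c i.+1) k r.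
Proof.
elim: k => [|k IH]; first by rewrite epolyS /epoly !big_ord0 /=; ring.
rewrite epolyS IH epolyS -[(r ^ 2) ^ k.+1]/(r ^ 2 * (r ^ 2) ^ k); ring.
Qed.

(** Used with e = p and then e = 1, it solves the radial Poisson equation for an even polynomial. *)
Lemma epoly_antiderivative e c k : exists c', forall r,
  is_derive (fun t => t ^ e.+1 * epoly c' k t) r (r ^ e * epoly c k r).
Proof.
exists (fun i => c i / INR (e + 2 * i).+1) => r; elim: k => [|k IH].
  rewrite /epoly big_ord0 Rmult_0_r.
  apply: (is_derive_ext (fun=> 0)); last exact: is_derive_const.
  by move=> t; rewrite big_ord0 Rmult_0_r.
rewrite epolyS Rmult_plus_distr_l.
apply: (is_derive_ext (fun t => t ^ e.+1 * epoly (fun i => c i / INR (e + 2 * i).+1) k t +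
   c k * (t ^ (e + 2 * k).+1 / INR (e + 2 * k).+1))).
  move=> t; rewrite epolyS Rmult_plus_distr_l; congr (_ + _).
  by rewrite pow_sq -addSn (pow_add _ e.+1); field; apply: not_0_INR.
apply: (is_derive_plus (fun t => t ^ e.+1 * epoly (fun i => c i / INR (e + 2 * i).+1) k t)) => //.
have -> : r ^ e * (c k * (r ^ 2) ^ k) = c k * r ^ (e + 2 * k).
  by rewrite pow_sq (pow_add _ e); ring.
by apply: is_derive_scal; apply: pow_Sn_derive.
Qed.

Lemma epoly_continuous c k r : continuous (epoly c k) r.
Proof.
elim: k => [|k IH].
  apply: (continuous_ext (fun=> 0)) => [t|]; first by rewrite /epoly big_ord0.
  exact: continuous_const.
apply: (continuous_ext (fun t => plus (epoly c k t) (c k * (t ^ 2) ^ k))).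
  by move=> t; rewrite epolyS.
apply: continuous_plus => //; apply: ex_derive_continuous; auto_derive => //.
Qed.

(* Richardson extrapolation: combining the values at r and r/2 kills the top
   coefficient of an even polynomial and keeps the constant one. *)
Lemma richardson k : exists C, 0 <= C /\ forall c rho M, 0 < rho ->
  (forall r, rho / 2 ^ k <= r <= rho -> Rabs (epoly c k.+1 r) <= M) -> Rabs (c 0%N) <= C * M.
Proof.
elim: k => [|k [C [C0 IH]]].
  exists 1; split; first lra.
  move=> c rho M rho0 /(_ rho); rewrite epolyS {1}/epoly big_ord0 /=.
  by rewrite Rmult_1_r Rplus_0_l Rmult_1_l; apply; lra.
exists (C * 3); split; first lra.
move=> c rho M rho0 HM; set f := 4 ^ k.+1.
have f4 : 4 <= f by rewrite /f /=; have := pow_R1_Rle 4 k ltac:(lra); lra.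
(* Coefficients of (f E(r/2) - E(r)) / (f - 1): the multiplier is 1 at i = 0 and 0 at i = k+1. As f
   >= 4, the factor 3 in the constant dominates (f + 1)/(f - 1). *)
pose c' i := (f / 4 ^ i - 1) / (f - 1) * c i.
have E r : epoly c' k.+1 r = (f * epoly c k.+2 (r / 2) - epoly c k.+2 r) / (f - 1).
  have E1 j : epoly c' j r = (f * epoly c j (r / 2) - epoly c j r) / (f - 1).
    elim: j => [|j IHj]; first by rewrite /epoly !big_ord0; field; lra.
    rewrite !epolyS IHj /c'.
    have -> : (r / 2) ^ 2 = r ^ 2 / 4 by field.
    have -> : (r ^ 2 / 4) ^ j = (r ^ 2) ^ j / 4 ^ j by rewrite /Rdiv Rpow_mult_distr pow_inv.
    by field; repeat split; try lra; apply: pow_nonzero; lra.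
  rewrite -E1 [RHS]epolyS /c' /f.
  have -> : 4 ^ k.+1 / 4 ^ k.+1 = 1 by field; apply: pow_nonzero; lra.
  by rewrite Rminus_diag /Rdiv !Rmult_0_l Rplus_0_r.
have c00 : c' 0%N = c 0%N by rewrite /c' /=; field; lra.
have M0 : 0 <= M.
  apply: Rle_trans (Rabs_pos _) (HM rho _); split; last lra.
  apply/Rle_div_l; first by apply: pow_lt; lra.
  by have := pow_R1_Rle 2 k.+1 ltac:(lra); nra.
rewrite -c00 Rmult_assoc; apply: (IH c' rho) => // r rr.
have k2 : 0 < 2 ^ k by apply: pow_lt; lra.
have rE : rho / 2 ^ k.+1 = rho / 2 ^ k / 2 by rewrite /=; field; lra.
have rp : 0 < rho / 2 ^ k by apply: Rdiv_lt_0_compat.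
have h1 := HM (r / 2) ltac:(lra); have h2 := HM r ltac:(lra).
rewrite E Rabs_div; last lra.
rewrite (Rabs_right (f - 1)); last lra.
apply/Rle_div_l; first lra.
apply: Rle_trans (Rabs_triang _ _) _; rewrite Rabs_Ropp Rabs_mult (Rabs_right f); last lra.
nra.
Qed.

(** Fixes the integration constant of a flux as 0: no point source sits at the centre. *)
Lemma flat_zero f C rho : 0 < rho -> (forall r, 0 < r <= rho -> is_derive f r 0) ->
  (forall r, 0 < r <= rho -> Rabs (f r) <= C * r) -> forall r, 0 < r <= rho -> f r = 0.
Proof.
move=> rho0 df fC r rr.
have fr s : 0 < s <= r -> f s = f r.
  case=> s0 [sr|->//]; apply: eq_is_derive => // u us; apply: df; lra.
apply: Rabs_eq_0; apply: Rle_antisym; last exact: Rabs_pos.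
apply: Rnot_lt_le => fr0.
pose s := Rmin r (Rabs (f r) / (2 * (Rabs C + 1))).
have C0 := Rabs_pos C; have C1 := Rle_abs C.
have s0 : 0 < s by apply: Rmin_pos; [lra | apply: Rdiv_lt_0_compat; lra].
have sr : s <= r := Rmin_l _ _.
have := fC s ltac:(lra); rewrite fr; last lra.
have : s <= Rabs (f r) / (2 * (Rabs C + 1)) := Rmin_r _ _.
move=> sd; have : s * (2 * (Rabs C + 1)) <= Rabs (f r) by apply/Rle_div_r => //; lra.
nra.
Qed.

Section potential.
Variables (p : nat) (rho a : R).
Hypotheses (rho0 : 0 < rho) (a0 : 0 < a).

(** N(r) is the integral of s^(-p) Y(s) from r to rho. The bound on Y makes the integrand O(s), so
    extending it by 0 to s <= 0 gives a continuous function on the line. *)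
Lemma potential_of_flux (Y : R -> R) M : (forall r, 0 < r -> continuous Y r) ->
  (forall r, 0 < r <= rho -> Rabs (Y r) <= M * r ^ p.+1) ->
  exists N : R -> R, [/\ forall r, continuous N r, N rho = 0 &
    forall r, 0 < r -> is_derive N r (- (/ r ^ p * Y r))].
Proof.
move=> cY YM; pose k s := if Rle_dec s 0 then 0 else / s ^ p * Y s.
have kpos s : 0 < s -> k s = / s ^ p * Y s.
  by rewrite /k; case: (Rle_dec s 0) => //= *; exfalso; lra.
have kneg s : s <= 0 -> k s = 0 by rewrite /k; case: (Rle_dec s 0).
have ck s : continuous k s.
  case: (Rtotal_order s 0) => [s0|[->|s0]].
  - apply: (continuous_ext_loc _ (fun=> 0)); last exact: continuous_const.
    have e0 : 0 < - s by lra.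
    exists (mkposreal _ e0) => t tt; rewrite kneg//.
    by move/Rabs_lt_between': tt => /=; lra.
  - apply/continuity_pt_filterlim => eps e0.
    have M0 : 0 < Rabs M + 1 by have := Rabs_pos M; lra.
    exists (Rmin rho (eps / (Rabs M + 1))); split.
      by apply: Rmin_pos => //; apply: Rdiv_lt_0_compat.
    move=> t [_ tt]; rewrite /= /R_dist in tt *; rewrite Rminus_0_r in tt.
    have t1 := Rlt_le_trans _ _ _ tt (Rmin_l _ _).
    have t2 := Rlt_le_trans _ _ _ tt (Rmin_r _ _).
    rewrite (kneg 0); last lra.
    rewrite Rminus_0_r; case: (Rle_lt_dec t 0) => tp.
      by rewrite kneg// Rabs_R0.
    rewrite kpos// Rabs_mult (Rabs_right (/ _)); last first.
      by apply/Rle_ge/Rlt_le/Rinv_0_lt_compat/pow_lt.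
    rewrite (Rabs_right t) in t1 t2; last lra.
    have tpp : 0 < t ^ p by apply: pow_lt.
    have := YM t ltac:(lra).
    move/(Rmult_le_compat_l (/ t ^ p) _ _ (Rlt_le _ _ (Rinv_0_lt_compat _ tpp))).
    have -> : / t ^ p * (M * t ^ p.+1) = M * t by rewrite /=; field; lra.
    move: t2 => /(Rlt_div_r _ _ _ M0); have := Rle_abs M; nra.
  - apply: (continuous_ext_loc _ (fun t => mult (/ t ^ p) (Y t))).
      exists (mkposreal _ s0) => t tt; rewrite kpos//.
      by move/Rabs_lt_between': tt => /=; lra.
    apply: continuous_mult; last exact: cY.
    apply: ex_derive_continuous; eexists; exact: inv_pow_derive.
have ek r s : ex_RInt k r s by apply: ex_RInt_continuous => t _; apply: ck.
pose N r := - RInt k rho r.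
have dN r : is_derive N r (- k r).
  apply: is_derive_opp; apply: (is_derive_RInt k _ rho); last exact: ck.
  by exists (mkposreal _ Rlt_0_1) => t _; apply: RInt_correct.
exists N; split.
- by move=> r; apply: ex_derive_continuous; exists (- k r).
- by rewrite /N RInt_point Ropp_0.
- by move=> r r0; rewrite -kpos.
Qed.

Lemma flux_of_density (h : R -> R) : (forall r, continuous h r) -> exists (Y : R -> R) M,
  [/\ forall r, is_derive Y r (r ^ p * h r), Y 0 = 0 &
   forall r, 0 < r <= rho -> Rabs (Y r) <= M * r ^ p.+1].
Proof.
move=> ch; pose k t := t ^ p * h t.
have ck t : continuous k t.
  apply: (continuous_mult (fun t => t ^ p)) => //.
  by apply: ex_derive_continuous; auto_derive.
have ek r s : ex_RInt k r s by apply: ex_RInt_continuous => t _; apply: ck.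
have dY r : is_derive (fun r => RInt k 0 r) r (k r).
  apply: (is_derive_RInt k _ 0); last exact: ck.
  by exists (mkposreal _ Rlt_0_1) => t _; apply: RInt_correct.
have [M HM] : exists M, forall r, 0 <= r <= rho -> Rabs (h r) <= M.
  have cc r : 0 <= r <= rho -> continuity_pt (fun t => Rabs (h t)) r.
    move=> _; apply: (continuity_pt_comp h Rabs); last exact: Rcontinuity_abs.
    by apply/continuity_pt_filterlim; apply: ch.
  have [x [Hx _]] := continuity_ab_maj (fun t => Rabs (h t)) 0 rho (Rlt_le _ _ rho0) cc.
  by exists (Rabs (h x)).
exists (fun r => RInt k 0 r), M; split=> //; first by rewrite RInt_point.
move=> r rr.
have M0 : 0 <= M by apply: Rle_trans (Rabs_pos _) (HM 0 _); lra.
have r0 : 0 <= r by lra.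
have Mk t : 0 <= t <= r -> - (M * t ^ p) <= k t <= M * t ^ p.
  move=> tt; apply/Rabs_le_between; rewrite /k Rabs_mult Rmult_comm (Rabs_right (_ ^ _)).
    by apply: Rmult_le_compat_r; [apply: pow_le; lra | apply: HM; lra].
  by apply/Rle_ge/pow_le; lra.
have p1 : 1 <= INR p.+1 by apply: (le_INR 1); apply/leP.
have F0 : M * (0 ^ p.+1 / INR p.+1) = 0 by rewrite pow_i; [field; lra | apply/ltP].
have F1 : M * (r ^ p.+1 / INR p.+1) <= M * r ^ p.+1.
  apply: Rmult_le_compat_l => //; apply/Rle_div_l; first lra.
  by have := pow_le r p.+1 r0; nra.
have dF t : is_derive (fun t => M * (t ^ p.+1 / INR p.+1)) t (M * t ^ p).
  by apply: is_derive_scal; apply: pow_Sn_derive.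
have dF' t : is_derive (fun t => - (M * (t ^ p.+1 / INR p.+1))) t (- (M * t ^ p)).
  exact: (is_derive_opp _ _ _ (dF t)).
have u := derive_le _ _ _ _ 0 r r0 (fun t _ => dY t) (fun t _ => dF t) (fun t tt => proj2 (Mk t tt)).
have l := derive_le _ _ _ _ 0 r r0 (fun t _ => dF' t) (fun t _ => dY t) (fun t tt => proj1 (Mk t tt)).
have Y0 : RInt k 0 0 = 0 by rewrite RInt_point.
rewrite Y0 F0 in u l; apply/Rabs_le_between; lra.
Qed.

Lemma shifted_inv_pow_derive q t : 0 <= t ->
  is_derive (fun t => / (a + t) ^ q) t (- INR q * / (a + t) ^ q.+1).
Proof.
move=> t0; have at0 : 0 < a + t by lra.
have d : is_derive (fun t => a + t) t 1 by auto_derive => //; ring.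
have := is_derive_comp _ _ _ _ _ (inv_pow_derive q (a + t) at0) d.
have -> : scal 1 (- INR q * / (a + t) ^ q * / (a + t)) = - INR q * / (a + t) ^ q.+1.
  have ? : (a + t) ^ q <> 0 by apply: pow_nonzero; lra.
  by rewrite /scal /= /mult /=; field; split; lra.
by [].
Qed.

(** K (a + r)^(-q-1) decreases at least as fast as N and is nonnegative at rho, where N vanishes. *)
Lemma potential_bound N Y K q : 0 <= K -> N rho = 0 ->
  (forall r, 0 < r -> is_derive N r (- (/ r ^ p * Y r))) ->
  (forall r, 0 < r <= rho -> 0 <= Y r <= K * r ^ p * / (a + r) ^ q.+2) ->
  forall r, 0 < r <= rho -> 0 <= N r <= K * / (a + r) ^ q.+1.
Proof.
move=> K0 N0 dN YK r rr; split.
  have H := derive_le N (fun=> 0) (fun t => - (/ t ^ p * Y t)) (fun=> 0) r rho (proj2 rr).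
  have : N rho - N r <= 0 - 0; last lra.
  apply: H => t tt; [apply: dN; lra | exact: is_derive_const |].
  have : 0 < / t ^ p by apply/Rinv_0_lt_compat/pow_lt; lra.
  by have := YK t ltac:(lra); nra.
have H := derive_le (fun t => K * / (a + t) ^ q.+1) N
  (fun t => K * (- INR q.+1 * / (a + t) ^ q.+2)) (fun t => - (/ t ^ p * Y t)) r rho (proj2 rr).
have : K * / (a + rho) ^ q.+1 - K * / (a + r) ^ q.+1 <= N rho - N r.
  apply: H => t tt; [|apply: dN; lra|].
    by apply: is_derive_scal; apply: shifted_inv_pow_derive; lra.
  have tp : 0 < t ^ p by apply: pow_lt; lra.
  have ip : 0 < / t ^ p by apply: Rinv_0_lt_compat.
  have aq : 0 < / (a + t) ^ q.+2 by apply/Rinv_0_lt_compat/pow_lt; lra.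
  have [_ h] := YK t ltac:(lra).
  have := Rmult_le_compat_l _ _ _ (Rlt_le _ _ ip) h.
  have -> : / t ^ p * (K * t ^ p * / (a + t) ^ q.+2) = K * / (a + t) ^ q.+2 by field; split; [apply: pow_nonzero|]; lra.
  have q1 : 1 <= INR q.+1 by apply: (le_INR 1); apply/leP.
  have Kq : 0 <= K * / (a + t) ^ q.+2 by apply: Rmult_le_pos; lra.
  nra.
have : 0 <= K * / (a + rho) ^ q.+1.
  by apply: Rmult_le_pos => //; apply/Rlt_le/Rinv_0_lt_compat/pow_lt; lra.
lra.
Qed.

(* Up to a constant, (a + r)^-(q+1) is a supersolution for the density (a + r)^-(q+3). *)
Lemma flux_bound (h Y : R -> R) K q : 0 <= K -> (0 < p)%N -> (q.+3 <= p)%N -> Y 0 = 0 ->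
  (forall r, is_derive Y r (r ^ p * h r)) ->
  (forall r, 0 < r <= rho -> 0 <= h r <= K * / (a + r) ^ q.+3) ->
  forall r, 0 < r <= rho -> 0 <= Y r <= K * r ^ p * / (a + r) ^ q.+2.
Proof.
move=> K0 p0 qp Y0 dY hK r rr.
have r0 : 0 <= r by lra.
have zp : 0 ^ p = 0 by apply: pow_i; apply/ltP.
split.
  have H := derive_le (fun=> 0) Y (fun=> 0) (fun t => t ^ p * h t) 0 r r0.
  have : 0 - 0 <= Y r - Y 0; last lra.
  apply: H => t tt; [exact: is_derive_const | exact: dY |].
  case: (Req_dec t 0) => [->|t0]; first by rewrite zp; lra.
  by apply: Rmult_le_pos; [apply: pow_le; lra | case: (hK t ltac:(lra))].
pose F t := K * (t ^ p * / (a + t) ^ q.+2).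
pose dF t := K * (INR p * t ^ p.-1 * / (a + t) ^ q.+2 + t ^ p * (- INR q.+2 * / (a + t) ^ q.+3)).
have H := derive_le Y F (fun t => t ^ p * h t) dF 0 r r0.
have : Y r - Y 0 <= F r - F 0.
  apply: H => t tt; first exact: dY.
    apply: is_derive_scal; apply/is_derive_Reals.
    apply: (derivable_pt_lim_mult (fun t => t ^ p)); apply/is_derive_Reals.
      by have := pow_derive p.-1 t; rewrite prednK.
    by apply: shifted_inv_pow_derive; lra.
  have at0 : 0 < / (a + t) ^ q.+3 by apply/Rinv_0_lt_compat/pow_lt; lra.
  have tp1 : 0 <= t ^ p.-1 by apply: pow_le; lra.
  have tpE : t ^ p = t * t ^ p.-1 by rewrite -[in LHS](prednK p0).
  have aE : / (a + t) ^ q.+2 = (a + t) * / (a + t) ^ q.+3.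
    have ? : (a + t) ^ q.+2 <> 0 by apply: pow_nonzero; lra.
    by rewrite -[(a + t) ^ q.+3]/((a + t) * (a + t) ^ q.+2); field; split; lra.
  (* This gap yields p (a + t) - (q + 2) t >= t, the supersolution inequality. *)
  have pq : INR q.+2 + 1 <= INR p by rewrite -S_INR; apply/le_INR/leP.
  apply: (Rle_trans _ (K * (t ^ p * / (a + t) ^ q.+3))).
    case: (Req_dec t 0) => [->|t0]; first by rewrite zp; lra.
    have [_ h1] := hK t ltac:(lra).
    by have := Rmult_le_compat_l (t ^ p) _ _ ltac:(apply: pow_le; lra) h1; lra.
  rewrite /dF; apply: Rmult_le_compat_l => //; rewrite aE tpE.
  have -> : INR p * t ^ p.-1 * ((a + t) * / (a + t) ^ q.+3) +
     t * t ^ p.-1 * (- INR q.+2 * / (a + t) ^ q.+3) =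
     (t ^ p.-1 * / (a + t) ^ q.+3) * (INR p * (a + t) - INR q.+2 * t) by ring.
  have -> : t * t ^ p.-1 * / (a + t) ^ q.+3 = (t ^ p.-1 * / (a + t) ^ q.+3) * t by ring.
  apply: Rmult_le_compat_l; first by apply: Rmult_le_pos; lra.
  have := pos_INR q.+2; nra.
by rewrite /F zp Y0; lra.
Qed.

End potential.

(** * The radial equations on a ball *)

Lemma Rmin_continuous (c r : R) : continuous (fun t => Rmin t c) r.
Proof.
apply/continuity_pt_filterlim => eps e0; exists eps; split=> // t [_ tt].
apply: Rle_lt_trans tt; rewrite /= /R_dist.
by rewrite /Rmin; case: Rle_dec => ?; case: Rle_dec => ?; split_Rabs; lra.
Qed.

Section interior_ode.
Variables (m p : nat) (V P : nat -> R -> R) (rho a B : R).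
Hypotheses (modd : odd m) (mp : (2 * m <= p)%N).
Hypotheses (rho0 : 0 < rho) (a0 : 0 < a) (B0 : 0 <= B).
Hypothesis dV : forall k r, (k < m)%N -> 0 < r <= rho -> is_derive (V k) r (/ r ^ p * P k r).
Hypothesis dP : forall k r, (k < m)%N -> 0 < r <= rho -> is_derive (P k) r (r ^ p * V k.+1 r).
Hypothesis Ptop : forall r, 0 < r <= rho ->
  0 <= - P m.-1 r <= B /\ - P m.-1 r <= B * (r / a) ^ p.+1.
Hypothesis Psmall : forall k, (k < m)%N -> exists M, forall r, 0 < r <= rho -> Rabs (P k r) <= M * r ^ p.

(** [Ptop] bounds the flux by B min(1, r/a)^(p+1), from the total mass and from the supremum of g.
    Since min(1, r/a) <= 2r/(a + r), the factor 2^(p+1) merges both cases into one smooth bound. *)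
Let K := B * 2 ^ p.+1.

Lemma K_ge0 : 0 <= K.
Proof. by apply: Rmult_le_pos => //; apply: pow_le; lra. Qed.

Lemma derive_const_on f (r : R) : (forall t, 0 < t <= rho -> is_derive f t 0) ->
  0 < r <= rho -> f r = f rho.
Proof.
move=> df [r0 [rr|->//]]; apply: eq_is_derive => // u us; apply: df; lra.
Qed.

Lemma decomposition_base : exists (N : R -> R) c,
  [/\ forall r, continuous N r,
      forall r, 0 < r <= rho -> 0 <= N r <= K * / (a + r) ^ p.-1 &
      forall r, 0 < r <= rho -> V m.-1 r = N r + epoly c 1 r].
Proof.
have m0 : (0 < m)%N by apply: odd_gt0.
have mm : (m.-1 < m)%N by rewrite prednK.
have p2 : (2 <= p)%N by apply: leq_trans mp; rewrite -{1}(muln1 2%N) leq_mul2l.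
have [q Eq] : exists q, p = q.+2 by exists p.-2; rewrite -subn2 -addn2 subnK.
(* Frozen beyond rho, where nothing is known about [P], so that Y is continuous on the whole
   half-line. *)
pose Y r := - P m.-1 (Rmin r rho).
have YE r : r <= rho -> Y r = - P m.-1 r by move=> rr; rewrite /Y Rmin_left.
have minr r : 0 < r -> 0 < Rmin r rho <= rho.
  by move=> r0; split; [apply: Rmin_pos | apply: Rmin_r].
have cY r : 0 < r -> continuous Y r.
  move=> r0; apply: (continuous_opp (fun t => P m.-1 (Rmin t rho))).
  apply: (continuous_comp (fun t => Rmin t rho)); first exact: Rmin_continuous.
  by apply: ex_derive_continuous; eexists; apply: dP => //; apply: minr.
have ap : 0 < a ^ p.+1 by apply: pow_lt.
have YM r : 0 < r <= rho -> Rabs (Y r) <= B / a ^ p.+1 * r ^ p.+1.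
  move=> rr; rewrite YE; last lra.
  have [[h1 h2] h3] := Ptop r rr.
  rewrite Rabs_right; last lra.
  by apply: Rle_trans h3 _; rewrite /Rdiv Rpow_mult_distr pow_inv; lra.
have [N [cN N0 dN]] := potential_of_flux p rho rho0 Y _ cY YM.
have YK r : 0 < r <= rho -> 0 <= Y r <= K * r ^ p * / (a + r) ^ q.+2.
  move=> rr; rewrite YE; last lra.
  have [[h1 h2] h3] := Ptop r rr; split=> //; rewrite -Eq.
  have s0 : 0 < / (a + r) by apply: Rinv_0_lt_compat; lra.
  have frac : 0 <= r * / (a + r) <= 1.
    split; first by apply: Rmult_le_pos; lra.
    by rewrite -[X in _ <= X](Rinv_r (a + r)); [apply: Rmult_le_compat_r|]; lra.
  have pw : (r * / (a + r)) ^ p.+1 <= r ^ p * / (a + r) ^ p.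
    rewrite -pow_inv -Rpow_mult_distr /=.
    by have := pow_le _ p (proj1 frac); nra.
  suff : - P m.-1 r <= B * (2 ^ p.+1 * (r * / (a + r)) ^ p.+1).
    move=> h; apply: Rle_trans h _; rewrite /K.
    have -> : B * 2 ^ p.+1 * r ^ p * / (a + r) ^ p = B * (2 ^ p.+1 * (r ^ p * / (a + r) ^ p)) by ring.
    apply: Rmult_le_compat_l => //; apply: Rmult_le_compat_l => //.
    by apply: pow_le; lra.
  rewrite -Rpow_mult_distr; case: (Rle_lt_dec r a) => ra.
    apply: Rle_trans h3 _; apply: Rmult_le_compat_l => //; apply: pow_incr; split.
      by apply: Rmult_le_pos; [lra | apply/Rlt_le/Rinv_0_lt_compat].
    have -> : r / a = 2 * (r * / (2 * a)) by field; lra.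
    apply: Rmult_le_compat_l; first lra.
    by apply: Rmult_le_compat_l; [lra | apply: Rinv_le_contravar; lra].
  apply: Rle_trans h2 _; rewrite -[X in X <= _]Rmult_1_r; apply: Rmult_le_compat_l => //.
  apply: pow_R1_Rle.
  have -> : 1 = 2 * (r * / (2 * r)) by field; lra.
  apply: Rmult_le_compat_l; first lra.
  by apply: Rmult_le_compat_l; [lra | apply: Rinv_le_contravar; lra].
have NK := potential_bound p rho a rho0 a0 N Y K q K_ge0 N0 dN YK.
pose d := V m.-1 rho - N rho.
exists N, (fun=> d); split=> //.
  by move=> r rr; rewrite Eq; apply: NK.
move=> r rr; rewrite epolyS {1}/epoly big_ord0 /= Rplus_0_l Rmult_1_r.
have := derive_const_on (fun t => V m.-1 t - N t) r _ rr.
move=> H; suff : V m.-1 r - N r = V m.-1 rho - N rho by rewrite /d; lra.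
apply: H => t tt; have d1 := dV m.-1 t mm tt; have d2 := dN t (proj1 tt).
have := is_derive_minus _ _ _ _ _ d1 d2.
by rewrite YE; [rewrite /minus /plus /opp /= -[X in is_derive _ _ X -> _](_ : 0 = _) //; ring | lra].
Qed.

(** One inversion of the radial Laplacian. The potential gains two powers of a + r and changes sign,
    as it decreases towards 0 at rho; the polynomial gains the factor r^2 and a new constant term,
    the integration constant of the mean. *)
Lemma decomposition_step j (N : R -> R) c : (j.+1 < m)%N -> (forall r, continuous N r) ->
  (forall r, 0 < r <= rho -> 0 <= N r <= K * / (a + r) ^ (p.-1 - 2 * j)) ->
  (forall r, 0 < r <= rho -> V (m.-1 - j) r = (-1) ^ j * N r + epoly c j.+1 r) ->
  exists (N' : R -> R) c',
  [/\ forall r, continuous N' r,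
      forall r, 0 < r <= rho -> 0 <= N' r <= K * / (a + r) ^ (p.-1 - 2 * j.+1) &
      forall r, 0 < r <= rho -> V (m.-1 - j.+1) r = (-1) ^ j.+1 * N' r + epoly c' j.+2 r].
Proof.
move=> jm cN NK VE.
set k := (m.-1 - j.+1)%N.
have kE : (m.-1 - j = k.+1)%N.
  by rewrite /k; lia.
have km : (k < m)%N.
  by rewrite /k; lia.
rewrite kE in VE.
have jp : (2 * j.+2 <= p)%N by apply: leq_trans mp; rewrite leq_mul2l.
have [q [Eq Eq' qp]] : exists q, [/\ (p.-1 - 2 * j = q.+3)%N, (p.-1 - 2 * j.+1 = q.+1)%N & (q.+3 <= p)%N].
  by exists (p - 2 * j - 4)%N; split; lia.
rewrite Eq in NK; rewrite Eq'.
have p0 : (0 < p)%N by apply: leq_trans qp.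
have [Y [M [dY Y0 YM]]] := flux_of_density p rho rho0 N cN.
have cY r : 0 < r -> continuous Y r.
  by move=> _; apply: ex_derive_continuous; eexists; apply: dY.
have [N' [cN' N0' dN']] := potential_of_flux p rho rho0 Y _ cY YM.
have YK := flux_bound p rho a a0 N Y K q K_ge0 p0 qp Y0 dY NK.
have NK' := potential_bound p rho a rho0 a0 N' Y K q K_ge0 N0' dN' YK.
have [c1 dc1] := epoly_antiderivative p c j.+1.
have [c2 dc2] := epoly_antiderivative 1 c1 j.+1.
have [M1 HM1] : exists M, forall r, 0 <= r <= rho -> Rabs (epoly c1 j.+1 r) <= M.
  have cc r : 0 <= r <= rho -> continuity_pt (fun t => Rabs (epoly c1 j.+1 t)) r.
    move=> _; apply: (continuity_pt_comp (epoly c1 j.+1) Rabs); last exact: Rcontinuity_abs.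
    by apply/continuity_pt_filterlim; apply: epoly_continuous.
  have [x [Hx _]] := continuity_ab_maj (fun t => Rabs (epoly c1 j.+1 t)) 0 rho (Rlt_le _ _ rho0) cc.
  by exists (Rabs (epoly c1 j.+1 x)).
pose s : R := (-1) ^ j.
have s1 : Rabs s = 1 by rewrite /s -RPow_abs Rabs_Ropp Rabs_R1 pow1.
(* Flux minus its expected form: constant by the equation and O(r) by [Psmall], hence zero. *)
pose f r := P k r - (s * Y r + r ^ p.+1 * epoly c1 j.+1 r).
have df r : 0 < r <= rho -> is_derive f r 0.
  move=> rr; have d1 := dP k r km rr.
  have d2 := is_derive_scal _ _ s _ (dY r).
  have d3 := is_derive_plus _ _ _ _ _ d2 (dc1 r).
  have := is_derive_minus _ _ _ _ _ d1 d3.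
  rewrite VE // -/s /minus /plus /opp /=.
  have -> : r ^ p * (s * N r + epoly c j.+1 r) + - (s * (r ^ p * N r) + r ^ p * epoly c j.+1 r) = 0 by ring.
  by [].
have [Mk HMk] := Psmall k km.
have fb r : 0 < r <= rho -> Rabs (f r) <= (Rabs Mk * rho ^ p.-1 + (Rabs M + Rabs M1) * rho ^ p) * r.
  move=> rr; have pE (x : R) : x ^ p = x * x ^ p.-1 by rewrite -[in LHS](prednK p0).
  have r1 : r ^ p.-1 <= rho ^ p.-1 by apply: pow_incr; lra.
  have r2 : r ^ p <= rho ^ p by apply: pow_incr; lra.
  have r10 : 0 <= r ^ p.-1 by apply: pow_le; lra.
  have r20 : 0 <= r ^ p by apply: pow_le; lra.
  have h1 : Rabs (P k r) <= Rabs Mk * rho ^ p.-1 * r.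
    apply: Rle_trans (HMk r rr) _; rewrite pE.
    have : Mk * r ^ p.-1 <= Rabs Mk * rho ^ p.-1.
      by have := Rle_abs Mk; have := Rabs_pos Mk; nra.
    by nra.
  have h2 : Rabs (s * Y r) <= Rabs M * rho ^ p * r.
    rewrite Rabs_mult s1 Rmult_1_l; apply: Rle_trans (YM r rr) _.
    have : M * r ^ p <= Rabs M * rho ^ p.
      by have := Rle_abs M; have := Rabs_pos M; nra.
    by rewrite -[r ^ p.+1]/(r * r ^ p); nra.
  have h3 : Rabs (r ^ p.+1 * epoly c1 j.+1 r) <= Rabs M1 * rho ^ p * r.
    rewrite Rabs_mult Rabs_right; last by apply/Rle_ge/pow_le; lra.
    have e1 : Rabs (epoly c1 j.+1 r) <= Rabs M1.
      by apply: Rle_trans (Rle_abs M1); apply: HM1; lra.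
    have e2 : r ^ p * Rabs (epoly c1 j.+1 r) <= rho ^ p * Rabs M1.
      by apply: Rmult_le_compat => //; apply: Rabs_pos.
    by rewrite -[r ^ p.+1]/(r * r ^ p); nra.
  apply: Rle_trans (Rabs_triang _ _) _; rewrite Rabs_Ropp.
  have := Rabs_triang (s * Y r) (r ^ p.+1 * epoly c1 j.+1 r); lra.
have f0 := flat_zero f _ rho rho0 df fb.
pose G r := V k r - ((-1) ^ j.+1 * N' r + r ^ 2 * epoly c2 j.+1 r).
have dG r : 0 < r <= rho -> is_derive G r 0.
  move=> rr; have d1 := dV k r km rr.
  have d2 := is_derive_scal _ _ ((-1) ^ j.+1) _ (dN' r (proj1 rr)).
  have d3 := is_derive_plus _ _ _ _ _ d2 (dc2 r).
  have := is_derive_minus _ _ _ _ _ d1 d3.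
  have -> : P k r = s * Y r + r ^ p.+1 * epoly c1 j.+1 r by have := f0 r rr; rewrite /f; lra.
  rewrite /minus /plus /opp /=.
  have -> : / r ^ p * (s * Y r + r * r ^ p * epoly c1 j.+1 r) +
    - (-1 * (-1) ^ j * - (/ r ^ p * Y r) + r * 1 * epoly c1 j.+1 r) = 0.
    by rewrite -/s; field; apply: pow_nonzero; lra.
  by [].
exists N', (fun i => if i is i'.+1 then c2 i' else G rho); split=> //.
move=> r rr; have e : V k r - _ = G rho := derive_const_on G r dG rr.
by rewrite epolySl -[epoly (fun=> _) j.+1 r]/(epoly c2 j.+1 r); lra.
Qed.

Lemma decomposition : exists (N : R -> R) c,
  [/\ forall r, continuous N r,
      forall r, 0 < r <= rho -> 0 <= N r <= K * / (a + r) ^ (p.+1 - 2 * m) &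
      forall r, 0 < r <= rho -> V 0 r = N r + epoly c m r].
Proof.
have m0 : (0 < m)%N by apply: odd_gt0.
have D j : (j < m)%N -> exists (N : R -> R) c,
  [/\ forall r, continuous N r,
      forall r, 0 < r <= rho -> 0 <= N r <= K * / (a + r) ^ (p.-1 - 2 * j) &
      forall r, 0 < r <= rho -> V (m.-1 - j) r = (-1) ^ j * N r + epoly c j.+1 r].
  elim: j => [|j IH] jm.
    have [N [c [cN NK VE]]] := decomposition_base; exists N, c; rewrite muln0 !subn0.
    by split=> // r rr; rewrite VE //= Rmult_1_l.
  have [N [c [cN NK VE]]] := IH (ltnW jm).
  exact: decomposition_step jm cN NK VE.
have mm : (m.-1 < m)%N by rewrite prednK.
have [N [c [cN NK VE]]] := D _ mm.
have E1 : (p.-1 - 2 * m.-1 = p.+1 - 2 * m)%N.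
  by lia.
have E2 : (-1) ^ m.-1 = 1.
  have -> : m.-1 = (2 * m./2)%N by rewrite mul2n -{1}(odd_double_half m) modd.
  by rewrite pow_1_even.
exists N, c; rewrite -E1; split=> //.
by move=> r rr; have := VE r rr; rewrite subnn E2 Rmult_1_l prednK.
Qed.

End interior_ode.

(** The potential is at most a multiple of B a^(2m-p-1) down to the centre, because a + r >= a. The
    constant coefficient of the polynomial follows by [richardson] from V 0 - N at radii comparable
    to rho. *)
Lemma ode_interior m p : odd m -> (2 * m <= p)%N -> exists C, 0 < C /\
  forall (V P : nat -> R -> R) rho a B L S, 0 < rho -> 0 < a -> 0 <= B -> 
  (forall k r, (k < m)%N -> 0 < r <= rho -> is_derive (V k) r (/ r ^ p * P k r)) ->
  (forall k r, (k < m)%N -> 0 < r <= rho -> is_derive (P k) r (r ^ p * V k.+1 r)) ->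
  (forall r, 0 < r <= rho -> 0 <= - P m.-1 r <= B /\ - P m.-1 r <= B * (r / a) ^ p.+1) ->
  (forall k, (k < m)%N -> exists M, forall r, 0 < r <= rho -> Rabs (P k r) <= M * r ^ p) ->
  (forall eps, 0 < eps -> exists delta, 0 < delta /\
     forall r, 0 < r < delta -> Rabs (V 0%N r - L) <= eps) ->
  (forall r, rho / 2 ^ m.-1 <= r <= rho -> 0 <= V 0%N r <= S) ->
  L <= C * (S + B / a ^ (p.+1 - 2 * m)).
Proof.
move=> modd mp; have m0 : (0 < m)%N by apply: odd_gt0.
have [C [C0 HC]] := richardson m.-1; rewrite prednK // in HC.
pose T : R := 2 ^ p.+1; have T1 : 1 <= T by apply: pow_R1_Rle; lra.
exists ((C + 1) * T + C + 1); split; first nra.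
move=> V P rho a B L S rho0 a0 B0 dV dP Ptop Psmall VL VS.
have [N [c [cN NK VE]]] := decomposition m p V P rho a B modd mp rho0 a0 B0 dV dP Ptop Psmall.
set e := (p.+1 - 2 * m)%N in NK *.
have ae : 0 < / a ^ e by apply/Rinv_0_lt_compat/pow_lt.
pose W := B / a ^ e.
have W0 : 0 <= W by apply: Rmult_le_pos => //; lra.
have NW r : 0 < r <= rho -> 0 <= N r <= T * W.
  move=> rr; have [h1 h2] := NK r rr; split=> //; apply: Rle_trans h2 _.
  have -> : T * W = B * 2 ^ p.+1 * / a ^ e by rewrite /T /W; field; apply: pow_nonzero; lra.
  apply: Rmult_le_compat_l; first by apply: Rmult_le_pos => //; apply: pow_le; lra.
  apply: Rinv_le_contravar; first by apply: pow_lt.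
  by apply: pow_incr; lra.
have r2 : 0 < rho / 2 ^ m.-1 by apply: Rdiv_lt_0_compat => //; apply: pow_lt; lra.
have S0 : 0 <= S.
  have : 0 <= V 0%N rho <= S; last lra.
  apply: VS; split; last lra.
  apply/Rle_div_l; first by apply: pow_lt; lra.
  by have := pow_R1_Rle 2 m.-1 ltac:(lra); nra.
have c0 : Rabs (c 0%N) <= C * (S + T * W).
  apply: (HC c rho) => // r rr.
  have rr' : 0 < r <= rho by lra.
  have h1 := VE r rr'; have h2 := NW r rr'; have h3 := VS r rr.
  apply/Rabs_le_between; lra.
suff LW : L <= T * W + C * (S + T * W).
  rewrite -/W; have : 0 <= (C + 1) * T * S by do 2! (apply: Rmult_le_pos => //; try lra).
  have : 0 <= C * W by apply: Rmult_le_pos.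
  by lra.
apply: Rnot_lt_le => LL; set D := T * W + _ in LL.
have e0 : 0 < (L - D) / 3 by lra.
have [d1 [d10 Hd1]] := VL _ e0.
have := epoly_continuous c m 0 => /continuity_pt_filterlim /(_ _ e0) [d2 [d20 Hd2]].
have ep0 : epoly c m 0 = c 0%N.
  by rewrite -(prednK m0) epolySl /= !Rmult_0_l Rplus_0_r.
pose r := Rmin rho (Rmin d1 d2) / 2.
have dd : 0 < Rmin d1 d2 by apply: Rmin_pos.
have d3 : 0 < Rmin rho (Rmin d1 d2) by apply: Rmin_pos.
have l1 := Rmin_l rho (Rmin d1 d2); have l2 := Rmin_r rho (Rmin d1 d2).
have l3 := Rmin_l d1 d2; have l4 := Rmin_r d1 d2.
have rr : 0 < r <= rho by rewrite /r; lra.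
have h1 := Hd1 r ltac:(rewrite /r; lra).
have h2 : Rabs (epoly c m r - epoly c m 0) < (L - D) / 3.
  apply: Hd2; split; first by split=> //; lra.
  by rewrite /= /R_dist Rminus_0_r Rabs_right; rewrite /r; lra.
rewrite ep0 in h2; have h3 := VE r rr; have h4 := NW r rr.
move/Rabs_le_between: h1; move/Rabs_lt_between: h2; move/Rabs_le_between: c0.
rewrite /D in LL *; lra.
Qed.

(** * Estimates around the origin *)

Section iterated_laplacian.
Variables (n m : nat) (v : pt n -> R) (D : seq 'I_n -> pt n -> R).
Local Notation sqdist := (sqdist n).
Local Notation origin := (origin n).
Hypothesis vD : partials_upto (2 * m) (fun y => 1/2 < enorm y) v D.

Lemma exterior_sqdist x : 1/2 < enorm x <-> 1/4 < sqdist origin x.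
Proof.
rewrite enorm_sqdist; have q0 := sqdist_ge0 n origin x.
have s0 := sqrt_pos (sqdist origin x); have ss := sqrt_sqrt _ q0.
by split; nra.
Qed.

Lemma partials_continuous l x : (size l <= 2 * m)%N -> 1/4 < sqdist origin x ->
  continuous (D l) x.
Proof.
move=> lm xu; have [_ [_ cD]] := vD.
apply/continuousP => eps e0.
have [d [d0 Hd]] := cD l lm x (proj2 (exterior_sqdist x) xu) eps e0.
have d2 : 0 < d ^ 2 by apply: pow_lt.
have u0 : 0 < sqdist origin x - 1/4 by lra.
have [e1 [e10 H1]] := proj1 (continuousP _ _ _) (sqdist_continuous n x x) _ d2.
have [e2 [e20 H2]] := proj1 (continuousP _ _ _) (sqdist_continuous n origin x) _ u0.
exists (Rmin e1 e2); split; first exact: Rmin_pos.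
move=> y yx; apply: Hd.
  apply/exterior_sqdist; have /Rabs_lt_between' : Rabs (sqdist origin y - sqdist origin x) < sqdist origin x - 1/4.
    by apply: H2 => i; apply: Rlt_le_trans (yx i) (Rmin_r _ _).
  by lra.
have := H1 y (fun i => Rlt_le_trans _ _ _ (yx i) (Rmin_l _ _)).
rewrite sqdist_self Rminus_0_r Rabs_right; last exact/Rle_ge/sqdist_ge0.
have -> : edist y x = sqrt (sqdist x y) by [].
move=> h; rewrite -(sqrt_pow2 d); last lra.
by apply: sqrt_lt_1 => //; [apply: sqdist_ge0 | lra].
Qed.

Lemma partials_derive l i x : (size l < 2 * m)%N -> 1/4 < sqdist origin x ->
  is_derive (fun t => D l (upd x i t)) (x i) (D (i :: l) x).
Proof.
move=> lm xu; have [_ [dD _]] := vD.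
by apply/is_derive_Reals; apply: dD => //; apply/exterior_sqdist.
Qed.

(* d_pre Delta^k d_l v: the derivatives listed in pre are taken last. *)
Fixpoint lap_partial (pre : seq 'I_n) (k : nat) (l : seq 'I_n) (x : pt n) : R :=
  if k is k'.+1 then \big[Rplus/0]_(i < n) lap_partial pre k' (i :: i :: l) x
  else D (pre ++ l) x.

Lemma lap_partial_nil k l x : lap_partial [::] k l x = lapD D k l x.
Proof. by elim: k l => //= k IH l; apply: eq_bigr => i _; apply: IH. Qed.

Lemma lap_partial_continuous pre k l x : (size pre + 2 * k + size l <= 2 * m)%N ->
  1/4 < sqdist origin x -> continuous (lap_partial pre k l) x.
Proof.
elim: k l => [|k IH] l km xu.
  by apply: partials_continuous => //; rewrite size_cat; lia.
by apply: Rsum_continuous => i; apply: IH => //=; lia.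
Qed.

Lemma Rsum_derive (s : seq 'I_n) (F : 'I_n -> R -> R) (dF : 'I_n -> R) t :
  (forall i, is_derive (F i) t (dF i)) ->
  is_derive (fun u => \big[Rplus/0]_(i <- s) F i u) t (\big[Rplus/0]_(i <- s) dF i).
Proof.
move=> dFE; elim: s => [|i s IH].
  rewrite big_nil; apply: (is_derive_ext (fun=> 0)); last exact: is_derive_const.
  by move=> u; rewrite big_nil.
rewrite big_cons; apply: (is_derive_ext (fun u => plus (F i u) (\big[Rplus/0]_(i <- s) F i u))).
  by move=> u; rewrite big_cons.
exact: is_derive_plus.
Qed.

Lemma lap_partial_derive pre k l i x : (size pre + 2 * k + size l < 2 * m)%N ->
  1/4 < sqdist origin x ->
  is_derive (fun t => lap_partial pre k l (upd x i t)) (x i) (lap_partial (i :: pre) k l x).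
Proof.
elim: k l => [|k IH] l km xu.
  by apply: partials_derive => //; rewrite size_cat; lia.
by apply: Rsum_derive => j; apply: IH => //=; lia.
Qed.

(** Only finite sums are exchanged; the order of differentiation never changes, so symmetry of mixed
    partials does not enter. *)
Lemma lap_partial_lap k l x :
  \big[Rplus/0]_(i < n) lap_partial [:: i; i] k l x = lapD D k.+1 l x.
Proof.
elim: k l => [|k IH] l //.
rewrite [RHS]/=; under eq_bigr => i _ do rewrite /=.
rewrite exchange_big /=; apply: eq_bigr => j _; exact: IH.
Qed.

Definition lap (k : nat) : pt n -> R := lapD D k [::].

Definition dlap (k : nat) (i : 'I_n) : pt n -> R := lap_partial [:: i] k [::].

Lemma lap_continuous k x : (k <= m)%N -> 1/4 < sqdist origin x -> continuous (lap k) x.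
Proof.
move=> km xu; apply: (continuous_ext (lap_partial [::] k [::])).
  by move=> y; apply: lap_partial_nil.
by apply: lap_partial_continuous => //=; lia.
Qed.

Lemma dlap_continuous k i x : (k < m)%N -> 1/4 < sqdist origin x -> continuous (dlap k i) x.
Proof. by move=> km xu; apply: lap_partial_continuous => //=; lia. Qed.

Lemma lap_C2 k : (k < m)%N -> C2_on n (1/4) (lap k) (dlap k) (lap k.+1).
Proof.
move=> km; split.
  move=> x xu; split; first by apply: lap_continuous => //; apply: ltnW.
  move=> i; split; first exact: dlap_continuous.
  apply: (is_derive_ext (fun t => lap_partial [::] k [::] (upd x i t))).
    by move=> t; apply: lap_partial_nil.
  by apply: lap_partial_derive => //=; lia.
exists (fun i => lap_partial [:: i; i] k [::]); split.
  move=> i x xu; split; first by apply: lap_partial_continuous => //=; lia.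
  by apply: lap_partial_derive => //=; lia.
by move=> x; rewrite lap_partial_lap.
Qed.

End iterated_laplacian.

Section exterior_estimates.
Variables (n m : nat) (w : nat -> pt n -> R) (dw : nat -> 'I_n -> pt n -> R).
Local Notation sqdist := (sqdist n).
Local Notation origin := (origin n).
Local Notation Lam := (Lam n).
Local Notation bdd := (bdd n).
Hypotheses (m0 : (0 < m)%N) (n3 : (3 <= n)%N).
Hypothesis wC2 : forall k, (k < m)%N -> C2_on n (1/4) (w k) (dw k) (w k.+1).
Hypothesis wcont : forall k x, (k <= m)%N -> 1/4 < sqdist origin x -> continuous (w k) x.
Hypothesis w0_ge0 : forall x, 1/4 < sqdist origin x -> 0 <= w 0 x.
Hypothesis wm_le0 : forall x, 1/4 < sqdist origin x -> w m x <= 0.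

Lemma adm_exterior r : 1 <= r -> adm n (1/4) origin 1 64 (/ r ^ 2).
Proof.
move=> r1; have p := inv_sq_gt0 r ltac:(lra).
have r2 : 1 <= r ^ 2 by apply: pow_R1_Rle.
have p1 : / r ^ 2 <= 1 by rewrite -Rinv_1; apply: Rinv_le_contravar; lra.
exists (1/2), (128 * r ^ 2), (/ r ^ 2 / 2); split; try lra.
  by move=> s /Rabs_lt_between; lra.
move=> x s /Rabs_lt_between ss [q1 q2]; have q0 := sqdist_ge0 n origin x.
split; first nra.
have : / r ^ 2 / 2 * sqdist origin x <= 64.
  by apply: Rle_trans q2; apply: Rmult_le_compat_r; lra.
move/(Rmult_le_compat_l (2 * r ^ 2) _ _ ltac:(lra)).
have -> : 2 * r ^ 2 * (/ r ^ 2 / 2 * sqdist origin x) = sqdist origin x by field; lra.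
lra.
Qed.

Lemma bumpX_continuous a b k q : a < b -> continuous (bumpX a b k) q.
Proof.
move=> /(bumpX_profile _ _ k) [dg [_ rem]].
by apply: ex_derive_continuous; exists (dg q); apply: quad_rem_derive.
Qed.

Lemma bumpX_supp a b k : a < b -> supp_in a b (bumpX a b k).
Proof. by move=> /(bumpX_profile _ _ k) [dg [sup _]] q _ /sup []. Qed.

Lemma bumpX_ge0 a b k q : 0 <= q -> 0 <= bumpX a b k q.
Proof.
move=> q0; rewrite bumpXE; apply: Rmult_le_pos; first exact: pow_le.
by case: (bump_range a b q).
Qed.

Lemma exterior_cut_bdd k r : (k <= m)%N -> 1 <= r ->
  bdd (fun x => w k x * bumpX 1 64 k (/ r ^ 2 * sqdist origin x)).
Proof.
move=> km r1; have := cut_continuous n _ _ _ _ _ _ _ (adm_exterior r r1)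
  (bumpX_supp 1 64 k ltac:(lra)) (fun x xu => wcont k x km xu)
  (fun q => bumpX_continuous 1 64 k q ltac:(lra)).
by case.
Qed.

Lemma exterior_cut_dom x r k : 1 <= r -> ~ (1/4 < sqdist origin x) ->
  bumpX 1 64 k (/ r ^ 2 * sqdist origin x) = 0.
Proof.
move=> r1 nx; have p := inv_sq_gt0 r ltac:(lra).
have r2 : 1 <= r ^ 2 by apply: pow_R1_Rle.
have p1 : / r ^ 2 <= 1 by rewrite -Rinv_1; apply: Rinv_le_contravar; lra.
have q0 := sqdist_ge0 n origin x.
apply: bumpX_supp; [lra | by apply: Rmult_le_pos; lra | nra].
Qed.

Lemma exterior_means : exists C, 0 < C /\ forall r, 1 <= r ->
  mean n (w 0) (bumpX 1 64 0) origin r <= C * r ^ (2 * m.-1) /\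
  exists s, r <= s <= 2 * r /\ - mean n (w m) (bumpX 1 64 m) origin s <= C / r ^ 2.
Proof.
have nE : n = n.-1.+1 by rewrite prednK //; apply: leq_trans n3.
pose V k := mean n (w k) (bumpX 1 64 k) origin.
pose P k := flux n (dw k) (bumpX 1 64 k) origin.
apply: (ode_exterior m n.-1 V P) => //.
- by lia.
- move=> k r km r1; have [dg pr] := bumpX_profile 1 64 k ltac:(lra).
  have := mean_derive n _ _ _ _ _ _ _ _ _ (Rlt_le_trans _ _ _ Rlt_0_1 r1) (adm_exterior r r1) pr (proj1 (wC2 k km)).
  have -> : r / r ^ n = / r ^ n.-1.
    have ? : r ^ n.-1 <> 0 by apply: pow_nonzero; lra.
    by rewrite [in LHS]nE -[r ^ n.-1.+1]/(r * r ^ n.-1); field; lra.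
  by [].
- move=> k r km r1; have [dg pr] := bumpX_profile 1 64 k ltac:(lra).
  have := flux_derive n _ _ _ _ _ _ _ _ _ _ (Rlt_le_trans _ _ _ Rlt_0_1 r1) (adm_exterior r r1) pr (wC2 k km).
  have -> : r ^ n / r = r ^ n.-1.
    by rewrite [in LHS]nE -[r ^ n.-1.+1]/(r * r ^ n.-1); field; lra.
  by [].
- move=> r r1; apply: Rmult_le_pos; first by apply/Rlt_le/Rinv_0_lt_compat/pow_lt; lra.
  apply: Lam_ge0; first exact: exterior_cut_bdd.
  move=> x; have p := inv_sq_gt0 r ltac:(lra).
  case: (excluded_middle_informative (1/4 < sqdist origin x)) => xu.
    apply: Rmult_le_pos; first exact: w0_ge0.
    by apply: bumpX_ge0; apply: Rmult_le_pos; [lra | apply: sqdist_ge0].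
  by rewrite exterior_cut_dom// Rmult_0_r; lra.
- move=> r r1.
  suff h : 0 <= Lam (fun x => -1 * (w m x * bumpX 1 64 m (/ r ^ 2 * sqdist origin x))).
    rewrite Lam_scal in h; last exact: exterior_cut_bdd.
    rewrite /V /mean; have : 0 < / r ^ n by apply/Rinv_0_lt_compat/pow_lt; lra.
    nra.
  apply: Lam_ge0; first by apply: bdd_scal; apply: exterior_cut_bdd.
  move=> x; have p := inv_sq_gt0 r ltac:(lra).
  case: (excluded_middle_informative (1/4 < sqdist origin x)) => xu.
    have := wm_le0 x xu.
    have : 0 <= bumpX 1 64 m (/ r ^ 2 * sqdist origin x).
      by apply: bumpX_ge0; apply: Rmult_le_pos; [lra | apply: sqdist_ge0].
    nra.
  by rewrite exterior_cut_dom// !Rmult_0_r; lra.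
Qed.

(** For |y| = 4R it contains the ball of radius R about y: [sqdist_split] with e = 1 gives 16 <= 2q
    + 2 and q <= 32 + 2 in units of R^2. For s in [R, 2R] the quotient |x|^2/s^2 stays in [7/4, 34],
    well inside the support [1, 64] of the annular bump. *)
Definition core (Rr : R) (x : pt n) := 7 * Rr ^ 2 <= sqdist origin x <= 34 * Rr ^ 2.

(** The support [1, 64] has midpoint 65/2 and half-width 63/2, which puts z in [-123/126, 6/126];
    then 1 - z^2 >= 1/25, and the bump squares it. *)
Lemma bump_core q : 7/4 <= q <= 34 -> / 625 <= bump 1 64 q.
Proof.
move=> qq; rewrite /bump; set z := (q - _) / _.
have z1 : -123/126 <= z <= 6/126 by rewrite /z; lra.
have z2 : 1 / 25 <= 1 - z ^ 2 by nra.
by rewrite (proj1 (bump0_in z _)); nra.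
Qed.

Lemma core_scale Rr s x : 1 <= Rr -> Rr <= s <= 2 * Rr -> core Rr x ->
  7/4 <= / s ^ 2 * sqdist origin x <= 34.
Proof.
move=> R1 ss [c1 c2]; have p := inv_sq_gt0 s ltac:(lra).
have sp : 0 < s ^ 2 by apply: pow_lt; lra.
have e : / s ^ 2 * s ^ 2 = 1 by field; lra.
split.
  have -> : 7 / 4 = / s ^ 2 * (7 / 4 * s ^ 2) by field; lra.
  by apply: Rmult_le_compat_l; nra.
have -> : 34 = / s ^ 2 * (34 * s ^ 2) by field; lra.
by apply: Rmult_le_compat_l; nra.
Qed.

Lemma core_exterior Rr x : 1 <= Rr -> core Rr x -> 1/4 < sqdist origin x.
Proof. by rewrite /core => R1 [c1 c2]; nra. Qed.

Lemma core_mass : exists C, 0 < C /\ forall Rr (phi : pt n -> R), 1 <= Rr ->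
  (forall x, 0 <= phi x <= 1) -> (forall x, ~ core Rr x -> phi x = 0) ->
  [/\ bdd (fun x => w 0 x * phi x), bdd (fun x => - w m x * phi x),
   Lam (fun x => w 0 x * phi x) <= C * (Rr ^ n * Rr ^ (2 * m.-1)) &
   Lam (fun x => - w m x * phi x) <= C * Rr ^ (n - 2)].
Proof.
have [C [C0 HC]] := exterior_means.
have t1 : 1 <= 2 ^ n by apply: pow_R1_Rle; lra.
exists (625 * 2 ^ n * C); split; first nra.
move=> Rr phi R1 phi1 phi0; have [E1 [s [ss E2]]] := HC Rr R1.
have dom k x (t : R) : 1 <= t -> Rr <= t <= 2 * Rr ->
    phi x <= 625 * bumpX 1 64 k (/ t ^ 2 * sqdist origin x).
  move=> t11 tR; have p := inv_sq_gt0 t ltac:(lra).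
  case: (excluded_middle_informative (core Rr x)) => cx; last first.
    rewrite phi0//; have : 0 <= bumpX 1 64 k (/ t ^ 2 * sqdist origin x); last lra.
    by apply: bumpX_ge0; apply: Rmult_le_pos; [lra | apply: sqdist_ge0].
  have qq := core_scale Rr t x R1 tR cx; have b := bump_core _ qq.
  have qk : 1 <= (/ t ^ 2 * sqdist origin x) ^ k by apply: pow_R1_Rle; lra.
  rewrite bumpXE; have := phi1 x; nra.
have dom0 x : 0 <= w 0 x * phi x <= 625 * (w 0 x * bumpX 1 64 0 (/ Rr ^ 2 * sqdist origin x)).
  case: (excluded_middle_informative (core Rr x)) => cx; last first.
    rewrite phi0// Rmult_0_r; split; first lra.
    case: (excluded_middle_informative (1/4 < sqdist origin x)) => xu.
      have := w0_ge0 x xu; have := bump_range 1 64 (/ Rr ^ 2 * sqdist origin x).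
      by rewrite /=; nra.
    by rewrite exterior_cut_dom//; lra.
  have := w0_ge0 x (core_exterior Rr x R1 cx); have := dom 0%N x Rr R1 ltac:(lra).
  by have := phi1 x; nra.
have s1 : 1 <= s by lra.
have domm x : 0 <= - w m x * phi x <= - 625 * (w m x * bumpX 1 64 m (/ s ^ 2 * sqdist origin x)).
  case: (excluded_middle_informative (core Rr x)) => cx; last first.
    rewrite phi0// Rmult_0_r; split; first lra.
    case: (excluded_middle_informative (1/4 < sqdist origin x)) => xu.
      have := wm_le0 x xu; have p := inv_sq_gt0 s ltac:(lra).
      have : 0 <= bumpX 1 64 m (/ s ^ 2 * sqdist origin x); last nra.
      by apply: bumpX_ge0; apply: Rmult_le_pos; [lra | apply: sqdist_ge0].
    by rewrite exterior_cut_dom//; lra.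
  have := wm_le0 x (core_exterior Rr x R1 cx); have := dom m x s s1 ss.
  by have := phi1 x; nra.
have b0 : bdd (fun x => 625 * (w 0 x * bumpX 1 64 0 (/ Rr ^ 2 * sqdist origin x))).
  by apply: bdd_scal; apply: exterior_cut_bdd.
have bm : bdd (fun x => - 625 * (w m x * bumpX 1 64 m (/ s ^ 2 * sqdist origin x))).
  by apply: bdd_scal; apply: exterior_cut_bdd.
have bp0 : bdd (fun x => w 0 x * phi x).
  by apply: bdd_mono b0 _ => x; have [h1 h2] := dom0 x; rewrite !Rabs_right; lra.
have bpm : bdd (fun x => - w m x * phi x).
  by apply: bdd_mono bm _ => x; have [h1 h2] := domm x; rewrite !Rabs_right; lra.
have Rn : 0 < Rr ^ n by apply: pow_lt; lra.
have sn : 0 < s ^ n by apply: pow_lt; lra.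
split=> //.
  apply: (Rle_trans _ _ _ (Lam_le n _ _ bp0 b0 (fun x => proj2 (dom0 x)))).
  rewrite Lam_scal; last exact: exterior_cut_bdd.
  move: E1; rewrite /mean; set A := Lam _ => E1.
  have := Rmult_le_compat_l _ _ _ (Rlt_le _ _ Rn) E1.
  rewrite -Rmult_assoc Rinv_r ?Rmult_1_l; last lra.
  have : 0 <= C * (Rr ^ n * Rr ^ (2 * m.-1)).
    by apply: Rmult_le_pos; [lra | apply: Rmult_le_pos; apply: pow_le; lra].
  by nra.
apply: (Rle_trans _ _ _ (Lam_le n _ _ bpm bm (fun x => proj2 (domm x)))).
rewrite Lam_scal; last exact: exterior_cut_bdd.
move: E2; rewrite /mean; set A := Lam _ => E2.
have := Rmult_le_compat_l _ _ _ (Rlt_le _ _ sn) E2.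
have -> : s ^ n * - (/ s ^ n * A) = - A by field; lra.
have sR : s ^ n <= 2 ^ n * Rr ^ n by rewrite -Rpow_mult_distr; apply: pow_incr; lra.
have CR : 0 <= C / Rr ^ 2 by apply/Rlt_le/Rdiv_lt_0_compat => //; apply: pow_lt; lra.
have := Rmult_le_compat_r _ _ _ CR sR.
have -> : 2 ^ n * Rr ^ n * (C / Rr ^ 2) = 2 ^ n * C * Rr ^ (n - 2).
  have -> : Rr ^ n = Rr ^ 2 * Rr ^ (n - 2) by rewrite -pow_add; congr (_ ^ _); lia.
  by field; lra.
by lra.
Qed.

End exterior_estimates.

(** * Estimates around a point *)

(** The primitive of minus the profile that vanishes beyond 1: through [flux_ibp] it turns a flux
    into an integral of the Laplacian. *)
Definition tail (k : nat) (q : R) : R := RInt (bumpX (-1) 1 k) q 1.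

Lemma bump11X_continuous k q : continuous (bumpX (-1) 1 k) q.
Proof. by apply: bumpX_continuous; lra. Qed.

Lemma bump11X_supp k : supp_in (-1) 1 (bumpX (-1) 1 k).
Proof. by apply: bumpX_supp; lra. Qed.

Lemma bump11X_le k q : 0 <= q -> bumpX (-1) 1 k q <= bump (-1) 1 q.
Proof.
move=> q0; case: (Rle_lt_dec q 1) => q1.
  rewrite bumpXE; have := bump_range (-1) 1 q; have := pow_le q k q0.
  by have := pow_incr q 1 k (conj q0 q1); rewrite pow1; nra.
by rewrite bump11X_supp//; [case: (bump_range (-1) 1 q) | lra].
Qed.

Lemma bump11X_integrable k a b : ex_RInt (bumpX (-1) 1 k) a b.
Proof. by apply: ex_RInt_continuous => t _; apply: bump11X_continuous. Qed.

Lemma tail_derive k q : is_derive (tail k) q (- bumpX (-1) 1 k q).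
Proof.
apply: (is_derive_RInt' (bumpX (-1) 1 k) _ q 1); last exact: bump11X_continuous.
by exists (mkposreal _ Rlt_0_1) => t _; apply: RInt_correct; apply: bump11X_integrable.
Qed.

Lemma tail_out k q : 1 <= q -> tail k q = 0.
Proof.
move=> q1; rewrite /tail (RInt_ext _ (fun=> 0)).
  by rewrite RInt_const /scal /= /mult /=; ring.
move=> t; rewrite Rmax_left// Rmin_right// => tt.
by apply: bump11X_supp; lra.
Qed.

Lemma tail_range k q : 0 <= q -> 0 <= tail k q <= 1.
Proof.
move=> q0; case: (Rle_lt_dec q 1) => q1; last by rewrite tail_out; lra.
split.
  apply: RInt_ge_0 => //; first exact: bump11X_integrable.
  by move=> t tt; apply: bumpX_ge0; lra.
apply: (Rle_trans _ (RInt (fun=> 1) q 1)).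
  apply: RInt_le => //; [exact: bump11X_integrable | exact: ex_RInt_const |].
  move=> t tt; apply: Rle_trans (bump11X_le k t _) _; first lra.
  by case: (bump_range (-1) 1 t).
by rewrite RInt_const /scal /= /mult /=; lra.
Qed.

Section local_estimate.
Variables (n m : nat) (w : nat -> pt n -> R) (dw : nat -> 'I_n -> pt n -> R).
Local Notation sqdist := (sqdist n).
Local Notation origin := (origin n).
Local Notation Lam := (Lam n).
Local Notation bdd := (bdd n).
Local Notation core := (core n).
Hypotheses (modd : odd m) (m2n : (2 * m < n)%N) (n3 : (3 <= n)%N).
Hypothesis wC2 : forall k, (k < m)%N -> C2_on n (1/4) (w k) (dw k) (w k.+1).
Hypothesis wcont : forall k x, (k <= m)%N -> 1/4 < sqdist origin x -> continuous (w k) x.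
Hypothesis w0_ge0 : forall x, 1/4 < sqdist origin x -> 0 <= w 0 x.
Hypothesis wm_le0 : forall x, 1/4 < sqdist origin x -> w m x <= 0.

Section ball.
Variables (Rr rho : R) (y0 : pt n).
Hypotheses (R1 : 1 <= Rr) (rho0 : 0 < rho).
Hypothesis ball_core : forall x, sqdist y0 x <= 4 * rho ^ 2 -> core Rr x.

Lemma scaled_le r x c : 0 < r -> / r ^ 2 * sqdist y0 x <= c -> sqdist y0 x <= c * r ^ 2.
Proof.
move=> r0 h; have rp : 0 < r ^ 2 by apply: pow_lt.
have := Rmult_le_compat_l (r ^ 2) _ _ (Rlt_le _ _ rp) h.
by rewrite -Rmult_assoc Rinv_r ?Rmult_1_l; lra.
Qed.

Lemma scaled_ge0 r x : 0 < r -> 0 <= / r ^ 2 * sqdist y0 x.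
Proof.
move=> r0; have p := inv_sq_gt0 r r0.
by apply: Rmult_le_pos; [lra | apply: sqdist_ge0].
Qed.


Lemma ball_sub r x : 0 < r <= rho -> sqdist y0 x <= 4 * r ^ 2 -> core Rr x.
Proof.
move=> rr h; apply: ball_core; have : r ^ 2 <= rho ^ 2 by apply: pow_incr; lra.
lra.
Qed.

Lemma adm_ball r : 0 < r <= rho -> adm n (1/4) y0 (-1) 1 (/ r ^ 2).
Proof.
move=> rr; have p := inv_sq_gt0 r ltac:(lra).
have rp : 0 < r ^ 2 by apply: pow_lt; lra.
have R2 : 1 <= Rr ^ 2 by apply: pow_R1_Rle.
exists (7 * Rr ^ 2), (34 * Rr ^ 2), (/ r ^ 2 / 2); split; try lra.
  by move=> s /Rabs_lt_between; lra.
move=> x s /Rabs_lt_between ss [_ q1]; apply: (ball_sub r) => //.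
have q0 := sqdist_ge0 n y0 x.
suff : / r ^ 2 * sqdist y0 x <= 2 by move/(scaled_le r x 2 ltac:(lra)); lra.
have : / r ^ 2 / 2 * sqdist y0 x <= 1.
  by apply: Rle_trans q1; apply: Rmult_le_compat_r; lra.
lra.
Qed.

Lemma ball_supp g r x : 0 < r <= rho -> supp_in (-1) 1 g -> ~ core Rr x ->
  g (/ r ^ 2 * sqdist y0 x) = 0.
Proof.
move=> rr sg nc; have q0 := scaled_ge0 r x (proj1 rr); apply: sg => // -[_ q1].
apply: nc; apply: (ball_sub r) => //; have := scaled_le r x 1 (proj1 rr) q1.
by have := pow2_ge_0 r; lra.
Qed.

Lemma tail_supp k : supp_in (-1) 1 (tail k).
Proof. by move=> q q0 nq; apply: tail_out; lra. Qed.

(** Writes the top flux as minus an integral of g >= 0 against a cutoff with values in [0, 1], so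
    its sign, the mass bound and the supremum bound can all be read off. *)
Lemma top_flux r : 0 < r <= rho ->
  flux n (dw m.-1) (bumpX (-1) 1 m.-1) y0 r =
  - (/ 2 * Lam (fun x => - w m x * tail m.-1 (/ r ^ 2 * sqdist y0 x))).
Proof.
move=> rr; have m0 : (0 < m)%N by apply: odd_gt0.
have mm : (m.-1 < m)%N by rewrite prednK.
have [C1 [ddw [C2 lwE]]] := wC2 m.-1 mm; rewrite prednK // in lwE.
have ad := adm_ball r rr.
have sN : supp_in (-1) 1 (fun q => - bumpX (-1) 1 m.-1 q).
  by move=> q q0 nq; rewrite bump11X_supp// Ropp_0.
have cN q : continuous (fun q => - bumpX (-1) 1 m.-1 q) q.
  by apply: (continuous_opp (bumpX (-1) 1 m.-1)); apply: bump11X_continuous.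
have := flux_ibp n _ _ _ _ _ _ _ _ _ _ ad (tail_supp m.-1) sN cN (tail_derive m.-1) C1 C2.
have -> : (fun x => \big[Rplus/0]_(i < n) ddw i x * tail m.-1 (/ r ^ 2 * sqdist y0 x)) =
   fun x => w m x * tail m.-1 (/ r ^ 2 * sqdist y0 x).
  by apply: functional_extensionality => x; rewrite lwE.
have [_ b1] := cut_continuous n _ _ _ _ _ _ _ ad (bump11X_supp m.-1)
  (fun x => euler_continuous n _ _ _ y0 x C1) (bump11X_continuous m.-1).
have ct q : continuous (tail m.-1) q.
  by apply: ex_derive_continuous; eexists; apply: tail_derive.
have [_ b2] := cut_continuous n _ _ _ _ _ _ _ ad (tail_supp m.-1)
  (fun x xu => wcont m x (leqnn m) xu) ct.
have -> : (fun x => euler n (dw m.-1) y0 x * - bumpX (-1) 1 m.-1 (/ r ^ 2 * sqdist y0 x)) =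
  fun x => -1 * (euler n (dw m.-1) y0 x * bumpX (-1) 1 m.-1 (/ r ^ 2 * sqdist y0 x)).
  by apply: functional_extensionality => x; ring.
have -> : (fun x => - w m x * tail m.-1 (/ r ^ 2 * sqdist y0 x)) =
  fun x => -1 * (w m x * tail m.-1 (/ r ^ 2 * sqdist y0 x)).
  by apply: functional_extensionality => x; ring.
pose A := Lam (fun x => euler n (dw m.-1) y0 x * bumpX (-1) 1 m.-1 (/ r ^ 2 * sqdist y0 x)).
pose B := Lam (fun x => w m x * tail m.-1 (/ r ^ 2 * sqdist y0 x)).
rewrite !Lam_scal// => h; have {}h : 2 * / r ^ 2 * (-1 * A) = - B := h.
by rewrite /flux -/A -/B; lra.
Qed.

(** On a ball of radius r the Euler derivative is O(r) and the mass O(r^n); with the factor r^(-2)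
    this is O(r^(n-1)). The constant may depend on the solution, as only its existence is used. *)
Lemma flux_small k : (k < m)%N -> exists M, forall r, 0 < r <= rho ->
  Rabs (flux n (dw k) (bumpX (-1) 1 k) y0 r) <= M * r ^ n.-1.
Proof.
move=> km; have nE : n = n.-1.+1 by rewrite prednK //; apply: leq_trans n3.
have [C1 _] := wC2 k km.
have R2 : 1 <= Rr ^ 2 by apply: pow_R1_Rle.
pose S x := \big[Rplus/0]_(i < n) Rabs (dw k i x).
have cS x : 7 * Rr ^ 2 <= sqdist origin x <= 34 * Rr ^ 2 -> continuous S x.
  move=> xs; apply: Rsum_continuous => i.
  apply: (continuous_comp (dw k i) Rabs); last exact: continuous_Rabs.
  by case: (C1 x ltac:(lra)) => _ /(_ i) [].
have [W [W0 HW]] := shell_bounded n _ _ _ cS.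
have [k0 [k1 [k00 [k10 mb]]]] := mass_bounds n (ltn_trans (ltn0Sn 1) n3).
exists (W * k1) => r rr; rewrite /flux.
have p := inv_sq_gt0 r (proj1 rr).
rewrite Rabs_mult (Rabs_right (/ _)); last lra.
have rp : 0 < r ^ 2 by apply: pow_lt; lra.
have r0 : 0 < r by lra.
have bb := bump_bdd n y0 r r0.
have h : Rabs (Lam (fun x => euler n (dw k) y0 x * bumpX (-1) 1 k (/ r ^ 2 * sqdist y0 x))) <=
    Lam (fun x => (r * W) * bump (-1) 1 (/ r ^ 2 * sqdist y0 x)).
  apply: Lam_abs_le; first exact: bdd_scal.
  move=> x; have q0 := scaled_ge0 r x r0.
  have b0 := bump_range (-1) 1 (/ r ^ 2 * sqdist y0 x).
  case: (Rle_lt_dec (/ r ^ 2 * sqdist y0 x) 1) => q1; last first.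
    rewrite bump11X_supp//; last lra.
    rewrite Rmult_0_r Rabs_R0; apply: Rmult_le_pos; last lra.
    by apply: Rmult_le_pos; lra.
  have qr := scaled_le r x 1 r0 q1.
  have cx : core Rr x by apply: (ball_sub r) => //; lra.
  rewrite Rabs_mult; apply: Rmult_le_compat; try exact: Rabs_pos; last first.
    by rewrite Rabs_right; [apply: bump11X_le | apply/Rle_ge/bumpX_ge0].
  rewrite /euler; apply: Rle_trans (Rsum_abs _ _ _) _.
  apply: (Rle_trans _ (r * S x)); last first.
    apply: Rmult_le_compat_l; first lra.
    by apply: Rle_trans (HW x cx); apply: Rle_abs.
  rewrite /S -Rsum_scal; apply: Rsum_le => i; rewrite Rabs_mult.
  apply: Rmult_le_compat_r; first exact: Rabs_pos.
  have := sqdist_coord n y0 x i; rewrite -pow2_abs; have := Rabs_pos (x i - y0 i).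
  by nra.
rewrite Lam_scal// massE// in h.
apply: (Rle_trans _ (/ r ^ 2 * (r * W * (k1 * r ^ n)))).
  apply: Rmult_le_compat_l; first lra.
  apply: Rle_trans h _; apply: Rmult_le_compat_l; first by apply: Rmult_le_pos; lra.
  by apply: Rmult_le_compat_r; [apply: pow_le; lra | case: (mb y0)].
rewrite [in r ^ n]nE -[r ^ n.-1.+1]/(r * r ^ n.-1).
by have -> : / r ^ 2 * (r * W * (k1 * (r * r ^ n.-1))) = W * k1 * r ^ n.-1 by [field; lra]; apply: Rle_refl.
Qed.

Lemma mean_limit eps : 0 < eps -> exists delta, 0 < delta /\ forall r, 0 < r < delta ->
  Rabs (mean n (w 0) (bumpX (-1) 1 0) y0 r - mass n y0 * w 0 y0) <= eps.
Proof.
move=> e0; have [k0 [k1 [k00 [k10 mb]]]] := mass_bounds n (ltn_trans (ltn0Sn 1) n3).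
have yc : core Rr y0.
  by apply: ball_core; rewrite sqdist_self; have := pow2_ge_0 rho; lra.
have yu : 1/4 < sqdist origin y0 by apply: core_exterior yc.
have e1 : 0 < eps / k1 by apply: Rdiv_lt_0_compat.
have [d [d0 Hd]] := proj1 (continuousP _ _ _) (wcont 0 y0 (leq0n m) yu) _ e1.
exists (Rmin d rho); split; first exact: Rmin_pos.
move=> r rr; have l1 := Rmin_l d rho; have l2 := Rmin_r d rho.
have r0 : 0 < r by lra.
have rrho : 0 < r <= rho by lra.
have bb := bump_bdd n y0 r r0.
have [_ bw] := cut_continuous n _ _ _ _ _ _ _ (adm_ball r rrho) (bump11X_supp 0)
  (fun x xu => wcont 0 x (leq0n m) xu) (bump11X_continuous 0).
have rn : 0 < r ^ n by apply: pow_lt.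
pose f x := 1 * (w 0 x * bump (-1) 1 (/ r ^ 2 * sqdist y0 x)) +
  (- w 0 y0) * bump (-1) 1 (/ r ^ 2 * sqdist y0 x).
have -> : mean n (w 0) (bumpX (-1) 1 0) y0 r - mass n y0 * w 0 y0 = / r ^ n * Lam f.
  rewrite /f Lam_lin// massE// /mean [bumpX _ _ _]/=; field; lra.
rewrite Rabs_mult (Rabs_right (/ _)); last by apply/Rle_ge/Rlt_le/Rinv_0_lt_compat.
have h : Rabs (Lam f) <= Lam (fun x => eps / k1 * bump (-1) 1 (/ r ^ 2 * sqdist y0 x)).
  apply: Lam_abs_le; first exact: bdd_scal.
  move=> x; have b0 := bump_range (-1) 1 (/ r ^ 2 * sqdist y0 x).
  have -> : f x = (w 0 x - w 0 y0) * bump (-1) 1 (/ r ^ 2 * sqdist y0 x) by rewrite /f; ring.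
  rewrite Rabs_mult (Rabs_right (bump _ _ _)); last lra.
  case: (Rle_lt_dec (/ r ^ 2 * sqdist y0 x) 1) => q1; last first.
    have -> : bump (-1) 1 (/ r ^ 2 * sqdist y0 x) = 0.
      by apply: (bump11X_supp 0); [apply: scaled_ge0 | lra].
    by rewrite !Rmult_0_r; lra.
  apply: Rmult_le_compat_r; first lra.
  apply/Rlt_le/Hd => i; have qr := scaled_le r x 1 r0 q1.
  have := sqdist_coord n y0 x i; rewrite -pow2_abs; have := Rabs_pos (x i - y0 i).
  by nra.
rewrite Lam_scal// massE// in h.
have := Rmult_le_compat_l _ _ _ (Rlt_le _ _ (Rinv_0_lt_compat _ rn)) h.
have -> : / r ^ n * (eps / k1 * (mass n y0 * r ^ n)) = eps * (mass n y0 / k1) by field; lra.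
have : mass n y0 / k1 <= 1 by apply/Rle_div_l => //; case: (mb y0) => ? ?; lra.
nra.
Qed.

End ball.

(** Instance of [ode_interior] with L the mass times w 0 y0, so the uniform lower bound on masses
    returns the value at y0. C is independent of the point and of all scales. *)
Lemma local_estimate : exists C, 0 < C /\ forall Rr rho a G0 (y0 : pt n),
  1 <= Rr -> 0 < rho -> 0 < a -> 0 < G0 ->
  (forall x, sqdist y0 x <= 4 * rho ^ 2 -> core Rr x) ->
  (forall x, sqdist y0 x <= 4 * rho ^ 2 -> - w m x <= G0) ->
  G0 * a ^ n = Rr ^ (n - 2) ->
  w 0 y0 <= C * (Rr ^ n * Rr ^ (2 * m.-1) / rho ^ n + Rr ^ (n - 2) / a ^ (n - 2 * m)).
Proof.
have m0 : (0 < m)%N by apply: odd_gt0.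
have nE : n = n.-1.+1 by rewrite prednK //; apply: leq_trans n3.
have mp : (2 * m <= n.-1)%N by lia.
have [C1 [C10 H1]] := core_mass n m w dw m0 n3 wC2 wcont w0_ge0 wm_le0.
have [C2 [C20 H2]] := ode_interior m n.-1 modd mp.
have [k0 [k1 [k00 [k10 mb]]]] := mass_bounds n (ltn_trans (ltn0Sn 1) n3).
(* Means are needed down to the radius rho / 2^(m-1); there r^(-n) <= T rho^(-n). *)
pose T := 2 ^ (m.-1 * n); have T1 : 1 <= T by apply: pow_R1_Rle; lra.
have t2 : 1 <= 2 ^ n by apply: pow_R1_Rle; lra.
pose C3 := C1 * T + (C1 + k1 * 2 ^ n).
have C30 : 0 < C3 by rewrite /C3; nra.
exists (C2 * C3 / k0); split; first by apply: Rdiv_lt_0_compat => //; nra.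
move=> Rr rho a G0 y0 R1 rho0 a0 G00 bc bG Ga.
pose V k := mean n (w k) (bumpX (-1) 1 k) y0.
pose P k := flux n (dw k) (bumpX (-1) 1 k) y0.
pose X := Rr ^ (n - 2); have X0 : 0 < X by apply: pow_lt; lra.
(* One B serves both flux bounds: C1 X from the mass of g, and k1 2^n X (r/a)^n from g <= G0 with G0
   a^n = X. *)
pose B := (C1 + k1 * 2 ^ n) * X.
pose S := C1 * T * (Rr ^ n * Rr ^ (2 * m.-1) / rho ^ n).
have rn : 0 < rho ^ n by apply: pow_lt.
have an : 0 < a ^ n by apply: pow_lt.
have core_u x : sqdist y0 x <= 4 * rho ^ 2 -> 1/4 < sqdist origin x.
  by move=> /bc; apply: core_exterior.
have key : mass n y0 * w 0 y0 <= C2 * (S + B / a ^ (n.-1.+1 - 2 * m)).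
  apply: (H2 V P rho a B) => //.
  - by apply: Rmult_le_pos; nra.
  - move=> k r km rr; have [dg pr] := bumpX_profile (-1) 1 k ltac:(lra).
    have := mean_derive n _ _ _ _ _ _ _ _ _ (proj1 rr) (adm_ball Rr rho y0 R1 bc r rr) pr (proj1 (wC2 k km)).
    have -> : r / r ^ n = / r ^ n.-1.
      have ? : r ^ n.-1 <> 0 by apply: pow_nonzero; lra.
      by rewrite [in LHS]nE -[r ^ n.-1.+1]/(r * r ^ n.-1); field; lra.
    by [].
  - move=> k r km rr; have [dg pr] := bumpX_profile (-1) 1 k ltac:(lra).
    have := flux_derive n _ _ _ _ _ _ _ _ _ _ (proj1 rr) (adm_ball Rr rho y0 R1 bc r rr) pr (wC2 k km).
    have -> : r ^ n / r = r ^ n.-1.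
      by rewrite [in LHS]nE -[r ^ n.-1.+1]/(r * r ^ n.-1); field; lra.
    by [].
  - move=> r rr; rewrite /P (top_flux Rr rho y0)// Ropp_involutive -nE.
    have r0 := proj1 rr; have rrn : 0 < r ^ n by apply: pow_lt.
    pose phi x := tail m.-1 (/ r ^ 2 * sqdist y0 x).
    have phi1 x : 0 <= phi x <= 1 by apply: tail_range; apply: scaled_ge0.
    have phi0 x : ~ core Rr x -> phi x = 0.
      by move=> nc; apply: (ball_supp Rr rho y0 bc) => //; apply: tail_supp.
    have [_ bm _ Lm] := H1 Rr phi R1 phi1 phi0.
    have phiout x : 1 < / r ^ 2 * sqdist y0 x -> phi x = 0.
      by move=> q1; apply: tail_out; lra.
    have inb x : / r ^ 2 * sqdist y0 x <= 1 -> sqdist y0 x <= 4 * rho ^ 2.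
      move=> q1; have := scaled_le y0 r x 1 r0 q1.
      have : r ^ 2 <= rho ^ 2 by apply: pow_incr; lra.
      by have := pow2_ge_0 rho; lra.
    have L0 : 0 <= Lam (fun x => - w m x * phi x).
      apply: Lam_ge0 => // x; case: (Rle_lt_dec (/ r ^ 2 * sqdist y0 x) 1) => q1.
        by have := wm_le0 x (core_u x (inb x q1)); have := phi1 x; nra.
      by rewrite phiout//; lra.
    rewrite -[Lam _]/(Lam (fun x => - w m x * phi x)).
    split; first split.
    + lra.
    + by rewrite /B -/X in Lm *; have : 0 <= k1 * 2 ^ n * X by [apply: Rmult_le_pos; nra]; lra.
    (* The bump of radius r degenerates at the boundary of its ball; the one of radius 2r is at
       least 1/2 there. *)
    have r20 : 0 < 2 * r by lra.
    have bb := bump_bdd n y0 (2 * r) r20.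
    have Lm2 : Lam (fun x => - w m x * phi x) <=
        Lam (fun x => (2 * G0) * bump (-1) 1 (/ (2 * r) ^ 2 * sqdist y0 x)).
      apply: Lam_le => //; first exact: bdd_scal.
      move=> x; have b0 := bump_range (-1) 1 (/ (2 * r) ^ 2 * sqdist y0 x).
      case: (Rle_lt_dec (/ r ^ 2 * sqdist y0 x) 1) => q1; last first.
        by rewrite phiout// Rmult_0_r; apply: Rmult_le_pos; lra.
      have q2 : / (2 * r) ^ 2 * sqdist y0 x = / r ^ 2 * sqdist y0 x / 4 by field; lra.
      have q3 := scaled_ge0 y0 r x r0.
      have : / 2 <= bump (-1) 1 (/ (2 * r) ^ 2 * sqdist y0 x).
        by apply: bump11_ge; rewrite q2; lra.
      have := bG x (inb x q1); have := wm_le0 x (core_u x (inb x q1)); have := phi1 x.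
      by nra.
    rewrite Lam_scal// massE// in Lm2.
    have -> : B * (r / a) ^ n = (C1 + k1 * 2 ^ n) * (G0 * r ^ n).
      by rewrite /B /X -Ga /Rdiv Rpow_mult_distr pow_inv; field; lra.
    have [_ mk] := mb y0; rewrite Rpow_mult_distr in Lm2.
    have g1 : 0 < G0 * r ^ n by apply: Rmult_lt_0_compat.
    have g2 : 0 <= 2 ^ n * (G0 * r ^ n) by apply: Rmult_le_pos; lra.
    have := Rmult_le_compat_r _ _ _ g2 mk; nra.
  - by move=> k km; apply: (flux_small Rr rho y0).
  - by move=> eps e0; apply: (mean_limit Rr rho y0).
  move=> r rr; have r2 : 0 < rho / 2 ^ m.-1 by apply: Rdiv_lt_0_compat => //; apply: pow_lt; lra.
  have r0 : 0 < r by lra.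
  have rrho : 0 < r <= rho by lra.
  have rrn : 0 < / r ^ n by apply/Rinv_0_lt_compat/pow_lt.
  pose phi x := bump (-1) 1 (/ r ^ 2 * sqdist y0 x).
  have phi1 x : 0 <= phi x <= 1 by apply: bump_range.
  have phi0 x : ~ core Rr x -> phi x = 0.
    by move=> nc; apply: (ball_supp Rr rho y0 bc _ _ _ rrho (bump11X_supp 0) nc).
  have [b0 _ L0 _] := H1 Rr phi R1 phi1 phi0.
  rewrite /V /mean [bumpX _ _ _]/= -/phi; split.
    apply: Rmult_le_pos; first lra.
    apply: Lam_ge0 => // x; case: (excluded_middle_informative (core Rr x)) => cx.
      by apply: Rmult_le_pos; [apply/w0_ge0/(core_exterior n Rr) | case: (phi1 x)].
    by rewrite -/(phi x) phi0// Rmult_0_r; lra.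
  have rT : / r ^ n <= T / rho ^ n.
    have -> : T / rho ^ n = / (rho / 2 ^ m.-1) ^ n.
      rewrite /T /Rdiv Rpow_mult_distr pow_inv.
      have -> : 2 ^ (m.-1 * n) = (2 ^ m.-1) ^ n.
        by elim: (n) => [|j IH]; [rewrite muln0 | rewrite mulnS pow_add IH].
      have ? : 2 ^ m.-1 <> 0 by apply: pow_nonzero; lra.
      have ? : (2 ^ m.-1) ^ n <> 0 by apply: pow_nonzero.
      by field; repeat split; lra.
    by apply: Rinv_le_contravar; [apply: pow_lt | apply: pow_incr; lra].
  have Y0 : 0 <= C1 * (Rr ^ n * Rr ^ (2 * m.-1)).
    by apply: Rmult_le_pos; [lra | apply: Rmult_le_pos; apply: pow_le; lra].
  apply: (Rle_trans _ (/ r ^ n * (C1 * (Rr ^ n * Rr ^ (2 * m.-1))))).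
    by apply: Rmult_le_compat_l => //; lra.
  have := Rmult_le_compat_r _ _ _ Y0 rT.
  by have -> : T / rho ^ n * (C1 * (Rr ^ n * Rr ^ (2 * m.-1))) = S by [rewrite /S; field; lra].
rewrite -nE in key.
have yu : 1/4 < sqdist origin y0.
  by apply: core_u; rewrite sqdist_self; have := pow2_ge_0 rho; lra.
have w0 := w0_ge0 y0 yu; have [mk _] := mb y0.
apply: (Rmult_le_reg_l k0) => //.
have -> : k0 * (C2 * C3 / k0 * (Rr ^ n * Rr ^ (2 * m.-1) / rho ^ n + Rr ^ (n - 2) / a ^ (n - 2 * m))) =
  C2 * (C3 * (Rr ^ n * Rr ^ (2 * m.-1) / rho ^ n) + C3 * (X / a ^ (n - 2 * m))).
  by rewrite /X; field; repeat split; try lra; apply: pow_nonzero; lra.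
apply: (Rle_trans _ (mass n y0 * w 0 y0)); first by apply: Rmult_le_compat_r.
apply: Rle_trans key _; apply: Rmult_le_compat_l; first lra.
have s0 : 0 <= Rr ^ n * Rr ^ (2 * m.-1) / rho ^ n.
  apply: Rmult_le_pos; last by apply/Rlt_le/Rinv_0_lt_compat.
  by apply: Rmult_le_pos; apply: pow_le; lra.
have x0 : 0 <= X / a ^ (n - 2 * m).
  by apply: Rmult_le_pos; [lra | apply/Rlt_le/Rinv_0_lt_compat/pow_lt].
have kk : 0 <= k1 * 2 ^ n by apply: Rmult_le_pos; lra.
have ct : 0 <= C1 * T by apply: Rmult_le_pos; lra.
apply: Rplus_le_compat.
  by rewrite /S /C3; apply: Rmult_le_compat_r => //; lra.
have -> : B / a ^ (n - 2 * m) = (C1 + k1 * 2 ^ n) * (X / a ^ (n - 2 * m)).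
  by rewrite /B; field; apply: pow_nonzero; lra.
by rewrite /C3; apply: Rmult_le_compat_r => //; lra.
Qed.

End local_estimate.

(** * The growth estimate *)

(** On [0, T] continuity bounds f, extended evenly to the line by [Rabs]. With 1 + t the power is at
    least 1 and absorbs that bound. *)
Lemma growth_bound (f : R -> R) (sigma : R) :
  (forall t, 0 <= t -> forall eps, 0 < eps -> exists delta, 0 < delta /\
     forall s, 0 <= s -> Rabs (s - t) < delta -> Rabs (f s - f t) < eps) ->
  (exists C T, 0 < T /\ forall t, T <= t -> Rabs (f t) <= C * Rpower t sigma) ->
  0 < sigma -> exists C, 0 < C /\ forall t, 0 <= t -> f t <= C * Rpower (1 + t) sigma.
Proof.
move=> cf [C [T [T0 HT]]] s0.
have cc t : 0 <= t <= T -> continuity_pt (fun t => f (Rabs t)) t.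
  move=> _ eps e0; have [d [d0 Hd]] := cf (Rabs t) (Rabs_pos t) eps e0.
  exists d; split=> // u [_ ut]; apply: Hd; first exact: Rabs_pos.
  by apply: Rle_lt_trans ut; apply: Rabs_triang_inv2.
have [x [Hx _]] := continuity_ab_maj (fun t => f (Rabs t)) 0 T (Rlt_le _ _ T0) cc.
set F := f (Rabs x) in Hx; have F0 := Rabs_pos F; have C0 := Rabs_pos C.
exists (Rabs C + Rabs F + 1); split; first lra.
move=> t t0; have p1 : 1 <= Rpower (1 + t) sigma.
  by rewrite -[X in X <= _](Rpower_O (1 + t)); [apply: Rle_Rpower; lra | lra].
case: (Rle_lt_dec t T) => tT.
  by have := Hx t (conj t0 tT); rewrite Rabs_right; [have := Rle_abs F; nra | lra].
apply: Rle_trans (Rle_abs _) _; apply: Rle_trans (HT t (Rlt_le _ _ tT)) _.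
have p2 : Rpower t sigma <= Rpower (1 + t) sigma by apply: Rle_Rpower_l; lra.
have p3 : 0 < Rpower t sigma by apply: exp_pos.
by have := Rle_abs C; nra.
Qed.

Lemma near_maximizer (T : Type) (P : T -> Prop) (F : T -> R) (x0 : T) (M : R) :
  P x0 -> 0 < F x0 -> (forall x, P x -> F x <= M) ->
  exists y, P y /\ forall x, P x -> F x <= 2 * F y.
Proof.
move=> P0 F0 FM; pose E z := exists x, P x /\ z = F x.
have bE : bound E by exists M => z [x [Px ->]]; apply: FM.
have exE : exists z, E z by exists (F x0), x0.
have [l [ub lub]] := completeness E bE exE.
have l0 : F x0 <= l by apply: ub; exists x0.
apply: Classical_Prop.NNPP => H.
have : l <= l / 2; last lra.
apply: lub => z [x [Px ->]]; apply: Rnot_lt_le => lx; apply: H.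
exists x; split=> // y Py; have : F y <= l by apply: ub; exists y.
lra.
Qed.

Lemma pow_Rpower (x : R) k : 0 < x -> x ^ k = Rpower x (INR k).
Proof. by move=> x0; rewrite Rpower_pow. Qed.

(* a is the scale at which the two bounds G0 r^n and X on the flux agree. *)
Lemma optimal_scale (n k : nat) (X G0 : R) : (0 < n)%N -> (k <= n)%N -> 0 < X -> 0 < G0 ->
  exists a, [/\ 0 < a, G0 * a ^ n = X &
    X / a ^ (n - k) = Rpower X (INR k / INR n) * Rpower G0 (INR (n - k) / INR n)].
Proof.
move=> n0 kn X0 G00; have N0 : 0 < INR n by apply/lt_0_INR/ltP.
have a0 : 0 < Rpower (X / G0) (/ INR n) by apply: exp_pos.
have XG : 0 < X / G0 by apply: Rdiv_lt_0_compat.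
exists (Rpower (X / G0) (/ INR n)); split=> //.
  rewrite pow_Rpower// Rpower_mult Rinv_l; last lra.
  by rewrite Rpower_1//; field; lra.
have nk : INR (n - k) = INR n - INR k by rewrite minus_INR //; apply/leP.
rewrite pow_Rpower// Rpower_mult nk /Rdiv -Rpower_Ropp.
rewrite -[X in X * _](exp_ln X)// /Rpower -!exp_plus; congr exp.
rewrite ln_mult//; last by apply: Rinv_0_lt_compat.
by rewrite ln_Rinv//; field; lra.
Qed.

(** * Absorbing the sublinear power of M *)

Section absorption.
Variables (m n : nat) (sigma : R).
Hypotheses (m0 : (0 < m)%N) (m2n : (2 * m < n)%N).
Hypotheses (s0 : 0 < sigma) (s1 : sigma < INR n / (INR n - 2 * INR m)).

Lemma dim_gap : 0 < INR n - 2 * INR m.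
Proof.
have := lt_INR _ _ (ltP m2n); rewrite mult_INR.
by rewrite [INR 2]/=; lra.
Qed.

Lemma subcritical : 0 < INR n - sigma * (INR n - 2 * INR m).
Proof.
have g := dim_gap; have := Rmult_lt_compat_r _ _ _ g s1.
have -> : INR n / (INR n - 2 * INR m) * (INR n - 2 * INR m) = INR n by field; lra.
lra.
Qed.

Let b := 2 * INR m * (INR n - 2) / (INR n - sigma * (INR n - 2 * INR m)).

(** After dropping the nonnegative sigma term this is (m - 1) n <= m (n - 2), that is 2m <= n. It
    places the L^1 contribution R^(2m-2) below R^b. *)
Lemma exponent_ge : 2 * (INR m - 1) <= b.
Proof.
have g := dim_gap; have sc := subcritical.
have m1 : 1 <= INR m by apply: (le_INR 1); apply/leP.
apply: (proj1 (Rle_div_r _ _ _ sc)).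
have : 0 <= (INR m - 1) * (sigma * (INR n - 2 * INR m)).
  by apply: Rmult_le_pos; [lra | apply: Rmult_le_pos; lra].
nra.
Qed.

Lemma exponent_ge0 : 0 <= b.
Proof.
have m1 : 1 <= INR m by apply: (le_INR 1); apply/leP.
by have := exponent_ge; lra.
Qed.

(** Split by the larger of the two terms. If the first wins, [exponent_ge] concludes; if the second
    wins, M^(1-theta) <= 2 C Y, and the power 1/(1-theta) turns the exponent (n-2) 2m/n of R into
    exactly b. *)
Lemma absorption C : 0 < C -> exists C', 0 < C' /\ forall Rr omega M,
  1 <= Rr -> 0 < omega <= Rr -> 1 <= M ->
  M <= C * (Rr ^ n * Rr ^ (2 * m.-1) / omega ^ n +
    Rpower Rr ((INR n - 2) * (2 * INR m / INR n)) *
    Rpower M (sigma * ((INR n - 2 * INR m) / INR n))) ->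
  M * omega ^ n <= C' * (Rr ^ n * Rpower Rr b).
Proof.
move=> C0; have g := dim_gap; have sc := subcritical.
have m1 : 1 <= INR m by apply: (le_INR 1); apply/leP.
have N0 : 0 < INR n by lra.
set theta := sigma * _.
have th1 : 0 < 1 - theta.
  have -> : 1 - theta = (INR n - sigma * (INR n - 2 * INR m)) / INR n by rewrite /theta; field; lra.
  exact: Rdiv_lt_0_compat.
pose C1 := Rpower (2 * C) (/ (1 - theta)); have C10 : 0 < C1 by apply: exp_pos.
exists (2 * C + C1); split; first lra.
move=> Rr omega M R1 [o0 oR] M1; set Y := Rpower Rr _ => H.
have on : 0 < omega ^ n by apply: pow_lt.
have Rn : 0 < Rr ^ n by apply: pow_lt; lra.
have onR : omega ^ n <= Rr ^ n by apply: pow_incr; lra.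
have Rb : 0 < Rpower Rr b by apply: exp_pos.
have Y0 : 0 < Y by apply: exp_pos.
have Mt : 0 < Rpower M theta by apply: exp_pos.
set A := Rr ^ n * Rr ^ (2 * m.-1) / omega ^ n in H.
have Z0 : 0 < Rr ^ n * Rpower Rr b by apply: Rmult_lt_0_compat.
case: (Rle_lt_dec (Y * Rpower M theta) A) => YA.
  have : M * omega ^ n <= 2 * C * (Rr ^ n * Rr ^ (2 * m.-1)).
    have -> : 2 * C * (Rr ^ n * Rr ^ (2 * m.-1)) = (2 * C * A) * omega ^ n.
      by rewrite /A; field; lra.
    by apply: Rmult_le_compat_r; [lra | nra].
  have : Rr ^ (2 * m.-1) <= Rpower Rr b.
    rewrite pow_Rpower; last lra.
    apply: Rle_Rpower => //; rewrite mult_INR -subn1 minus_INR; last exact/leP.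
    by rewrite [INR 2]/= [INR 1]/=; have := exponent_ge; lra.
  move/(Rmult_le_compat_l _ _ _ (Rlt_le _ _ Rn)) => h1 h2; nra.
have MY : M <= 2 * C * Y * Rpower M theta by nra.
have ME : M = Rpower M (1 - theta) * Rpower M theta.
  by rewrite -Rpower_plus (_ : 1 - theta + theta = 1) ?Rpower_1; lra || ring.
have M2 : Rpower M (1 - theta) <= 2 * C * Y.
  by apply: (Rmult_le_reg_r (Rpower M theta)) => //; rewrite -ME.
have M3 : M <= C1 * Rpower Rr b.
  have -> : C1 * Rpower Rr b = Rpower (2 * C * Y) (/ (1 - theta)).
    rewrite -Rpower_mult_distr//; last lra.
    congr (_ * _); rewrite /Y Rpower_mult; congr Rpower.
    by rewrite /b /theta; field; repeat split; lra.
  have {1}-> : M = Rpower (Rpower M (1 - theta)) (/ (1 - theta)).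
    by rewrite Rpower_mult Rinv_r ?Rpower_1; lra.
  apply: Rle_Rpower_l; first by apply/Rlt_le/Rinv_0_lt_compat.
  by split=> //; apply: exp_pos.
have : M * omega ^ n <= C1 * Rpower Rr b * Rr ^ n by apply: Rmult_le_compat; lra.
nra.
Qed.

End absorption.

(** * Localising near a weighted maximum *)

Section doubling.
Variable n : nat.
Local Notation sqdist := (sqdist n).
Local Notation origin := (origin n).

(* A substitute for the distance from x to the sphere of radius Rr around y that
   only involves squared distances. *)
Definition depth (Rr : R) (y x : pt n) := (Rr ^ 2 - sqdist y x) / Rr.

Lemma depth_range Rr y x : 0 < Rr -> sqdist y x < Rr ^ 2 -> 0 < depth Rr y x <= Rr.
Proof.
move=> R0 h; split; first by apply: Rdiv_lt_0_compat; lra.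
by apply/Rle_div_l => //; have := sqdist_ge0 n y x; nra.
Qed.

Lemma depth_half Rr y y0 x : 0 < Rr -> sqdist y y0 < Rr ^ 2 ->
  sqdist y0 x <= 4 * (depth Rr y y0 / 10) ^ 2 ->
  sqdist y x < Rr ^ 2 /\ depth Rr y y0 / 2 <= depth Rr y x.
Proof.
move=> R0 h0 hx; have [w0 wR] := depth_range Rr y y0 R0 h0.
set w := depth Rr y y0 in w0 wR hx *.
(* With e = w/(4R), the two error terms of [sqdist_split] are at most wR/4 and wR/5; together they
   stay below wR/2, half of the gap R^2 - |y0 - y|^2 = wR. *)
have e0 : 0 < w / (4 * Rr) by apply: Rdiv_lt_0_compat; lra.
have := sqdist_split n _ y y0 x e0.
have -> : / (w / (4 * Rr)) = 4 * Rr / w by field; lra.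
have q0 := sqdist_ge0 n y y0; have wE : w * Rr = Rr ^ 2 - sqdist y y0.
  by rewrite /w /depth; field; lra.
move=> h.
have h1 : w / (4 * Rr) * sqdist y y0 <= w * Rr / 4.
  have -> : w * Rr / 4 = w / (4 * Rr) * Rr ^ 2 by field; lra.
  by apply: Rmult_le_compat_l; lra.
have h2 : (1 + 4 * Rr / w) * sqdist y0 x <= w * Rr / 5.
  have k : 1 + 4 * Rr / w <= 5 * Rr / w.
    have -> : 5 * Rr / w = Rr / w + 4 * Rr / w by field; lra.
    suff : 1 <= Rr / w by lra.
    by apply/Rle_div_r => //; lra.
  have -> : w * Rr / 5 = (5 * Rr / w) * (4 * (w / 10) ^ 2) by field; lra.
  apply: Rmult_le_compat => //; last exact: sqdist_ge0.
  by have : 0 < 4 * Rr / w by [apply: Rdiv_lt_0_compat; lra]; lra.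
have h3 : sqdist y x <= Rr ^ 2 - w * Rr / 2 by lra.
have wr : 0 < w * Rr by apply: Rmult_lt_0_compat.
split; first lra.
by rewrite [depth Rr y x]/depth; apply: (proj1 (Rle_div_r _ _ _ R0)); lra.
Qed.

Lemma ball_in_core Rr (y x : pt n) : sqdist origin y = 16 * Rr ^ 2 ->
  sqdist y x < Rr ^ 2 -> core n Rr x.
Proof.
move=> hy hx; split.
  by have := sqdist_split n 1 origin x y ltac:(lra); rewrite Rinv_1 (sqdist_sym _ x); lra.
by have := sqdist_split n 1 origin y x ltac:(lra); rewrite Rinv_1; lra.
Qed.

End doubling.

Theorem theorem1p14 (m n : nat) (f : R -> R) (sigma : R)
  (v : pt n -> R) (D : seq 'I_n -> pt n -> R) :
  (3 <= m)%nat -> odd m -> (2 * m < n)%nat ->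
  (* f : [0,oo) -> [0,oo) continuous *)
  (forall t, 0 <= t -> 0 <= f t) ->
  (forall t, 0 <= t -> forall eps, 0 < eps -> exists delta, 0 < delta /\
     forall s, 0 <= s -> Rabs (s - t) < delta -> Rabs (f s - f t) < eps) ->
  (* f(t) = O(t^sigma) as t -> oo *)
  (exists C T, 0 < T /\ forall t, T <= t -> Rabs (f t) <= C * Rpower t sigma) ->
  0 < sigma -> sigma < INR n / (INR n - 2 * INR m) ->
  (* v is C^{2m} on R^n \ B_{1/2}(0), with derivatives D *)
  partials_upto (2 * m) (fun y => 1/2 < enorm y) v D ->
  (forall y, 1/2 < enorm y -> 0 <= v y) ->
  (forall y, 1/2 < enorm y -> 0 <= - lap_iter D m y /\ - lap_iter D m y <= f (v y)) ->
  exists C R0, forall y, R0 <= enorm y ->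
    Rabs (v y) <= C * Rpower (enorm y)
      (2 * INR m * (INR n - 2) / (INR n - sigma * (INR n - 2 * INR m))).
Proof.
move=> m3 modd m2n f0 cf fO s0 s1 vD v0 vm.
have m0 : (0 < m)%N by apply: leq_trans m3.
have n3 : (3 <= n)%N by lia.
pose w := lap n D; pose dw := dlap n D.
have vw x : 1/4 < sqdist n (origin n) x -> w 0%N x = v x.
  by move=> xu; case: vD => E _; apply/E/exterior_sqdist.
have wC2 k : (k < m)%N -> C2_on n (1/4) (w k) (dw k) (w k.+1) by apply: (lap_C2 n m v).
have wcont k x : (k <= m)%N -> 1/4 < sqdist n (origin n) x -> continuous (w k) x.
  exact: (lap_continuous n m v).
have w0 x : 1/4 < sqdist n (origin n) x -> 0 <= w 0%N x.
  by move=> xu; rewrite vw//; apply/v0/exterior_sqdist.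
have wm0 x : 1/4 < sqdist n (origin n) x -> w m x <= 0.
  move=> xu; have h : 0 <= - w m x := proj1 (vm x (proj2 (exterior_sqdist n x) xu)).
  lra.
have [Cf [Cf0 Hf]] := growth_bound f sigma cf fO s0.
have [C1 [C10 H1]] := local_estimate n m w dw modd m2n n3 wC2 wcont w0 wm0.
pose kappa := (INR n - 2 * INR m) / INR n.
(* Makes the kappa-th power of G0 = Cf (2^(n+1) M)^sigma equal to C2 M^(sigma kappa). *)
pose C2 := Rpower (Cf * Rpower (2 ^ n.+1) sigma) kappa.
have C20 : 0 < C2 by apply: exp_pos.
have t10 : 0 < 10 ^ n by apply: pow_lt; lra.
have [C3 [C30 H3]] := absorption m n sigma m0 m2n s0 s1 (C1 * (10 ^ n + C2) + 1) ltac:(nra).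
set b := 2 * INR m * (INR n - 2) / _ in H3 *.
have b0 : 0 <= b by apply: exponent_ge0.
(* From |y| >= 4 on, Rr = |y|/4 is at least 1, as the exterior estimates require. *)
exists (2 * C3), 4 => y y4.
have e0 : 0 < enorm y by lra.
pose Rr := enorm y / 4; have R1 : 1 <= Rr by rewrite /Rr; lra.
have yR : sqdist n (origin n) y = 16 * Rr ^ 2.
  rewrite /Rr enorm_sqdist; have := sqrt_sqrt _ (sqdist_ge0 n (origin n) y).
  by set s := sqrt _ => <-; field.
have R0 : 0 < Rr by lra.
have Rn : 0 < Rr ^ n by apply: pow_lt.
have R2 : 1 <= Rr ^ 2 by apply: pow_R1_Rle.
have inU x : sqdist n y x < Rr ^ 2 -> 1/4 < sqdist n (origin n) x.
  by move=> h; apply: (core_exterior n Rr) => //; apply: ball_in_core h.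
(* The summand 1 makes F positive at y and gives M >= 1; it also matches the power of 1 + t in the
   growth bound. *)
pose F x := (1 + w 0%N x) * depth n Rr y x ^ n.
have yy : sqdist n y y < Rr ^ 2 by rewrite sqdist_self; lra.
have dy : depth n Rr y y = Rr by rewrite /depth sqdist_self; field; lra.
have [W [W0 HW]] := shell_bounded n (7 * Rr ^ 2) (34 * Rr ^ 2) (w 0%N)
  (fun x xs => wcont 0%N x (leq0n m) (core_exterior n Rr x R1 xs)).
have [y0 [y0b Hy0]] : exists y0, sqdist n y y0 < Rr ^ 2 /\
    forall x, sqdist n y x < Rr ^ 2 -> F x <= 2 * F y0.
  apply: (near_maximizer _ _ _ y ((1 + W) * Rr ^ n)) => //.
    by rewrite /F dy; apply: Rmult_lt_0_compat => //; have := w0 y (inU y yy); lra.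
  move=> x xb; have [d1 d2] := depth_range n Rr y x R0 xb.
  have := HW x (ball_in_core n Rr y x yR xb); have := Rle_abs (w 0%N x) => ? ?.
  have := w0 x (inU x xb) => ?.
  apply: Rmult_le_compat; [lra | apply: pow_le; lra | lra | apply: pow_incr; lra].
have [om0 omR] := depth_range n Rr y y0 R0 y0b.
set om := depth n Rr y y0 in om0 omR.
pose M := 1 + w 0%N y0.
have M1 : 1 <= M by have := w0 y0 (inU y0 y0b); rewrite /M; lra.
have on : 0 < om ^ n by apply: pow_lt.
(* By [depth_half] the weight is still at least (om/2)^n on this ball, so near-maximality costs 2
   times 2^n. *)
have ball x : sqdist n y0 x <= 4 * (om / 10) ^ 2 ->
    sqdist n y x < Rr ^ 2 /\ 1 + w 0%N x <= 2 ^ n.+1 * M.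
  move=> xb; have [xR dx] := depth_half n Rr y y0 x R0 y0b xb; split=> //.
  have p : (om / 2) ^ n <= depth n Rr y x ^ n by apply: pow_incr; rewrite -/om in dx; lra.
  have := Hy0 x xR; rewrite /F -/om -/M => h.
  have w1 := w0 x (inU x xR).
  apply: (Rmult_le_reg_r ((om / 2) ^ n)); first by apply: pow_lt; lra.
  have -> : 2 ^ n.+1 * M * (om / 2) ^ n = 2 * (M * om ^ n).
    rewrite /Rdiv Rpow_mult_distr pow_inv -[2 ^ n.+1]/(2 * 2 ^ n); field.
    by apply: pow_nonzero; lra.
  by apply: Rle_trans h; apply: Rmult_le_compat_l; lra.
pose G0 := Cf * Rpower (2 ^ n.+1 * M) sigma.
have G00 : 0 < G0 by apply: Rmult_lt_0_compat => //; apply: exp_pos.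
have t2 : 0 < 2 ^ n.+1 by apply: pow_lt; lra.
have gG x : sqdist n y0 x <= 4 * (om / 10) ^ 2 -> - w m x <= G0.
  move=> /ball [xR xM]; have xu := inU x xR; have w1 := w0 x xu.
  have [_ h] := vm x (proj2 (exterior_sqdist n x) xu).
  apply: Rle_trans h _; rewrite -vw//; apply: Rle_trans (Hf _ w1) _.
  by apply: Rmult_le_compat_l; [lra | apply: Rle_Rpower_l; lra].
have n0 : (0 < n)%N by apply: leq_trans n3.
have X0 : 0 < Rr ^ (n - 2) by apply: pow_lt.
have [a [a0 Ga Xa]] := optimal_scale n (2 * m) _ _ n0 (ltnW m2n) X0 G00.
have est := H1 Rr (om / 10) a G0 y0 R1 ltac:(lra) a0 G00
  (fun x xb => ball_in_core n Rr y x yR (proj1 (ball x xb))) gG Ga.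
have N0 : 0 < INR n by apply/lt_0_INR/ltP.
have nm : INR (n - 2 * m) = INR n - 2 * INR m.
  by rewrite minus_INR ?mult_INR; [rewrite [INR 2]/= | apply/leP/ltnW].
have n2 : INR (n - 2) = INR n - 2 by rewrite minus_INR; [|apply/leP; lia].
have XE : Rr ^ (n - 2) / a ^ (n - 2 * m) =
    C2 * (Rpower Rr ((INR n - 2) * (2 * INR m / INR n)) * Rpower M (sigma * kappa)).
  have GE : Rpower G0 kappa = C2 * Rpower M (sigma * kappa).
    rewrite /G0 -(Rpower_mult_distr (2 ^ n.+1) M sigma)//; last lra.
    rewrite -Rmult_assoc -(Rpower_mult_distr (Cf * Rpower (2 ^ n.+1) sigma)) ?Rpower_mult//.
      by apply: Rmult_lt_0_compat => //; apply: exp_pos.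
    exact: exp_pos.
  by rewrite Xa nm -/kappa GE pow_Rpower// Rpower_mult n2 mult_INR (_ : INR 2 = 2)//; ring.
rewrite XE in est.
have oE : (om / 10) ^ n = om ^ n / 10 ^ n by rewrite /Rdiv Rpow_mult_distr pow_inv.
set Y := Rpower Rr _ * Rpower M _ in est.
have Y0 : 0 < Y by apply: Rmult_lt_0_compat; apply: exp_pos.
pose A := Rr ^ n * Rr ^ (2 * m.-1) / om ^ n.
have Rm : 1 <= Rr ^ (2 * m.-1) by apply: pow_R1_Rle.
have A1 : 1 <= A.
  apply/Rle_div_r => //; have : om ^ n <= Rr ^ n by apply: pow_incr; lra.
  nra.
(* The final 1 in the constant pays for the 1 in M = 1 + v(y0), because A >= 1. *)
have est2 : M <= (C1 * (10 ^ n + C2) + 1) * (A + Y).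
  have AE : Rr ^ n * Rr ^ (2 * m.-1) / (om / 10) ^ n = 10 ^ n * A.
    by rewrite oE /A; field; lra.
  rewrite AE in est; rewrite /M.
  have c1 : 0 <= C1 * (C2 * A) by apply: Rmult_le_pos; [lra | apply: Rmult_le_pos; lra].
  have c2 : 0 <= C1 * (10 ^ n * Y) by apply: Rmult_le_pos; [lra | apply: Rmult_le_pos; lra].
  lra.
have := H3 Rr om M R1 (conj om0 omR) M1 est2 => fin.
(* The depth at y itself is Rr, so both sides carry Rr^n, which cancels to leave a bound on v(y). *)
have := Hy0 y yy; rewrite /F dy -/om -/M => h.
have vy : 0 <= w 0%N y by apply: w0; apply: inU.
have hh : w 0%N y * Rr ^ n <= 2 * C3 * Rpower Rr b * Rr ^ n by nra.
rewrite -vw; last exact: inU.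
rewrite Rabs_right; last lra.
apply: (Rle_trans _ (2 * C3 * Rpower Rr b)); first exact: Rmult_le_reg_r Rn hh.
apply: Rmult_le_compat_l; first lra.
by apply: Rle_Rpower_l => //; split=> //; rewrite /Rr; lra.
Qed.
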